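(* Let $n\ge 1$. For every dominant coweight $\lambda$ of $\mathrm{GL}_n(\mathbb{C})$, the global Schubert variety $\overline{\mathbf{Gr}_\lambda}$ and the closed subset $X_\lambda$ of the global affine Grassmannian $\mathbf{Gr}$ coincide: $$\overline{\mathbf{Gr}_\lambda} = X_\lambda .$$
   Context: Let $n\ge 1$, $\mathbb{K}=\mathbb{C}((t))$, $\mathbb{O}=\mathbb{C}[[t]]$. A coweight is an element $\lambda=(\lambda_1,\dots,\lambda_n)\in\mathbb{Z}^n$; it is dominant if $\lambda_1\ge\cdots\ge\lambda_n$. Write $\mathbf{t}^\lambda=\mathrm{diag}(t^{\lambda_1},\dots,t^{\lambda_n})$. A lattice is a free $\mathbb{O}$-submodule $L\subset\mathbb{K}^n$ of rank $n$. Its valuation $\nu(L)\in\mathbb{Z}$ is the integer such that, for any $\mathbb{O}$-basis $f_1,\dots,f_n$ of $L$, $\det[f_1\cdots f_n]=t^{\nu(L)}\cdot(\text{unit of }\mathbb{O})$. The affine Grassmannian $\mathcal{G}r=\mathrm{GL}_n(\mathbb{K})/\mathrm{GL}_n(\mathbb{O})$ is the set of all lattices, with its standard structure of ind-projective ind-variety over $\mathbb{C}$ (the increasing union over $N$ of the sets of lattices $L$ with $t^N\mathbb{O}^n\subset L\subset t^{-N}\mathbb{O}^n$, each identified with the closed subvariety of $t$-stable subspaces in the union of the Grassmannians of subspaces of $t^{-N}\mathbb{O}^n/t^N\mathbb{O}^n$). For dominant $\lambda$, put $\mathbf{L}^\lambda=\mathbf{t}^\lambda\mathbb{O}^n$,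 $\mathcal{G}r_\lambda=\mathrm{GL}_n(\mathbb{O})\cdot\mathbf{L}^\lambda$, and let $\overline{\mathcal{G}r_\lambda}$ be its closure in $\mathcal{G}r$. For $0\le i\le n$ and $y\in\mathbb{C}$, let $\theta_i(y):\mathbb{K}^n\to\mathbb{K}^n$ be the linear map multiplying the first $i$ coordinates by $t-y$ and fixing the others. The global affine Grassmannian $\mathbf{Gr}\subset\mathbb{C}\times\mathcal{G}r\times\cdots\times\mathcal{G}r$ ($n$ copies of $\mathcal{G}r$), with the induced ind-variety structure, is the set of tuples $(y,L_1,\dots,L_n)$ such that $\nu(L_1)=\cdots=\nu(L_n)$ and $$L_1\supset\theta_1(y)(L_2)\supset\theta_2(y)(L_3)\supset\cdots\supset\theta_{n-1}(y)(L_n)\supset(t-y)L_1 .$$ For $y\ne0$ all these containments are equalities, and the part $\mathbf{Gr}_{\boldsymbol\eta}$ of $\mathbf{Gr}$ where $y\neq 0$ is identified with $\mathbb{C}^\times\times\mathcal{G}r$ via $(y,L_1,\dots,L_n)\mapsto(y,L_1)$. The global Schubert variety $\overline{\mathbf{Gr}_\lambda}$ is the closure in $\mathbf{Gr}$ of $\mathbb{C}^\times\times\mathcal{G}r_\lambda\subset\mathbf{Gr}_{\boldsymbol\eta}$. Finally, $$X_\lambda=\{(y,L_1,\dots,L_n)\in\mathbf{Gr}\mid L_1,\dots,L_n\in\overline{\mathcal{G}r_\lambda}\}.$$ *)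

(* Defs.v *)
From HB Require Import structures.
From mathcomp Require Import all_boot all_order all_algebra.
From mathcomp Require Import boolp classical_sets reals.
From mathcomp Require Export complex.
From mathcomp Require Import -(notations) mpoly.

Set Implicit Arguments.
Unset Strict Implicit.
Unset Printing Implicit Defensive.

Import Order.TTheory GRing.Theory Num.Theory.
Local Open Scope classical_set_scope.
Local Open Scope ring_scope.

Record fps (R : Type) := Fps { fcoef : nat -> R }.

HB.instance Definition _ (R : Type) := gen_eqMixin (fps R).
HB.instance Definition _ (R : Type) := gen_choiceMixin (fps R).

Lemma fpsP (R : Type) (f g : fps R) : (forall k, fcoef f k = fcoef g k) -> f = g.
Proof. by case: f g => [f] [g] /= fg; congr Fps; apply/funext. Qed.

Section FpsRing.
Variable R : comNzRingType.
Implicit Types f g h : fps R.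

Definition fps_zero : fps R := Fps (fun=> 0).
Definition fps_opp f := Fps (fun k => - fcoef f k).
Definition fps_add f g := Fps (fun k => fcoef f k + fcoef g k).
Definition fps_const (c : R) := Fps (fun k => if k == 0%N then c else 0).
Definition fps_var : fps R := Fps (fun k => if k == 1%N then 1 else 0).
Definition fps_mul f g :=
  Fps (fun k => \sum_(j < k.+1) fcoef f j * fcoef g (k - j)).

Fact fps_addA : associative fps_add.
Proof. by move=> f g h; apply: fpsP => k /=; rewrite addrA. Qed.
Fact fps_addC : commutative fps_add.
Proof. by move=> f g; apply: fpsP => k /=; rewrite addrC. Qed.
Fact fps_add0 : left_id fps_zero fps_add.
Proof. by move=> f; apply: fpsP => k /=; rewrite add0r. Qed.
Fact fps_addN : left_inverse fps_zero fps_opp fps_add.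
Proof. by move=> f; apply: fpsP => k /=; rewrite addNr. Qed.

HB.instance Definition _ :=
  GRing.isZmodule.Build (fps R) fps_addA fps_addC fps_add0 fps_addN.

Definition fps_trunc m f : {poly R} := \poly_(i < m) fcoef f i.

Fact coef_trunc_mul m f g k : (k < m)%N ->
  (fps_trunc m f * fps_trunc m g)`_k = fcoef (fps_mul f g) k.
Proof.
move=> km; rewrite coefM; apply: eq_bigr => j _; rewrite !coef_poly.
by rewrite (leq_ltn_trans _ km) ?(leq_ltn_trans (leq_subr _ _) km) // -ltnS.
Qed.

Fact fps_mulC : commutative fps_mul.
Proof.
by move=> f g; apply: fpsP => k; rewrite -!(@coef_trunc_mul k.+1) // mulrC.
Qed.

Fact fps_mulA : associative fps_mul.
Proof.
move=> f g h; apply: fpsP => k.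
have mulE u v i : (i <= k)%N ->
    fcoef (fps_mul u v) i = (fps_trunc k.+1 u * fps_trunc k.+1 v)`_i.
  by move=> ik; rewrite coef_trunc_mul.
transitivity (fps_trunc k.+1 f * fps_trunc k.+1 g * fps_trunc k.+1 h)`_k.
  rewrite -mulrA coefM; apply: eq_bigr => j _.
  by rewrite mulE ?leq_subr // coef_poly ltn_ord.
rewrite coefM; apply: eq_bigr => j _.
rewrite mulE; last by rewrite -ltnS.
by rewrite coef_poly ltnS leq_subr.
Qed.

Fact fps_mul1 : left_id (fps_const 1) fps_mul.
Proof.
move=> f; apply: fpsP => k /=; rewrite big_ord_recl /= subn0 mul1r big1 ?addr0 //.
by move=> i _; rewrite /= mul0r.
Qed.

Fact fps_mulDl : left_distributive fps_mul fps_add.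
Proof.
move=> f g h; apply: fpsP => k /=; rewrite -big_split /=.
by apply: eq_bigr => i _; rewrite mulrDl.
Qed.

Fact fps_one_neq0 : fps_const 1 != 0 :> fps R.
Proof. by apply/eqP => /(congr1 (fun f => fcoef f 0)) /eqP; rewrite /= oner_eq0. Qed.

HB.instance Definition _ := GRing.Zmodule_isComNzRing.Build (fps R)
  fps_mulA fps_mulC fps_mul1 fps_mulDl fps_one_neq0.

Definition fps_unit : {pred fps R} := fun f => `[< exists g, g * f = 1 >].
Definition fps_inv f := if f \in fps_unit then xget 0 [set g | g * f = 1] else f.

Fact fps_mulVf : {in fps_unit, left_inverse 1 fps_inv *%R}.
Proof.
move=> f fU; rewrite /fps_inv fU; move/asboolP: fU => fU.
exact: (@xgetPex _ 0 [set g | g * f = 1] fU).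
Qed.
Fact fps_unitP f g : g * f = 1 -> fps_unit f.
Proof. by move=> gf; apply/asboolP; exists g. Qed.
Fact fps_invout : {in [predC fps_unit], fps_inv =1 id}.
Proof. by move=> f /negbTE fU; rewrite /fps_inv fU. Qed.

HB.instance Definition _ := GRing.ComNzRing_hasMulInverse.Build (fps R)
  fps_mulVf fps_unitP fps_invout.

End FpsRing.

Section FpsDomain.
Variable R : idomainType.

Fact fps_order (f : fps R) : f != 0 ->
  exists2 a, fcoef f a != 0 & forall i, (i < a)%N -> fcoef f i = 0.
Proof.
move=> f0; have ex : exists i, fcoef f i != 0.
  apply: contrapT => nex; case/eqP: f0; apply: fpsP => k /=.
  by apply: contrapT => fk; apply: nex; exists k; apply/eqP.
case: (ex_minnP ex) => a fa amin; exists a => // i; apply: contraTeq => fi.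
by rewrite -leqNgt amin.
Qed.

Fact fps_idomain : GRing.integral_domain_axiom (fps R).
Proof.
move=> f g fg0; apply: contraT; rewrite negb_or => /andP[].
case/fps_order=> a fa fmin /fps_order[b gb gmin].
have : fcoef (f * g) (a + b) = 0 by rewrite fg0.
rewrite /= (bigD1 (inord a)) //= inordK ?ltnS ?leq_addr // addKn big1 => [|i].
  by move/eqP; rewrite addr0 mulf_eq0 (negbTE fa) (negbTE gb).
rewrite -val_eqE /= inordK ?ltnS ?leq_addr // neq_ltn => /orP[/fmin->|ai].
  by rewrite mul0r.
rewrite (gmin (a + b - i)%N) ?mulr0 // ltn_subLR; last by rewrite -ltnS.
by rewrite ltn_add2r.
Qed.

HB.instance Definition _ :=
  GRing.ComUnitRing_isIntegral.Build (fps R) fps_idomain.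

End FpsDomain.

Section Lattices.
Variables (C : fieldType) (n : nat).

Notation O := (fps C).
(* C((t)) is the fraction field of C[[t]] *)
Notation K := {fraction O}.
Notation iota := (map_mx (@tofrac O)).

Definition tK : K := tofrac (fps_var C).

Definition On : set 'cV[K]_n := range (fun f : 'cV[O]_n => iota f).

(* the columns of A form an O-basis of L *)
Definition is_basis (L : set 'cV[K]_n) (A : 'M[K]_n) :=
  L = [set A *m iota a | a in [set: 'cV[O]_n]] /\
  (forall a : 'cV[O]_n, A *m iota a = 0 -> a = 0).

Definition Gr : set (set 'cV[K]_n) := [set L | exists A, is_basis L A].

Definition nu (L : set 'cV[K]_n) : int :=
  xget 0 [set k | forall A, is_basis L A ->
    exists2 u : O, u \is a GRing.unit & \det A = tK ^ k * tofrac u].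

Definition GrN (N : nat) : set (set 'cV[K]_n) :=
  [set L | [/\ Gr L, [set tK ^+ N *: v | v in On] `<=` L
             & L `<=` [set tK ^- N *: v | v in On]]].

(* Coordinates on t^-N O^n / t^N O^n, in the basis of the t^(k - N) e_i with
   i < n and k < 2N, of the class of t^-N f. *)
Definition quo_coord (N : nat) (f : 'cV[O]_n) : 'rV[C]_(n * (N + N)) :=
  mxvec (\matrix_(i < n, k < N + N) fcoef (f i 0) k).

(* the rows of M form a basis of the subspace L / t^N O^n *)
Definition frame (N d : nat) (L : set 'cV[K]_n)
    (M : 'M[C]_(d, n * (N + N))) :=
  row_free M /\
  forall w, (w <= M)%MS <->
    exists2 f : 'cV[O]_n, L (tK ^- N *: iota f) & quo_coord N f = w.

(* All d-tuples of columns, not only the increasing ones, index Pluecker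
   coordinates; the additional ones are zero or equal to the others up to
   sign. *)
Definition plucker (d m : nat) (M : 'M[C]_(d, m)) (s : {ffun 'I_d -> 'I_m}) : C :=
  \det (colsub s M).

Section Polynomials.
Variables (a b m : nat) (d : 'I_b -> nat).

Definition pvar : finType :=
  ('I_a + {i : 'I_b & {ffun 'I_(d i) -> 'I_m}})%type.

Definition in_factor (i : 'I_b) (v : pvar) : bool :=
  if v is inr u then tag u == i else false.

Definition multihomogeneous (F : mpoly #|pvar| C) :=
  forall i : 'I_b, exists e : nat, forall x, x \in msupp F ->
    (\sum_(k < #|pvar| | in_factor i (enum_val k)) x k = e)%N.

Definition peval (y : 'rV[C]_a) (M : forall i, 'M[C]_(d i, m))
    (F : mpoly #|pvar| C) : C :=
  meval (fun k => match enum_val k with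
                        | inl j => y 0 j
                        | inr u => plucker (M (tag u)) (tagged u)
                        end) F.

End Polynomials.

(* Z is closed iff for all N its trace on C^a * (GrN N)^b is closed, where
   GrN N is embedded in the union over d of the Grassmannians of d-dimensional
   subspaces of t^-N O^n / t^N O^n; a closed subset of a product of
   Grassmannians is the zero set of polynomials that are homogeneous in the
   Pluecker coordinates of each factor. *)
Definition zclosed (a b : nat)
    (Z : set ('rV[C]_a * ('I_b -> set 'cV[K]_n))) :=
  Z `<=` [set p | forall i, Gr (p.2 i)] /\
  forall (N : nat) (d : 'I_b -> nat),
  exists2 P : set (mpoly #|pvar a (n * (N + N)) d| C),
    P `<=` @multihomogeneous a b (n * (N + N)) d &
    forall (y : 'rV[C]_a) (L : 'I_b -> set 'cV[K]_n)
           (M : forall i, 'M[C]_(d i, n * (N + N))),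
      (forall i, GrN N (L i) /\ frame (L i) (M i)) ->
      (Z (y, L) <-> forall F, P F -> peval y M F = 0).

Definition closed_Gr (Z : set (set 'cV[K]_n)) :=
  @zclosed 0 1 [set p | Z (p.2 ord0)].

Definition dominant (lambda : 'I_n -> int) :=
  forall i j : 'I_n, (i <= j)%N -> lambda j <= lambda i.

Definition Llambda (lambda : 'I_n -> int) : set 'cV[K]_n :=
  [set diag_mx (\row_i tK ^ lambda i) *m v | v in On].

Definition Gr_orbit (lambda : 'I_n -> int) : set (set 'cV[K]_n) :=
  [set L | exists2 g : 'M[O]_n, g \in unitmx &
     L = [set iota g *m v | v in Llambda lambda]].

Definition Gr_schubert (lambda : 'I_n -> int) : set (set 'cV[K]_n) :=
  smallest closed_Gr (Gr_orbit lambda).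

Definition t_minus (y : C) : K := tofrac (fps_var C - fps_const y).

Definition theta (i : nat) (y : C) (v : 'cV[K]_n) : 'cV[K]_n :=
  \col_(j < n) (if (j < i)%N then t_minus y * v j 0 else v j 0).

(* The tuple (y, L_1, .., L_n) is encoded as (y, L) with L i standing for
   L_(i+1); so the chain reads theta_i (L i) for i = 0, .., n - 1. *)
Definition GGr : set (C * ('I_n -> set 'cV[K]_n)) :=
  [set p | [/\ forall i, Gr (p.2 i),
      forall i j, nu (p.2 i) = nu (p.2 j),
      forall i j : 'I_n, j = i.+1 :> nat ->
        theta j p.1 @` p.2 j `<=` theta i p.1 @` p.2 i
    & forall i j : 'I_n, i.+1 = n -> j = 0%N :> nat ->
        [set t_minus p.1 *: v | v in p.2 j] `<=` theta i p.1 @` p.2 i]].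

Definition closed_GGr (Z : set (C * ('I_n -> set 'cV[K]_n))) :=
  exists2 W : set ('rV[C]_1 * ('I_n -> set 'cV[K]_n)),
    zclosed W & Z = GGr `&` [set p | W (p.1%:M, p.2)].

(* the subset of the part y != 0 of GGr corresponding to C^* * Gr_lambda under
   (y, L_1, .., L_n) |-> (y, L_1) *)
Definition GGr_orbit (lambda : 'I_n -> int) : set (C * ('I_n -> set 'cV[K]_n)) :=
  [set p | [/\ GGr p, p.1 != 0
     & forall i : 'I_n, i = 0%N :> nat -> Gr_orbit lambda (p.2 i)]].

Definition global_schubert (lambda : 'I_n -> int) :=
  smallest closed_GGr (GGr_orbit lambda).

Definition Xlambda (lambda : 'I_n -> int) : set (C * ('I_n -> set 'cV[K]_n)) :=
  [set p | GGr p /\ forall i, Gr_schubert lambda (p.2 i)].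

End Lattices.

(* Main.v *)
Require Import Defs.
From HB Require Import structures.
From mathcomp Require Import all_boot all_order all_algebra.
From mathcomp Require Import boolp classical_sets.
From mathcomp Require Import reals complex.
From mathcomp Require Import -(notations) mpoly.
From mathcomp Require Import fingroup perm zify ring.

(** The closed Schubert variety of lambda consists of the lattices g t^mu O^n with
    g in GL_n(O) and mu below lambda in the dominance order. In terms of the
    function k |-> sum of max(k - mu_c, 0), the hinge of mu, dominance means that
    the hinge of mu is at most that of lambda and that the sums of the entries
    agree. The hinges are ranks of truncations of the lattice, so that dominance
    is given by equations in the Pluecker coordinates ([zclosed_Gr_le]). Hence
    X_lambda is closed. It contains the orbit over y != 0, because t - y is then a
    unit and the lattices of a point all have the same position; this is one
    inclusion.

    For the other one, a closed set Z that contains the orbit over y != 0 has to be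
    shown to contain X_lambda. The tool is [pencil_limit]: a pencil of tuples of
    lattices with determinants of constant valuation that lies in Z outside of
    finitely many points lies in Z. Root subgroups give pencils that join a tuple
    of lattices to its images under an affine reflection ([root_limit]). Over
    y != 0 this yields the classical fact that the closure of an orbit contains
    the orbits of the dominated weights ([dominated_limit]).

    Over y = 0 a point is a periodic chain of lattices. By the affine Bruhat
    decomposition ([iwahori_decomposition]) it has a basis adapted both to itself
    and to the standard chain ([common_adapted_basis]), so that up to the action of
    the Iwahori subgroup it is a chain of coordinate lattices, given by a weight nu
    and a permutation s. The position of its i-th lattice relative to the i-th
    standard lattice is the weight [relpos nu s i], and the point is in X_lambda if
    and only if all these weights are dominated by lambda. The point is moved
    towards the generic fibre in two steps.

    If s is not the identity, [dominated_reflection] provides an affine reflection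
    that moves the chain up in the Bruhat order and leaves all positions dominated.
    This amounts to the equality of the permissible set and the admissible set of
    lambda, which is a theorem of Haines and Ngo for GL_n. The reflection is
    found by following the positions along one period: each step of the chain
    moves one unit between two coordinates, and some coordinate raised in this way
    can return a unit to the coordinate of the largest total, because otherwise
    the obstructions could be traced back to a step that has none
    ([unobstructed_step]). A sum of squares increases, so that the process ends.

    If s is the identity, all positions are equal to nu, and the chain is
    deformed to y != 0 by replacing the factors t above the diagonal of the
    matrix in the Iwahori subgroup by t - y. The conjugates of this deformation
    are affine functions of y ([deform_conj]), so that it is a pencil, and its
    other members lie in the orbit of nu over y != 0, which is contained in Z by
    the first case ([translation_limit]). *)

Set Implicit Arguments.
Unset Strict Implicit.
Unset Printing Implicit Defensive.

Import Order.TTheory GRing.Theory Num.Theory.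
Local Open Scope ring_scope.
Local Open Scope classical_set_scope.

(** * Power series and Laurent series *)

Section PowerSeries.
Variable C : fieldType.
Notation O := (fps C).
Notation K := {fraction O}.
Notation tK := (tK C).
Implicit Types (f g u : O) (x y : K).

Definition fcoef0 (f : O) : C := fcoef f 0.

Lemma fcoefD f g i : fcoef (f + g) i = fcoef f i + fcoef g i.
Proof. by []. Qed.

Lemma fcoefM f g i : fcoef (f * g) i = \sum_(j < i.+1) fcoef f j * fcoef g (i - j).
Proof. by []. Qed.

Fact fcoef0_zmod : zmod_morphism fcoef0.
Proof. by []. Qed.

Fact fcoef0_monoid : monoid_morphism fcoef0.
Proof. by split=> // f g; rewrite /fcoef0 fcoefM big_ord_recl big_ord0 addr0. Qed.

HB.instance Definition _ := GRing.isZmodMorphism.Build O C fcoef0 fcoef0_zmod.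
HB.instance Definition _ := GRing.isMonoidMorphism.Build O C fcoef0 fcoef0_monoid.

(** The inverse of [f] is found coefficient by coefficient; the list of the
    first [k] of them is built by recursion on [k]. *)
Fixpoint inv_coefs (f : O) (k : nat) : seq C :=
  if k is k'.+1 then
    let s := inv_coefs f k' in
    rcons s (((k' == 0%N)%:R - \sum_(j < k') fcoef f j.+1 * s`_(k' - j.+1)) / fcoef f 0)
  else [::].

Lemma size_inv_coefs f k : size (inv_coefs f k) = k.
Proof. by elim: k => //= k IH; rewrite size_rcons IH. Qed.

Lemma nth_inv_coefs f k i : (i < k)%N -> (inv_coefs f k)`_i = (inv_coefs f i.+1)`_i.
Proof.
elim: k => // k IH; rewrite ltnS leq_eqVlt => /orP[/eqP-> //|ik].
by rewrite [inv_coefs f k.+1]/= nth_rcons size_inv_coefs ik IH.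
Qed.

Lemma fps_unitE f : (f \is a GRing.unit) = (fcoef0 f != 0).
Proof.
apply/idP/idP => [/(rmorph_unit fcoef0)|f0]; first by rewrite unitfE.
pose g : O := Fps (fun k => (inv_coefs f k.+1)`_k).
suff fg : f * g = 1 by apply/unitrPr; exists g.
apply: fpsP => k; rewrite fcoefM big_ord_recl /= subn0.
rewrite nth_rcons size_inv_coefs ltnn eqxx.
rewrite mulrCA mulfV // mulr1 -addrA [X in _ + X]addrC.
rewrite (_ : \sum_(i < k) _ = \sum_(j < k) fcoef f j.+1 * (inv_coefs f k)`_(k - j.+1)).
  by rewrite subrr addr0; case: eqP.
apply: eq_bigr => j _; rewrite /bump /= add1n; congr (_ * _).
by rewrite [RHS]nth_inv_coefs // subnSK // leq_subr.
Qed.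

Lemma fcoef_varM f i : fcoef (fps_var C * f) i = if i is j.+1 then fcoef f j else 0.
Proof.
rewrite fcoefM; case: i => [|j]; first by rewrite big_ord_recl big_ord0 /= mul0r addr0.
rewrite big_ord_recl /= mul0r add0r big_ord_recl /= mul1r subSS subn0 big1 ?addr0 // => i _.
by rewrite mul0r.
Qed.

Lemma fcoef_varXM f k i :
  fcoef (fps_var C ^+ k * f) i = if (k <= i)%N then fcoef f (i - k) else 0.
Proof.
elim: k i => [|k IH] i; first by rewrite mul1r subn0.
by rewrite exprS -mulrA fcoef_varM; case: i => // i; rewrite IH ltnS subSS.
Qed.

Lemma fps_var_neq0 : fps_var C != 0.
Proof. by apply/eqP => /(congr1 (fun f => fcoef f 1)) /eqP; rewrite /= oner_eq0. Qed.

Lemma dvd_varX f k : (forall i, (i < k)%N -> fcoef f i = 0) ->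
  exists g, f = fps_var C ^+ k * g.
Proof.
move=> fk; exists (Fps (fun i => fcoef f (i + k))); apply: fpsP => i.
rewrite fcoef_varXM; case: leqP => [ki|/fk //].
by rewrite /= subnK.
Qed.

Lemma fps_unit_part f : f != 0 ->
  exists a u, u \is a GRing.unit /\ f = fps_var C ^+ a * u.
Proof.
move=> /fps_order[a fa fmin]; have [u fE] := dvd_varX fmin.
exists a, u; split=> //; rewrite fps_unitE.
by move: fa; rewrite fE fcoef_varXM leqnn subnn.
Qed.

Fact tofrac_inj : injective (@tofrac O).
Proof. by move=> f g /eqP; rewrite tofrac_eq => /eqP. Qed.

Lemma tK_neq0 : tK != 0.
Proof. by rewrite tofrac_eq0 fps_var_neq0. Qed.

Implicit Types (k l : int).

Lemma tKD k l : tK ^ (k + l) = tK ^ k * tK ^ l.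
Proof. by rewrite expfzDr // tK_neq0. Qed.

Lemma tKV k : (tK ^ k)^-1 = tK ^ (- k).
Proof. by rewrite invr_expz. Qed.

Lemma tofracV u : u \is a GRing.unit -> tofrac u^-1 = (tofrac u)^-1.
Proof. exact: rmorphV. Qed.

Lemma tofrac_unit_neq0 u : u \is a GRing.unit -> tofrac u != 0.
Proof. by move=> uU; rewrite tofrac_eq0; apply: contraTneq uU => ->; rewrite unitr0. Qed.

Lemma laurent_ratio x : exists f g, g != 0 /\ x = tofrac f / tofrac g.
Proof.
move: x; elim/quotW => -[[f g] /= g0]; exists f, g; split => //.
apply: (canRL (mulfK _)); first by rewrite tofrac_eq0.
unlock tofrac; rewrite -[LHS]FracField.pi_mul; apply/eqmodP.
by rewrite /= FracField.equivfE /FracField.mulf /= !numden_Ratio ?oner_eq0 ?mulr1 //= mulrC.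
Qed.

Lemma laurent_unit_part x : x != 0 ->
  exists k u, u \is a GRing.unit /\ x = tK ^ k * tofrac u.
Proof.
have [f [g [g0 ->]]] := laurent_ratio x.
have [->|f0 _] := eqVneq f 0; first by rewrite tofrac0 mul0r eqxx.
have [a [u [uU ->]]] := fps_unit_part f0; have [b [v [vU ->]]] := fps_unit_part g0.
exists (a%:Z - b%:Z), (u / v); split; first by rewrite unitrMl ?unitrV.
rewrite tKD -tKV -!exprnP !tofracM !tofracXn invfM -/tK tofracV //.
by rewrite mulrACA.
Qed.

(** The Laurent series without polar part, as a subset of the fraction field. *)
Definition integral x := exists f, x = tofrac f.

End PowerSeries.

(** * Lattices over a discrete valuation ring *)

(** A field [K] with a discrete valuation, presented by the subset [O] of
    integral elements and by a uniformizer [t]; the description of lattices by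
    matrices depends on nothing else. *)
Record is_dvr (K : fieldType) (O : K -> Prop) (t : K) : Prop := IsDvr {
  dvr1 : O 1;
  dvrB : forall x y, O x -> O y -> O (x - y);
  dvrM : forall x y, O x -> O y -> O (x * y);
  dvr_t : O t;
  dvr_tV : ~ O t^-1;
  dvr_order : forall x, x != 0 ->
    exists k : int, O (x * t ^ (- k)) /\ O (x^-1 * t ^ k)
}.

Definition has_val (K : fieldType) (O : K -> Prop) (t x : K) (k : int) :=
  [/\ x != 0, O (x * t ^ (- k)) & O (x^-1 * t ^ k)].

Section Valuation.
Variables (K : fieldType) (O : K -> Prop) (t : K).
Hypothesis Odvr : is_dvr O t.
Notation hasv := (has_val O t).
Implicit Types (x y : K) (k l : int).

Lemma dvr0 : O 0.
Proof. by rewrite -(subrr 1); apply: (dvrB Odvr); apply: (dvr1 Odvr). Qed.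

Lemma dvrN x : O x -> O (- x).
Proof. by move=> Ox; rewrite -sub0r; apply: (dvrB Odvr) => //; apply: dvr0. Qed.

Lemma dvrD x y : O x -> O y -> O (x + y).
Proof. by move=> Ox /dvrN Oy; rewrite -[y]opprK; apply: (dvrB Odvr). Qed.

Lemma dvr_sum (I : Type) (r : seq I) (P : pred I) (F : I -> K) :
  (forall i, P i -> O (F i)) -> O (\sum_(i <- r | P i) F i).
Proof. by move=> h; apply: big_ind; [exact: dvr0|exact: dvrD|]. Qed.

Lemma dvr_prod (I : Type) (r : seq I) (P : pred I) (F : I -> K) :
  (forall i, P i -> O (F i)) -> O (\prod_(i <- r | P i) F i).
Proof. by move=> h; apply: big_ind; [exact: (dvr1 Odvr)|exact: (dvrM Odvr)|]. Qed.

Lemma dvr_t_neq0 : t != 0.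
Proof. by apply/eqP => t0; apply: (dvr_tV Odvr); rewrite t0 invr0; apply: dvr0. Qed.

Lemma dvr_tX_neq0 k : t ^ k != 0.
Proof. by rewrite expfz_neq0 // dvr_t_neq0. Qed.

Lemma dvr_tD k l : t ^ (k + l) = t ^ k * t ^ l.
Proof. by rewrite expfzDr // dvr_t_neq0. Qed.

Lemma dvr_tX k : 0 <= k -> O (t ^ k).
Proof.
case: k => // k _; rewrite -exprnP; elim: k => [|k IH]; first exact: (dvr1 Odvr).
by rewrite exprS; apply: (dvrM Odvr) => //; apply: (dvr_t Odvr).
Qed.

Lemma dvr_tXP k : O (t ^ k) <-> 0 <= k.
Proof.
split=> [|]; last exact: dvr_tX.
case: k => // k Ok; case: (dvr_tV Odvr).
rewrite -[t^-1]/(t ^ (-1)) (_ : -1 = Negz k + k%:Z); last by rewrite NegzE; lia.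
by rewrite dvr_tD; apply: (dvrM Odvr) => //; apply: dvr_tX.
Qed.

Lemma has_valP x : x != 0 -> exists k, hasv x k.
Proof. by move=> x0; have [k [h1 h2]] := dvr_order Odvr x0; exists k. Qed.

Lemma has_val_tX k : hasv (t ^ k) k.
Proof.
split; first exact: dvr_tX_neq0.
  by rewrite -dvr_tD subrr expr0z; apply: (dvr1 Odvr).
by rewrite invr_expz -dvr_tD addNr expr0z; apply: (dvr1 Odvr).
Qed.

Lemma has_valM x y k l : hasv x k -> hasv y l -> hasv (x * y) (k + l).
Proof.
move=> [x0 x1 x2] [y0 y1 y2]; split; first by rewrite mulf_neq0.
  by rewrite opprD dvr_tD mulrACA; apply: (dvrM Odvr).
by rewrite invfM dvr_tD mulrACA; apply: (dvrM Odvr).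
Qed.

Lemma has_valV x k : hasv x k -> hasv x^-1 (- k).
Proof. by move=> [x0 x1 x2]; split; rewrite ?invr_eq0 ?invrK ?opprK. Qed.

Lemma has_val_int x k : hasv x k -> (O x <-> 0 <= k).
Proof.
move=> [x0 x1 x2]; split=> [Ox|k0].
  apply/dvr_tXP; rewrite -[_ ^ _](mulKf x0) mulrCA.
  exact: (dvrM Odvr).
rewrite -[x](mulfK (dvr_tX_neq0 (- k))) invr_expz opprK.
by apply: (dvrM Odvr) => //; apply: dvr_tX.
Qed.

Lemma has_val_inj x k l : hasv x k -> hasv x l -> k = l.
Proof.
move=> hk hl; apply/eqP; rewrite eq_le; apply/andP; split; rewrite -subr_ge0.
  have := has_valM hl (has_valV hk); rewrite mulfV; last by case: hk.
  by move=> h; apply/(has_val_int h); apply: (dvr1 Odvr).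
have := has_valM hk (has_valV hl); rewrite mulfV; last by case: hk.
by move=> h; apply/(has_val_int h); apply: (dvr1 Odvr).
Qed.

Lemma dvr_pole x : exists m : nat, O (t ^+ m * x).
Proof.
have [->|/has_valP[k xk]] := eqVneq x 0.
  by exists 0%N; rewrite mulr0; apply: dvr0.
exists `|k|%N; apply/(has_val_int (has_valM (has_val_tX `|k|%N) xk)); lia.
Qed.

End Valuation.

Section IntegralMatrices.
Variables (K : fieldType) (O : K -> Prop) (t : K).
Hypothesis Odvr : is_dvr O t.

Definition intmx (m n : nat) (A : 'M[K]_(m, n)) := forall i j, O (A i j).

(** The group GL_n(O) inside GL_n(K). *)
Definition GLO (n : nat) (A : 'M[K]_n) :=
  [/\ A \in unitmx, intmx A & intmx (invmx A)].

Lemma intmxM m n p (A : 'M[K]_(m, n)) (B : 'M[K]_(n, p)) :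
  intmx A -> intmx B -> intmx (A *m B).
Proof.
by move=> hA hB i j; rewrite mxE; apply: (dvr_sum Odvr) => k _; apply: (dvrM Odvr).
Qed.

Lemma intmxD m n (A B : 'M[K]_(m, n)) : intmx A -> intmx B -> intmx (A + B).
Proof. by move=> hA hB i j; rewrite mxE; apply: (dvrD Odvr). Qed.

Lemma intmxZ m n a (A : 'M[K]_(m, n)) : O a -> intmx A -> intmx (a *: A).
Proof. by move=> ha hA i j; rewrite mxE; apply: (dvrM Odvr). Qed.

Lemma intmx_delta m n i j : intmx (delta_mx i j : 'M[K]_(m, n)).
Proof.
by move=> a b; rewrite mxE; case: (_ && _); [exact: (dvr1 Odvr)|exact: (dvr0 Odvr)].
Qed.

Lemma intmx1 n : intmx (1%:M : 'M[K]_n).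
Proof.
by move=> i j; rewrite mxE; case: eqP; [have := dvr1 Odvr|have := dvr0 Odvr].
Qed.

Lemma int_det n (A : 'M[K]_n) : intmx A -> O (\det A).
Proof.
move=> hA; rewrite /determinant; apply: (dvr_sum Odvr) => s _.
apply: (dvrM Odvr); last exact: (dvr_prod Odvr).
by case: (perm.odd_perm s); rewrite ?expr1 ?expr0;
  [apply: (dvrN Odvr)|]; apply: (dvr1 Odvr).
Qed.

Lemma intmx_adj n (A : 'M[K]_n) : intmx A -> intmx (\adj A).
Proof.
move=> hA i j; rewrite mxE /cofactor; apply: (dvrM Odvr).
  elim: (_ + _)%N => [|m IH]; first exact: (dvr1 Odvr).
  by rewrite exprS; apply: (dvrM Odvr) => //; apply/(dvrN Odvr)/(dvr1 Odvr).
by apply: int_det => a b; rewrite !mxE.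
Qed.

Lemma intmx_pole m n (A : 'M[K]_(m, n)) :
  exists N0, forall N, (N0 <= N)%N -> intmx (t ^+ N *: A).
Proof.
have h ij : exists N, O (t ^+ N * A ij.1 ij.2) by apply: (dvr_pole Odvr).
have [f fP] := choice h; exists (\max_ij f ij)%N => N hN i j; rewrite mxE.
have fN : (f (i, j) <= N)%N by apply: leq_trans hN; apply: leq_bigmax.
rewrite -(subnK fN) exprD -mulrA; apply: (dvrM Odvr); last exact: (fP (i, j)).
by rewrite exprnP; apply: (dvr_tX Odvr).
Qed.

Section Square.
Variable n : nat.
Implicit Types A B g h : 'M[K]_n.

Lemma GLO_unit g : GLO g -> g \in unitmx. Proof. by case. Qed.

Lemma GLO1 : GLO (1%:M : 'M_n).
Proof. by split; [exact: unitmx1|exact: intmx1|rewrite invmx1; exact: intmx1]. Qed.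

Lemma GLOV g : GLO g -> GLO (invmx g).
Proof. by move=> [gU gO gV]; split; rewrite ?unitmx_inv ?invmxK. Qed.

Lemma invmxM A B : A \in unitmx -> B \in unitmx ->
  invmx (A *m B) = invmx B *m invmx A.
Proof.
move=> AU BU; have ABU : A *m B \in unitmx by rewrite unitmx_mul AU.
have ABV : A *m B *m (invmx B *m invmx A) = 1%:M.
  by rewrite mulmxA mulmxK // mulmxV.
by rewrite -[RHS](mulKmx ABU) ABV mulmx1.
Qed.

Lemma GLOM g h : GLO g -> GLO h -> GLO (g *m h).
Proof.
move=> [gU gO gV] [hU hO hV]; split; first by rewrite unitmx_mul gU.
  exact: intmxM.
by rewrite invmxM //; apply: intmxM.
Qed.

Lemma GLO_exhibit g h : g *m h = 1%:M -> intmx g -> intmx h -> GLO g.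
Proof.
move=> gh gO hO; have gU : g \in unitmx by have [] := mulmx1_unit gh.
by split=> //; rewrite -[invmx g]mulmx1 -gh mulKmx.
Qed.

(** The inverse is given by the adjugate. *)
Lemma GLO_detP g : GLO g <-> intmx g /\ has_val O t (\det g) 0.
Proof.
split=> [[gU gO gV]|[gO [d0 _ dV]]].
  split=> //; move: gU; rewrite unitmxE unitfE => d0.
  split=> //; rewrite ?oppr0 expr0z mulr1 -?det_inv; exact: int_det.
have gU : g \in unitmx by rewrite unitmxE unitfE.
split=> //; rewrite /invmx gU; apply: intmxZ; last exact: intmx_adj.
by move: dV; rewrite expr0z mulr1.
Qed.

Definition lat A : set 'cV[K]_n := [set A *m v | v in [set v | intmx v]].

Lemma latP A (v : 'cV[K]_n) : A \in unitmx -> lat A v <-> intmx (invmx A *m v).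
Proof.
move=> AU; split=> [[w wO <-]|wO]; first by rewrite mulKmx.
by exists (invmx A *m v); rewrite ?mulKVmx.
Qed.

Lemma lat_image B A : [set B *m v | v in lat A] = lat (B *m A).
Proof.
apply/seteqP; split=> [v [_ [w wO <-] <-]|v [w wO <-]]; first by exists w; rewrite ?mulmxA.
by exists (A *m w); [exists w|rewrite mulmxA].
Qed.

Lemma lat_subP A B : A \in unitmx -> B \in unitmx ->
  (lat A `<=` lat B <-> intmx (invmx B *m A)).
Proof.
move=> AU BU; split=> [sAB i j|hO v [w wO <-]]; last first.
  by apply/latP => //; rewrite mulmxA; apply: intmxM.
have /sAB/latP : lat A (col j A).
  by exists (delta_mx j 0); [exact: intmx_delta|rewrite -colE].
by move=> /(_ BU i 0); rewrite colE mulmxA -colE mxE.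
Qed.

Lemma lat_eqP A B : A \in unitmx -> B \in unitmx ->
  (lat A = lat B <-> GLO (invmx A *m B)).
Proof.
move=> AU BU; have VU : invmx A *m B \in unitmx by rewrite unitmx_mul unitmx_inv AU.
have VE : invmx (invmx A *m B) = invmx B *m A by rewrite invmxM ?unitmx_inv // invmxK.
split=> [e|[_ h1 h2]].
  by split; rewrite // ?VE; apply/lat_subP; rewrite ?e.
by apply/seteqP; split; apply/lat_subP; rewrite // -VE.
Qed.

Lemma lat_GLO A g : A \in unitmx -> GLO g -> lat (A *m g) = lat A.
Proof.
move=> AU gO; apply/esym/lat_eqP; rewrite ?unitmx_mul ?AU ?GLO_unit //.
by rewrite mulKmx.
Qed.

(** The matrix t^mu. *)
Definition tdiag (mu : 'I_n -> int) : 'M[K]_n := diag_mx (\row_i t ^ mu i).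

Lemma tdiagE mu i j : tdiag mu i j = (t ^ mu i) *+ (i == j).
Proof. by rewrite /tdiag !mxE. Qed.

Lemma tdiagM mu nu : tdiag mu *m tdiag nu = tdiag (fun i => mu i + nu i).
Proof.
rewrite /tdiag mulmx_diag; congr diag_mx.
by apply/matrixP => i j; rewrite !mxE (dvr_tD Odvr).
Qed.

Lemma tdiag0 : tdiag (fun=> 0) = 1%:M.
Proof. by apply/matrixP => i j; rewrite tdiagE mxE expr0z. Qed.

Lemma det_tdiag mu : \det (tdiag mu) = t ^ (\sum_i mu i).
Proof.
rewrite det_diag; elim/big_rec2: _ => [|i x y _]; first by rewrite expr0z.
by rewrite mxE (dvr_tD Odvr) => ->.
Qed.

Lemma tdiag_unit mu : tdiag mu \in unitmx.
Proof. by rewrite unitmxE det_tdiag unitfE (dvr_tX_neq0 Odvr). Qed.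

Lemma invmx_tdiag mu : invmx (tdiag mu) = tdiag (fun i => - mu i).
Proof.
rewrite -[RHS](mulKmx (tdiag_unit mu)) tdiagM -[LHS]mulmx1; congr (_ *m _).
by rewrite -tdiag0; congr tdiag; apply/funext => i; rewrite subrr.
Qed.

Lemma tdiag_mul p mu (A : 'M[K]_(n, p)) i j : (tdiag mu *m A) i j = t ^ mu i * A i j.
Proof. by rewrite mul_diag_mx !mxE. Qed.

Lemma mul_tdiag p (A : 'M[K]_(p, n)) mu i j : (A *m tdiag mu) i j = A i j * t ^ mu j.
Proof. by rewrite mul_mx_diag !mxE. Qed.

(** Cramer's rule bounds the poles of the inverse. *)
Lemma intmx_inv_pole A (N0 N : nat) k : intmx (t ^+ N0 *: A) ->
  has_val O t (\det A) k -> (n * N0 + absz k <= N)%N -> intmx (t ^+ N *: invmx A).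
Proof.
move=> tA Ak N_ge; have AU : A \in unitmx by rewrite unitmxE unitfE; case: Ak.
set D := t ^+ N0 *: A in tA.
have t0 m : t ^+ m != 0 by rewrite expf_neq0 // (dvr_t_neq0 Odvr).
have Dk : has_val O t (\det D) ((n * N0)%N%:Z + k).
  rewrite detZ -exprM mulnC; apply: (has_valM Odvr) => //.
  by rewrite exprnP; apply: (has_val_tX Odvr).
have -> : t ^+ N *: invmx A = (t ^+ (N + N0) / \det D) *: \adj D.
  have d0 : \det D != 0 by case: Dk.
  have DU : D \in unitmx by rewrite unitmxE unitfE.
  have e1 : (t ^+ N0)^-1 *: D = A by rewrite scalerA mulVf // scale1r.
  have e2 : (\det D)^-1 *: \adj D = invmx D by rewrite /invmx DU.
  rewrite -scalerA e2 -e1 invmxZ; last by rewrite unitmxZ // unitrV unitfE.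
  by rewrite invrK scalerA exprD.
apply: intmxZ; last exact: intmx_adj.
apply/(has_val_int Odvr (has_valM Odvr _ (has_valV Dk))).
  by rewrite exprnP; apply: (has_val_tX Odvr).
by move: N_ge; clear; lia.
Qed.

End Square.
End IntegralMatrices.

(** * The affine Bruhat decomposition *)

Section Iwahori.
Variables (K : fieldType) (O : K -> Prop) (t : K).
Hypothesis Odvr : is_dvr O t.
Variable n : nat.
Implicit Types A B g b : 'M[K]_n.
Notation hasv := (has_val O t).

(** The Iwahori subgroup of the matrices that are lower triangular modulo t;
    it stabilizes each member of the standard chain of lattices. *)
Definition iwahori g :=
  GLO O g /\ forall r c : 'I_n, (r < c)%N -> O (g r c * t^-1).

Lemma iwahori1 : iwahori 1%:M.
Proof.
split; first exact: (GLO1 Odvr).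
by move=> r c rc; rewrite mxE -val_eqE ltn_eqF //= mul0r; apply: (dvr0 Odvr).
Qed.

Lemma iwahoriM g b : iwahori g -> iwahori b -> iwahori (g *m b).
Proof.
move=> [gO gt] [bO bt]; split; first exact: (GLOM Odvr).
move=> r c rc; rewrite mxE big_distrl /=; apply: (dvr_sum Odvr) => k _.
case: gO bO => _ gO _ [_ bO _]; have [rk|kr] := ltnP r k.
  by rewrite mulrAC; apply: (dvrM Odvr); [exact: gt|exact: bO].
rewrite -mulrA; apply: (dvrM Odvr); first exact: gO.
exact/bt/(leq_ltn_trans kr).
Qed.

Lemma elementary_mulmx (x : 'cV[K]_n) (y : 'rV[K]_n) : y *m x = 0 ->
  (1%:M + x *m y) *m (1%:M - x *m y) = 1%:M.
Proof.
move=> yx; rewrite mulmxBr mulmx1 mulmxDl mul1mx -mulmxA [y *m (_ *m _)]mulmxA.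
by rewrite yx mul0mx mulmx0 addr0 addrK.
Qed.

Lemma iwahori_elementary (x : 'cV[K]_n) (y : 'rV[K]_n) : y *m x = 0 ->
  intmx O (x *m y) ->
  (forall r c : 'I_n, (r < c)%N -> O ((x *m y) r c * t^-1)) ->
  iwahori (1%:M + x *m y).
Proof.
move=> yx xyO xyt; split.
  apply: (GLO_exhibit (elementary_mulmx yx)).
    by apply: (intmxD Odvr) => //; apply: (intmx1 Odvr).
  move=> i j; rewrite mxE; apply: (dvrD Odvr); first exact: (intmx1 Odvr).
  by rewrite mxE; apply/(dvrN Odvr)/xyO.
move=> r c rc; rewrite mxE mulrDl; apply: (dvrD Odvr); last exact: xyt.
by rewrite mxE -val_eqE ltn_eqF //= mul0r; apply: (dvr0 Odvr).
Qed.

Lemma iwahori_diag (d : 'rV[K]_n) : (forall i, hasv (d 0 i) 0) -> iwahori (diag_mx d).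
Proof.
move=> dO; have dE i j : diag_mx d i j = d 0 i *+ (i == j) by rewrite mxE.
split; last first.
  move=> r c rc; rewrite dE -val_eqE ltn_eqF //= mul0r; exact: (dvr0 Odvr).
apply: (@GLO_exhibit _ _ _ _ (diag_mx (\row_i (d 0 i)^-1))).
- rewrite mulmx_diag; apply/matrixP => i j; rewrite !mxE mulfV //.
  by case: (dO i).
- move=> i j; rewrite dE; case: eqP => _; last exact: (dvr0 Odvr).
  by apply/(has_val_int Odvr (dO i)).
- move=> i j; rewrite !mxE; case: eqP => _; last exact: (dvr0 Odvr).
  by rewrite mulr1n; apply/(has_val_int Odvr (has_valV (dO i))); rewrite oppr0.
Qed.

(** The rows of [S] have been cleared: the only nonzero entry of such a row is
    also the only nonzero entry of its column. *)
Let cleared (S : {set 'I_n}) B := forall r, r \in S ->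
  exists c, [/\ B r c != 0, forall c', c' != c -> B r c' = 0
              & forall r', r' != r -> B r' c = 0].

(** The digits of an integer in base [n], with the valuation as the leading one,
    are compared lexicographically. *)
Let row_key (v1 v2 : int) (r r' : nat) : (r < n)%N -> (r' < n)%N ->
  (v1 * n%:Z + r%:Z) * n%:Z <= (v2 * n%:Z + r'%:Z) * n%:Z ->
  v1 + (r' < r)%N%:Z <= v2.
Proof.
clear; move=> rn r'n; have n0 : 0 < n%:Z by lia.
rewrite (ler_pM2r n0) leNgt => h1; apply/negP; case: ltnP => h2 h3.
  have : 0 <= (v1 - v2) * n%:Z by apply: mulr_ge0; lia.
  by lia.
have : n%:Z <= (v1 - v2) * n%:Z by rewrite ler_peMl; lia.
by lia.
Qed.

Let col_key (v1 v2 : int) (r c c' : nat) : (r < n)%N -> (c < n)%N -> (c' < n)%N ->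
  (v1 * n%:Z + r%:Z) * n%:Z - c%:Z <= (v2 * n%:Z + r%:Z) * n%:Z - c'%:Z ->
  v1 + (c < c')%N%:Z <= v2.
Proof.
clear; move=> rn cn c'n h; have {}h : (v1 - v2) * (n%:Z * n%:Z) <= c%:Z - c'%:Z by lia.
have nn : n%:Z <= n%:Z * n%:Z by rewrite ler_peMl; lia.
rewrite leNgt; apply/negP; case: (ltnP c c') => h4 h5.
  suff : 0 <= (v1 - v2) * (n%:Z * n%:Z) by lia.
  by apply: mulr_ge0; lia.
suff : n%:Z * n%:Z <= (v1 - v2) * (n%:Z * n%:Z) by lia.
by rewrite ler_peMl; lia.
Qed.

(** A pivot of least valuation, then of least row, then of greatest column
    divides the other entries of its row and of its column by factors that are
    allowed in the Iwahori subgroup. *)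
Let pivot (S : {set 'I_n}) B : B \in unitmx -> S != finset.setT ->
  exists r c k, [/\ r \notin S, B r c != 0, hasv (B r c) k,
    forall r', r' \notin S -> B r' c != 0 ->
      exists2 k', hasv (B r' c) k' & k + (r' < r)%N%:Z <= k'
    & forall c', B r c' != 0 ->
      exists2 k', hasv (B r c') k' & k + (c < c')%N%:Z <= k'].
Proof.
move=> BU SnT; have [r0 r0S] : exists r0, r0 \notin S.
  apply: contrapT => nS; case/eqP: SnT; apply/setP => r; rewrite inE.
  by apply: contrapT => rS; apply: nS; exists r; apply/negP.
have [c0 rc0] : exists c0, B r0 c0 != 0.
  apply: contrapT => nB; move: BU; rewrite -row_free_unit -kermx_eq0.
  suff /eqP : delta_mx 0 r0 *m B == 0 :> 'rV_n.
    move/sub_kermxP => + /eqP k0; rewrite k0 submx0 => /eqP/matrixP/(_ 0 r0).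
    by rewrite !mxE !eqxx => /eqP; rewrite oner_eq0.
  rewrite -rowE; apply/eqP/matrixP => i j; rewrite !mxE.
  by apply: contrapT => /eqP rj; apply: nB; exists j.
have val_ex (rc : 'I_n * 'I_n) : exists k, B rc.1 rc.2 != 0 -> hasv (B rc.1 rc.2) k.
  have [->|/(has_valP Odvr)[k]] := eqVneq (B rc.1 rc.2) 0; first by exists 0.
  by exists k.
have [v vP] := choice val_ex.
(* The three criteria are read off the digits of a single integer. *)
pose key (rc : 'I_n * 'I_n) : int :=
  (v rc * n%:Z + (rc.1 : nat)%:Z) * n%:Z - (rc.2 : nat)%:Z.
pose P (rc : 'I_n * 'I_n) := (rc.1 \notin S) && (B rc.1 rc.2 != 0).
have P0 : P (r0, c0) by rewrite /P r0S.
have [[r c] /andP[/= rS rc_neq0] rc_min] := Order.TotalTheory.arg_minP key P0.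
exists r, c, (v (r, c)); split=> //; first exact: (vP (r, c)).
  move=> r' r'S r'c; exists (v (r', c)); first exact: (vP (r', c)).
  have := rc_min (r', c); rewrite /P /key /= r'S r'c => /(_ isT).
  by move=> h; apply: (row_key (ltn_ord r) (ltn_ord r')); move: h; rewrite lerD2r.
move=> c' rc'; exists (v (r, c')); first exact: (vP (r, c')).
have := rc_min (r, c'); rewrite /P /key /= rS rc' => /(_ isT).
by apply: col_key; [exact: (ltn_ord r)|exact: ltn_ord|exact: ltn_ord].
Qed.

(** The pivot clears its row and its column; the rows and columns cleared before
    vanish there, so they are not affected. *)
Let clear_step (S : {set 'I_n}) B : B \in unitmx -> S != finset.setT -> cleared S B ->
  exists r g b B', [/\ r \notin S, iwahori g, iwahori b, cleared (r |: S) B'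
                     & B = g *m B' *m b].
Proof.
move=> BU SnT clB; have [r [c [k [rS rc0 rck col_min row_min]]]] := pivot BU SnT.
have Sc r' : r' \in S -> B r' c = 0.
  move=> r'S; have [c1 [_ rowz colz]] := clB r' r'S.
  have [cc1|/rowz //] := eqVneq c c1.
  by move: rc0; rewrite cc1 colz ?eqxx //; apply: contraNneq rS => ->.
have ratio z k' e : hasv z k' -> k + e <= k' -> O (z / B r c * t ^ (- e)).
  move=> zk h; apply/(has_val_int Odvr (has_valM Odvr
    (has_valM Odvr zk (has_valV rck)) (has_val_tX Odvr _))); lia.
have t0 (e : bool) z : e -> O (z * t ^ (- e%:Z)) -> O (z / t) by move=> ->.
have t1 (e : bool) z : O (z * t ^ (- e%:Z)) -> O z.
  move=> h; have := dvrM Odvr h (dvr_tX Odvr (_ : 0 <= e%:Z)).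
  by rewrite -mulrA -(dvr_tD Odvr) addNr expr0z mulr1; apply; lia.
pose x : 'cV[K]_n := \col_r' (if r' == r then 0 else B r' c / B r c).
pose y : 'rV[K]_n := \row_c' (if c' == c then 0 else B r c' / B r c).
have xO r' : O (x r' 0 * t ^ (- (r' < r)%N%:Z)).
  rewrite mxE; case: eqP => [_|_]; first by rewrite mul0r; apply: (dvr0 Odvr).
  have [r'S|r'S] := boolP (r' \in S).
    by rewrite Sc // !mul0r; apply: (dvr0 Odvr).
  have [->|/(col_min _ r'S)[k' h1 h2]] := eqVneq (B r' c) 0.
    by rewrite !mul0r; apply: (dvr0 Odvr).
  exact: ratio h1 h2.
have yO c' : O (y 0 c' * t ^ (- (c < c')%N%:Z)).
  rewrite mxE; case: eqP => [_|_]; first by rewrite mul0r; apply: (dvr0 Odvr).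
  have [->|/row_min[k' h1 h2]] := eqVneq (B r c') 0.
    by rewrite !mul0r; apply: (dvr0 Odvr).
  exact: ratio h1 h2.
have xE (a : 'cV[K]_n) i j : (a *m (delta_mx 0 r : 'rV[K]_n)) i j = a i 0 *+ (j == r).
  by rewrite mxE big_ord1 mxE eqxx /=; case: eqP; rewrite ?mulr1 ?mulr0.
have yE (a : 'rV[K]_n) i j : ((delta_mx c 0 : 'cV[K]_n) *m a) i j = a 0 j *+ (i == c).
  by rewrite mxE big_ord1 mxE eqxx andbT; case: eqP; rewrite ?mul1r ?mul0r.
have ex : delta_mx 0 r *m x = 0 :> 'M_1.
  by apply/matrixP => i j; rewrite -rowE !mxE eqxx.
have ye : y *m delta_mx c 0 = 0 :> 'M_1.
  by apply/matrixP => i j; rewrite -colE !mxE eqxx.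
pose g := 1%:M + x *m delta_mx 0 r; pose b := 1%:M + delta_mx c 0 *m y.
pose g' := 1%:M - x *m delta_mx 0 r; pose b' := 1%:M - delta_mx c 0 *m y.
have gO : iwahori g.
  apply: iwahori_elementary => // [i j|i j ij]; rewrite xE; case: eqP => [jr|_].
  - exact: (t1 _ _ (xO i)).
  - exact: (dvr0 Odvr).
  - by apply: (t0 (i < r)%N); [rewrite -jr|exact: xO].
  - by rewrite mul0r; exact: (dvr0 Odvr).
have bO : iwahori b.
  apply: iwahori_elementary => // [i j|i j ij]; rewrite yE; case: eqP => [ic|_].
  - exact: (t1 _ _ (yO j)).
  - exact: (dvr0 Odvr).
  - by apply: (t0 (c < j)%N); [rewrite -ic|exact: yO].
  - by rewrite mul0r; exact: (dvr0 Odvr).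
exists r, g, b, (g' *m B *m b'); split=> //; last first.
  have gg' : g *m g' = 1%:M by apply: elementary_mulmx.
  have b'b : b' *m b = 1%:M by apply: mulmx1C; apply: elementary_mulmx.
  by rewrite mulmxA mulmxA gg' mul1mx -mulmxA b'b mulmx1.
have B'E i j : (g' *m B *m b') i j =
    if i == r then B r c *+ (j == c) else B i j - x i 0 * B r j.
  have g'BE a d : (g' *m B) a d = B a d - x a 0 * B r d.
    rewrite mulmxBl mul1mx -mulmxA -rowE mxE; congr (_ + _).
    by rewrite mxE mxE big_ord1 [row _ _ _ _]mxE.
  rewrite mulmxBr mulmx1 mulmxA -colE mxE [X in _ + X]mxE.
  rewrite [(col _ _ *m y) _ _]mxE big_ord1 [col _ _ _ _]mxE !g'BE.
  have [->|ir] := eqVneq i r.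
    rewrite !mxE eqxx !mul0r !subr0; have [->|jc] := eqVneq j c.
      by rewrite mulr0 subr0.
    by rewrite mulrC divfK // subrr.
  by rewrite [x i 0]mxE (negbTE ir) divfK // subrr mul0r subr0.
move=> r1; rewrite in_setU1; have [-> _|r1r /= r1S] := eqVneq r1 r.
  exists c; split=> [|c' c'c|r' r'r]; rewrite B'E ?eqxx //.
    by rewrite (negbTE c'c).
  by rewrite (negbTE r'r) mxE (negbTE r'r) divfK // subrr.
have [c1 [h1 h2 h3]] := clB _ r1S; exists c1.
have c1c : c1 != c by apply: contraNneq rc0 => <-; rewrite h3 // eq_sym.
have xr1 : x r1 0 = 0 by rewrite mxE (negbTE r1r) Sc // mul0r.
have rc1 : B r c1 = 0 by rewrite h3 // eq_sym.
split=> [|c' c'c|r' r'r]; rewrite B'E.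
- by rewrite (negbTE r1r) xr1 mul0r subr0.
- by rewrite (negbTE r1r) xr1 mul0r subr0 h2.
- by case: eqP => _; rewrite ?(negbTE c1c) // rc1 mulr0 subr0 h3.
Qed.

Let clear_all B : B \in unitmx -> exists g b B', [/\ iwahori g, iwahori b,
  cleared finset.setT B' & B = g *m B' *m b].
Proof.
move=> BU; suff h m : (m <= n)%N -> exists (S : {set 'I_n}) g b B',
    [/\ #|S| = m, iwahori g, iwahori b, cleared S B' & B = g *m B' *m b].
  have [S [g [b [B' [Sn gO bO clB' BE]]]]] := h n (leqnn n).
  exists g, b, B'; split=> //; suff <- : S = finset.setT by [].
  by apply/eqP; rewrite eqEcard finset.subsetT cardsT card_ord Sn leqnn.
elim: m => [_|m IH mn].
  exists finset.set0, 1%:M, 1%:M, B; split; rewrite ?cards0 ?mul1mx ?mulmx1 //.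
  - exact: iwahori1.
  - exact: iwahori1.
  - by move=> r; rewrite inE.
have [S [g [b [B' [Sm gO bO clB' BE]]]]] := IH (ltnW mn).
have B'U : B' \in unitmx.
  by move: BU; rewrite BE !unitmx_mul => /andP[/andP[]].
have SnT : S != finset.setT.
  by apply: contraTneq mn => ST; rewrite -Sm ST cardsT card_ord ltnn.
have [r [g1 [b1 [B1 [rS g1O b1O clB1 B'E]]]]] := clear_step B'U SnT clB'.
exists (r |: S), (g *m g1), (b1 *m b), B1; split=> //.
- by rewrite cardsU1 rS Sm.
- exact: iwahoriM.
- exact: iwahoriM.
- by rewrite BE B'E !mulmxA.
Qed.

(** The affine Bruhat decomposition: GL_n(K) is the union of the double cosets
    of the Iwahori subgroup that contain a monomial matrix. *)
Theorem iwahori_decomposition A : A \in unitmx ->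
  exists g b (s : 'S_n) nu, [/\ iwahori g, iwahori b
    & A = g *m tdiag t nu *m perm_mx s *m b].
Proof.
move=> AU; have [g [b [B [gO bO clB AE]]]] := clear_all AU.
have h r : exists c, [/\ B r c != 0, forall c', c' != c -> B r c' = 0
    & forall r', r' != r -> B r' c = 0] by apply: clB; rewrite inE.
have [s sP] := choice h; have s_inj : injective s.
  move=> r1 r2 s12; apply: contrapT => /eqP r12.
  have [/eqP nz _ _] := sP r1; case: nz; rewrite s12.
  by have [_ _ -> //] := sP r2.
have vex r : exists k, hasv (B r (s r)) k.
  by have [/(has_valP Odvr)[k hk] _ _] := sP r; exists k.
have [nu nuP] := choice vex.
pose d : 'rV[K]_n := \row_r (B r (s r) * t ^ (- nu r)).
exists (g *m diag_mx d), b, (perm.perm s_inj), nu; split=> //.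
  apply: iwahoriM => //; apply: iwahori_diag => r; rewrite mxE.
  by have := has_valM Odvr (nuP r) (has_val_tX Odvr (- nu r)); rewrite subrr.
rewrite AE; congr (_ *m b); rewrite -!mulmxA; congr (g *m _).
apply/matrixP => r c; rewrite mul_diag_mx mxE mxE (tdiag_mul _ nu) !mxE perm.permE.
rewrite -mulrA [t ^ (- nu r) * _]mulrA -(dvr_tD Odvr) addNr expr0z mul1r.
by have [<-|cs] := eqVneq (s r) c; rewrite ?mulr1 ?mulr0 //;
  have [_ -> //] := sP r; rewrite eq_sym.
Qed.

End Iwahori.

(** * Root subgroups and affine reflections *)

Section RootSubgroups.
Variables (K : fieldType) (O : K -> Prop) (t : K).
Hypothesis Odvr : is_dvr O t.
Variable n : nat.
Notation hasv := (has_val O t).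
Implicit Types a l : 'I_n.
Notation lat := (lat O).
Notation tdiag := (tdiag t).

Definition root_mx (a l : 'I_n) (x : K) : 'M[K]_n := 1%:M + x *: delta_mx a l.

(** The affine reflection in the hyperplane nu_a - nu_l = e. *)
Definition refl (a l : 'I_n) (e : int) (nu : 'I_n -> int) : 'I_n -> int :=
  fun c => if c == a then nu l + e else if c == l then nu a - e else nu c.

Lemma root_mxE a l x i j :
  root_mx a l x i j = (i == j)%:R + x * ((i == a) && (j == l))%:R.
Proof. by rewrite !mxE. Qed.

Lemma root_mx_outer a l x :
  root_mx a l x = 1%:M + (x *: delta_mx a 0 : 'cV_n) *m (delta_mx 0 l : 'rV_n).
Proof. by rewrite -scalemxAl mul_delta_mx. Qed.

Lemma root_mxK a l x : a != l -> root_mx a l x *m root_mx a l (- x) = 1%:M.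
Proof.
move=> al; rewrite root_mx_outer (_ : root_mx a l (- x) =
  1%:M - (x *: delta_mx a 0 : 'cV_n) *m (delta_mx 0 l : 'rV_n)).
  apply: elementary_mulmx; rewrite -scalemxAr mul_delta_mx_cond.
  by rewrite eq_sym (negbTE al) mulr0n scaler0.
by rewrite root_mx_outer scaleNr mulNmx.
Qed.

Lemma root_mx_unit a l x : a != l -> root_mx a l x \in unitmx.
Proof. by move=> al; have [] := mulmx1_unit (root_mxK x al). Qed.

Lemma invmx_root a l x : a != l -> invmx (root_mx a l x) = root_mx a l (- x).
Proof.
by move=> al; rewrite -[RHS](mulKmx (root_mx_unit x al)) root_mxK // mulmx1.
Qed.


Lemma det_root a l x : a != l -> \det (root_mx a l x) = 1.
Proof.
have diag i : a != l -> root_mx a l x i i = 1.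
  move=> al; rewrite root_mxE eqxx; have [->|ia] := eqVneq i a.
    by rewrite (negbTE al) mulr0 addr0.
  by rewrite mulr0 addr0.
move=> al; have [la|al_lt] := ltnP l a.
  rewrite det_trig; first by apply: big1 => i _; apply: diag.
  apply/is_trig_mxP => i j ij; rewrite root_mxE -val_eqE ltn_eqF // add0r.
  case: andP => [[/eqP ia /eqP jl]|_]; last by rewrite mulr0.
  by move: ij; rewrite ia jl ltnNge ltnW.
rewrite -det_tr det_trig; first by apply: big1 => i _; rewrite mxE; apply: diag.
apply/is_trig_mxP => i j ij; rewrite mxE root_mxE -val_eqE gtn_eqF // add0r.
case: andP => [[/eqP ja /eqP il]|_]; last by rewrite mulr0.
by move: ij; rewrite ja il ltnNge al_lt.
Qed.

Lemma root_GLO a l x : a != l -> O x -> GLO O (root_mx a l x).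
Proof.
have rO y : O y -> intmx O (root_mx a l y).
  move=> Oy; apply: (intmxD Odvr); first exact: (intmx1 Odvr).
  by apply: (intmxZ Odvr) => //; apply: (intmx_delta Odvr).
move=> al Ox; apply: (GLO_exhibit (root_mxK x al)); apply: rO => //.
exact: (dvrN Odvr).
Qed.

Lemma root_iwahori a l x : a != l -> O (x * t ^ (- (a < l)%N%:Z)) ->
  iwahori O t (root_mx a l x).
Proof.
move=> al Ox; have Ox' : O x.
  rewrite -[x](mulfK (dvr_tX_neq0 Odvr (- (a < l)%N%:Z))) invr_expz opprK.
  by apply: (dvrM Odvr) => //; apply: (dvr_tX Odvr).
split; first exact: root_GLO.
move=> r c rc; rewrite root_mxE -val_eqE ltn_eqF //= add0r.
case: andP => [[/eqP ra /eqP cl]|_]; last by rewrite mulr0 mul0r; apply: (dvr0 Odvr).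
by rewrite mulr1; move: Ox; rewrite -ra -cl rc.
Qed.

(** Put x = z^-1 t^e. In the plane of the coordinates [l] and [a] the matrix
    1 + x^-1 E_la is (1 + x E_al) s (1 + x E_al), where s is antidiagonal. The
    right factor stabilizes t^nu O^n by the inequality on [nu], and s reflects
    [nu]. *)
Lemma root_lattice a l (e : int) z (nu : 'I_n -> int) : a != l -> nu a - nu l <= e -> hasv z 0 ->
  lat (root_mx l a (z * t ^ (- e)) *m tdiag nu)
  = lat (root_mx a l (z^-1 * t ^ e) *m tdiag (refl a l e nu)).
Proof.
move=> al nue zO; set x := z^-1 * t ^ e.
have z0 : z != 0 by case: zO.
have x0 : x != 0 by rewrite mulf_neq0 ?invr_eq0 // (dvr_tX_neq0 Odvr).
have xV : z * t ^ (- e) = x^-1 by rewrite /x invfM invrK invr_expz.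
rewrite xV; have la : l != a by rewrite eq_sym.
set nu' := refl a l e nu.
have U1 : root_mx l a x^-1 *m tdiag nu \in unitmx.
  by rewrite unitmx_mul root_mx_unit //= (tdiag_unit Odvr).
have U2 : root_mx a l x *m tdiag nu' \in unitmx.
  by rewrite unitmx_mul root_mx_unit //= (tdiag_unit Odvr).
apply/(lat_eqP Odvr U1 U2).
have prodE (i j c d : 'I_n) (u v : K) : i != j ->
    (root_mx i j u *m root_mx j i v) c d =
    (c == d)%:R + u * ((c == i) && (d == j))%:R + v * ((c == j) && (d == i))%:R
    + u * v * ((c == i) && (d == i))%:R.
  move=> ij; rewrite /root_mx mulmxDl mul1mx mulmxDr mulmx1 -scalemxAl -scalemxAr.
  by rewrite mul_delta_mx scalerA !mxE; ring.
have entry mu mu' (M : 'M[K]_n) i j :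
    (tdiag mu *m M *m tdiag mu') i j = M i j * t ^ (mu i + mu' j).
  by rewrite (mul_tdiag _ _ mu') (tdiag_mul _ mu) (dvr_tD Odvr) mulrAC mulrC mulrA.
have Ot k : 0 <= k -> O (t ^ k) by apply: (dvr_tX Odvr).
have Oz : O z by apply/(has_val_int Odvr zO).
have OzV : O z^-1 by apply/(has_val_int Odvr (has_valV zO)); rewrite oppr0.
have xt k : x * t ^ k = z^-1 * t ^ (e + k) by rewrite (dvr_tD Odvr) mulrA.
have xVt k : x^-1 * t ^ k = z * t ^ (k - e) by rewrite -xV -mulrA -(dvr_tD Odvr) addrC.
have trich i : [\/ i = a, i = l | i != a /\ i != l].
  have [|ia] := eqVneq i a; first by constructor 1.
  by have [|il] := eqVneq i l; [constructor 2|constructor 3].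
apply: (@GLO_exhibit _ _ _ _ (invmx (root_mx a l x *m tdiag nu') *m
                              (root_mx l a x^-1 *m tdiag nu))).
- by rewrite -mulmxA mulKVmx // mulVmx.
- rewrite invmxM ?root_mx_unit ?(tdiag_unit Odvr) // (invmx_tdiag Odvr).
  rewrite invmx_root // mulmxA -[_ *m _ *m root_mx a l x]mulmxA => i j.
  rewrite entry prodE // /nu' /refl.
  case: (trich i) => [->|->|[ia il]]; case: (trich j) => [->|->|[ja jl]];
    rewrite ?eqxx ?(negbTE al) ?(negbTE la) ?(negbTE ia) ?(negbTE il)
      ?(negbTE ja) ?(negbTE jl) /= ?andbF ?mulr0 ?mulr1 ?addr0 ?add0r ?mul1r.
  + by apply: Ot; lia.
  + by rewrite xt; apply: (dvrM Odvr) => //; apply: Ot; lia.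
  + by rewrite eq_sym (negbTE ja) mul0r; apply: (dvr0 Odvr).
  + rewrite mulNr xVt; apply/(dvrN Odvr)/(dvrM Odvr) => //; apply: Ot; lia.
  + by rewrite mulNr mulVf // subrr mul0r; apply: (dvr0 Odvr).
  + by rewrite eq_sym (negbTE jl) mul0r; apply: (dvr0 Odvr).
  + by rewrite mul0r; apply: (dvr0 Odvr).
  + by rewrite mul0r; apply: (dvr0 Odvr).
  + have [->|_] := eqVneq i j; last by rewrite mul0r; apply: (dvr0 Odvr).
    by rewrite mul1r addNr; apply: Ot.
- rewrite invmxM ?root_mx_unit ?(tdiag_unit Odvr) // (invmx_tdiag Odvr).
  rewrite invmx_root // mulmxA -[_ *m _ *m root_mx l a _]mulmxA => i j.
  rewrite entry prodE // /nu' /refl.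
  case: (trich i) => [->|->|[ia il]]; case: (trich j) => [->|->|[ja jl]];
    rewrite ?eqxx ?(negbTE al) ?(negbTE la) ?(negbTE ia) ?(negbTE il)
      ?(negbTE ja) ?(negbTE jl) /= ?andbF ?mulr0 ?mulr1 ?addr0 ?add0r ?mul1r.
  + by rewrite mulNr mulfV // subrr mul0r; apply: (dvr0 Odvr).
  + rewrite mulNr xt; apply/(dvrN Odvr)/(dvrM Odvr) => //; apply: Ot; lia.
  + by rewrite eq_sym (negbTE ja) mul0r; apply: (dvr0 Odvr).
  + by rewrite xVt; apply: (dvrM Odvr) => //; apply: Ot; lia.
  + by apply: Ot; lia.
  + by rewrite eq_sym (negbTE jl) mul0r; apply: (dvr0 Odvr).
  + by rewrite mul0r; apply: (dvr0 Odvr).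
  + by rewrite mul0r; apply: (dvr0 Odvr).
  + have [->|_] := eqVneq i j; last by rewrite mul0r; apply: (dvr0 Odvr).
    by rewrite mul1r addNr; apply: Ot.
Qed.

End RootSubgroups.

(** * Bases adapted to two periodic chains of lattices *)

Section AdaptedBasis.
Variables (K : fieldType) (O : K -> Prop) (t : K).
Hypothesis Odvr : is_dvr O t.
Variable n : nat.
Notation hasv := (has_val O t).
Notation lat := (lat O).
Notation tdiag := (tdiag t).
Implicit Types A B : 'M[K]_n.

(** The standard chain is i |-> t^(omega i) O^n. *)
Definition omega (i : nat) : 'I_n -> int := fun c => (c < i)%N%:Z.

(** Conjugation by the matrices t^(omega i) preserves the integrality of the
    elements of the Iwahori subgroup. *)
Lemma iwahori_conj g i : iwahori O t g ->
  GLO O (tdiag (fun c => - omega i c) *m g *m tdiag (omega i)).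
Proof.
move=> [gO gt]; have [gU gi _] := gO; apply/(GLO_detP Odvr); split.
  move=> r c; rewrite (mul_tdiag _ _ (omega i)) (tdiag_mul _ (fun c => - omega i c)).
  rewrite mulrAC -(dvr_tD Odvr) /omega mulrC.
  have [rc|cr] := ltnP r c.
    have -> : t ^ (- (r < i)%N%:Z + (c < i)%N%:Z)
        = t^-1 * t ^ (- (r < i)%N%:Z + (c < i)%N%:Z + 1).
      by rewrite -[t^-1]/(t ^ (-1)) -(dvr_tD Odvr); congr (t ^ _); lia.
    rewrite mulrA; apply: (dvrM Odvr); first exact: gt.
    by apply: (dvr_tX Odvr); case: ltnP; case: ltnP; lia.
  apply: (dvrM Odvr); first exact: gi.
  by apply: (dvr_tX Odvr); case: ltnP; case: ltnP; lia.
rewrite !det_mulmx mulrAC -det_mulmx (tdiagM Odvr).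
have -> : (fun c => - omega i c + omega i c) = (fun=> 0).
  by apply/funext => c; rewrite addNr.
by rewrite tdiag0 det1 mul1r; have [_] := (GLO_detP Odvr g).1 gO.
Qed.

Let cong (x y : K) := [/\ O x, O y & O ((x - y) / t)].

Let congM x y x' y' : cong x y -> cong x' y' -> cong (x * x') (y * y').
Proof.
move=> [x1 y1 h1] [x2 y2 h2]; split; try exact: (dvrM Odvr).
have -> : (x * x' - y * y') / t = ((x - y) / t) * x' + y * ((x' - y') / t) by ring.
by apply: (dvrD Odvr); apply: (dvrM Odvr).
Qed.

Let cong_det A B : (forall i j, cong (A i j) (B i j)) -> cong (\det A) (\det B).
Proof.
move=> AB; rewrite /determinant.
have refl_c x : O x -> cong x x.
  by move=> Ox; split; rewrite // subrr mul0r; apply: (dvr0 Odvr).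
have c1 := refl_c 1 (dvr1 Odvr).
apply: (big_ind2 cong); first by apply/refl_c/(dvr0 Odvr).
  move=> x y x' y' [x1 y1 h1] [x2 y2 h2]; split; try exact: (dvrD Odvr).
  have -> : (x + x' - (y + y')) / t = (x - y) / t + (x' - y') / t by ring.
  exact: (dvrD Odvr).
move=> s _; apply: congM.
  apply: refl_c; case: (odd_perm s); rewrite ?expr1 ?expr0;
    [apply: (dvrN Odvr)|]; exact: (dvr1 Odvr).
by apply: (big_ind2 cong) => // x y x' y'; apply: congM.
Qed.

(** The determinant is congruent to 1 modulo t. *)
Lemma GLO_congr1 A : intmx O A -> GLO O (1%:M - t *: A).
Proof.
move=> AO; have int1 : intmx O (1%:M - t *: A).
  move=> i j; rewrite mxE; apply: (dvrD Odvr); first exact: (intmx1 Odvr).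
  by rewrite !mxE; apply/(dvrN Odvr)/(dvrM Odvr) => //; apply: (dvr_t Odvr).
have [dO _ dt] : cong (\det (1%:M - t *: A)) (\det (1%:M : 'M_n)).
  apply: cong_det => i j; split; [exact: int1|exact: (intmx1 Odvr)|].
  have -> : ((1%:M - t *: A) i j - (1%:M : 'M_n) i j) / t = - A i j.
    by rewrite !mxE; field; rewrite (dvr_t_neq0 Odvr).
  exact: (dvrN Odvr).
rewrite det1 in dt; set d := \det _ in dO dt *.
have tV k : 0 < k -> ~ O (d * t ^ (- k)).
  move=> k0 Od; apply: (dvr_tV Odvr).
  have -> : t^-1 = d * t ^ (- k) * t ^ (k - 1) - (d - 1) / t.
    rewrite -mulrA -(dvr_tD Odvr) addrA addNr add0r -[t ^ (-1)]/(t^-1).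
    by ring.
  apply: (dvrB Odvr) => //; apply: (dvrM Odvr) => //; apply: (dvr_tX Odvr); lia.
have d0 : d != 0.
  by apply/eqP => d0; apply: (tV 1) => //; rewrite d0 mul0r; apply: (dvr0 Odvr).
have [k dk] := has_valP Odvr d0.
suff k0 : k = 0 by apply/(GLO_detP Odvr); split=> //; rewrite k0 in dk.
have kge : 0 <= k by apply/(has_val_int Odvr dk).
apply/eqP; rewrite eq_le kge andbT leNgt; apply/negP => /tV; apply.
by case: dk.
Qed.

Lemma perm_mx_GLO (s : 'S_n) : GLO O (perm_mx s).
Proof.
have intp (s' : 'S_n) : intmx O (perm_mx s').
  move=> i j; rewrite !mxE.
  by case: eqP => _; [exact: (dvr1 Odvr)|exact: (dvr0 Odvr)].
apply: (@GLO_exhibit _ _ _ _ (perm_mx s^-1)) => //.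
by rewrite -perm_mxM mulgV perm_mx1.
Qed.

Lemma perm_tdiag (s : 'S_n) (mu : 'I_n -> int) :
  perm_mx s *m tdiag mu = tdiag (fun c => mu (s c)) *m perm_mx s.
Proof.
apply/matrixP => r c; rewrite (mul_tdiag _ _ mu) (tdiag_mul _ (fun c => mu (s c))).
by rewrite !mxE; case: eqP => [->|_]; rewrite ?mul1r ?mulr1 ?mul0r ?mulr0.
Qed.

(** The exponents in the decomposition of A^-1 B are nonnegative and their sum is
    1, so that all but one are zero; [v] is the basis vector that belongs to the
    exponent 1. *)
Lemma colength_one A B k : A \in unitmx -> B \in unitmx -> lat B `<=` lat A ->
  hasv (\det A) k -> hasv (\det B) (k + 1) ->
  exists2 v, lat A v & forall x, lat A x -> exists2 a, O a & lat B (x - a *: v).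
Proof.
move=> AU BU sBA Ak Bk; have MO := (lat_subP Odvr BU AU).1 sBA.
have MU : invmx A *m B \in unitmx by rewrite unitmx_mul unitmx_inv AU.
have [g [b [s [nu [[gO _] [bO _] ME]]]]] := iwahori_decomposition Odvr MU.
have gU := GLO_unit gO; have bU := GLO_unit bO.
have nu0 i : 0 <= nu i.
  have : intmx O (tdiag nu *m perm_mx s).
    have -> : tdiag nu *m perm_mx s = invmx g *m (invmx A *m B) *m invmx b.
      by rewrite ME -!mulmxA mulKmx // mulmxV // mulmx1.
    by case: gO bO => _ _ gV [_ _ bV]; apply: (intmxM Odvr) bV; apply: (intmxM Odvr).
  move=> /(_ i (s i)); rewrite (tdiag_mul _ nu) !mxE eqxx mulr1.
  by move/(dvr_tXP Odvr).
have nu1 : \sum_i nu i = 1.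
  have dM : hasv (\det (invmx A *m B)) 1.
    have := has_valM Odvr (has_valV Ak) Bk.
    by rewrite det_mulmx det_inv addrA addNr add0r.
  apply: (has_val_inj Odvr _ dM); rewrite ME !det_mulmx det_perm (det_tdiag Odvr).
  have [_ dg] := (GLO_detP Odvr g).1 gO; have [_ db] := (GLO_detP Odvr b).1 bO.
  have ds : hasv ((-1) ^+ s) 0.
    split; rewrite ?signr_eq0 // ?oppr0 expr0z mulr1.
      by case: (odd_perm s); rewrite ?expr1 ?expr0;
        [apply: (dvrN Odvr)|]; exact: (dvr1 Odvr).
    by rewrite -exprVn invrN1; case: (odd_perm s); rewrite ?expr1 ?expr0;
        [apply: (dvrN Odvr)|]; exact: (dvr1 Odvr).
  have := has_valM Odvr (has_valM Odvr (has_valM Odvr dg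
    (has_val_tX Odvr (\sum_i nu i))) ds) db.
  by rewrite add0r !addr0.
have [c nuc] : exists c, nu c = 1.
  apply: contrapT => nc; have nz i : nu i != 0 -> 2 <= nu i.
    move=> h; have := nu0 i; have : nu i <> 1 by move=> h1; apply: nc; exists i.
    by move: h; lia.
  have [i ni] : exists i, nu i != 0.
    apply: contrapT => nn; have : \sum_i nu i = 0.
      by apply: big1 => i _; apply: contrapT => /eqP ni; apply: nn; exists i.
    by rewrite nu1.
  have : 2 + 0 <= \sum_i nu i.
    by rewrite (bigD1 i) //=; apply: lerD; [exact: nz|exact: sumr_ge0].
  by rewrite nu1.
have nuz i : i != c -> nu i = 0.
  move=> ic; apply/eqP; rewrite eq_le nu0 andbT.
  have : nu c + (nu i + 0) <= \sum_i nu i.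
    rewrite (bigD1 c) //= (bigD1 i) //=; do 2!apply: lerD => //.
    exact: sumr_ge0.
  by rewrite nu1 nuc addr0 -subr_ge0 opprD addrA subrr add0r oppr_ge0.
exists (A *m (g *m delta_mx c 0)).
  by exists (g *m delta_mx c 0) => //; apply: (intmxM Odvr); [case: gO|apply: (intmx_delta Odvr)].
move=> x [y yO <-]; set z := invmx g *m y.
have zO : intmx O z by apply: (intmxM Odvr) => //; case: gO.
exists (z c 0); first exact: zO.
apply/(latP _ _ BU).
have -> : invmx B *m (A *m y - z c 0 *: (A *m (g *m delta_mx c 0)))
    = invmx (invmx A *m B) *m (g *m (z - z c 0 *: delta_mx c 0)).
  rewrite invmxM ?unitmx_inv // invmxK -mulmxA; congr (_ *m _).
  by rewrite [in RHS]mulmxBr mulKVmx // -scalemxAr mulmxBr -scalemxAr.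
clearbody z.
rewrite ME invmxM ?unitmx_mul ?gU ?bU ?unitmx_perm ?(tdiag_unit Odvr) //.
rewrite invmxM ?unitmx_mul ?gU ?unitmx_perm ?(tdiag_unit Odvr) //.
rewrite invmxM ?(tdiag_unit Odvr) // -!mulmxA mulKmx //.
case: bO => _ _ bV; apply: (intmxM Odvr) => //; apply: (intmxM Odvr).
  by case: (perm_mx_GLO s).
rewrite (invmx_tdiag Odvr) => i j; rewrite (tdiag_mul _ (fun i => - nu i)) !mxE ord1 eqxx andbT.
have [->|ic] := eqVneq i c; first by rewrite mulr1 subrr mulr0; apply: (dvr0 Odvr).
by rewrite nuz // oppr0 expr0z mul1r mulr0 subr0; apply: zO.
Qed.

(** Any periodic chain of lattices and the standard chain have a common adapted
    basis. The vectors that generate the successive quotients of the chain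
    generate its first lattice by Nakayama's lemma, and the affine Bruhat
    decomposition of their matrix compares them with the standard basis: its left
    factor preserves the standard chain, its right factor the given one. *)
Theorem common_adapted_basis (B : nat -> 'M[K]_n) k :
  (forall i, (i <= n)%N -> B i \in unitmx) ->
  (forall i, (i <= n)%N -> hasv (\det (B i)) (k + i%:Z)) ->
  (forall i, (i < n)%N -> lat (B i.+1) `<=` lat (B i)) ->
  lat (B n) = lat (t *: B 0%N) ->
  exists g nu (s : 'S_n), iwahori O t g /\
    forall i, (i <= n)%N -> lat (B i) = lat (g *m tdiag (fun c => nu c + omega i (s c))).
Proof.
move=> BU Bk Bsub Bn; have t0 := dvr_t_neq0 Odvr.
have step (i : 'I_n) : exists v, lat (B i) v /\
    forall x, lat (B i) x -> exists2 a, O a & lat (B i.+1) (x - a *: v).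
  have [|||||v v1 v2] := @colength_one (B i) (B i.+1) (k + i%:Z).
  - by apply: BU; apply: ltnW.
  - exact: BU.
  - exact: Bsub.
  - by apply: Bk; apply: ltnW.
  - by have := Bk _ (ltn_ord i); rewrite (_ : k + i.+1%:Z = k + i%:Z + 1); last lia.
  by exists v.
have [v vP] := choice step.
have Bsub_le i j : (i <= j)%N -> (j <= n)%N -> lat (B j) `<=` lat (B i).
  elim: j => [|j IH]; first by rewrite leqn0 => /eqP-> _ x.
  rewrite leq_eqVlt => /orP[/eqP-> _ x //|ij jn x xj].
  by apply: IH => //; [exact: ltnW|apply: (Bsub j)].
pose A : 'M[K]_n := \matrix_(r, c) v c r 0.
have colA c : col c A = v c by apply/matrixP => i j; rewrite !mxE ord1.
have expand m : (m <= n)%N -> forall x, lat (B (n - m)%N) x ->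
    exists w : 'cV[K]_n, [/\ intmx O w, forall r : 'I_n, (r < n - m)%N -> w r 0 = 0
                          & lat (B n) (x - A *m w)].
  elim: m => [_ x|m IH mn x xB].
    rewrite subn0 => xB; exists 0; split=> [i j|r _|]; rewrite ?mxE //.
      exact: (dvr0 Odvr).
    by rewrite mulmx0 subr0.
  have lt_n : (n - m.+1 < n)%N by lia.
  have [vB /(_ _ xB)[a Oa]] := vP (Ordinal lt_n).
  rewrite /= subnSK // => /(IH (ltnW mn))[w [wO w0 wB]].
  exists (w + a *: delta_mx (Ordinal lt_n) 0); split.
  - apply: (intmxD Odvr) => //; apply: (intmxZ Odvr) => //; exact: (intmx_delta Odvr).
  - move=> r rm; rewrite !mxE w0; last by lia.
    by rewrite -val_eqE /= ltn_eqF // mulr0 addr0.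
  - by rewrite mulmxDr -scalemxAr -colE colA opprD [- _ - _]addrC addrA.
have latB0 i x : (i <= n)%N -> lat (B i) x -> lat (B 0%N) x by move=> hi; apply: (Bsub_le 0%N i).
have B0U := BU 0%N (leq0n n); have tB0U : t *: B 0%N \in unitmx.
  by rewrite unitmxZ // unitfE.
pose V := invmx (B 0%N) *m A; have AE : A = B 0%N *m V by rewrite mulKVmx.
have VO : intmx O V.
  move=> i c; have /latP : lat (B 0%N) (v c) by apply: (latB0 c); [exact: ltnW|case: (vP c)].
  by move=> /(_ B0U i 0); rewrite -colA colE mulmxA -colE mxE.
have W_ex (j : 'I_n) : exists wy : 'cV[K]_n * 'cV[K]_n,
    [/\ intmx O wy.1, intmx O wy.2 & delta_mx j 0 = V *m wy.1 + t *: wy.2].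
  have [|w [wO _]] := @expand n (leqnn n) (B 0%N *m delta_mx j 0).
    by rewrite subnn; exists (delta_mx j 0) => //; apply: (intmx_delta Odvr).
  rewrite Bn => -[y yO yE]; exists (w, y); split=> //=.
  have : invmx (B 0%N) *m (t *: B 0%N *m y)
      = invmx (B 0%N) *m (B 0%N *m delta_mx j 0 - A *m w) by rewrite yE.
  rewrite -scalemxAl -scalemxAr mulKmx // mulmxBr mulKmx // mulmxA => ->.
  by rewrite addrC subrK.
have [WY WYP] := choice W_ex.
pose W : 'M[K]_n := \matrix_(i, j) (WY j).1 i 0.
pose Y : 'M[K]_n := \matrix_(i, j) (WY j).2 i 0.
have VW : V *m W = 1%:M - t *: Y.
  apply/matrixP => i j; have [_ _ /matrixP/(_ i 0)] := WYP j.
  rewrite [LHS]mxE eqxx andbT [RHS]mxE [X in _ + X]mxE => ij.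
  have -> : (1%:M - t *: Y) i j = (i == j)%:R - t * (WY j).2 i 0 by rewrite !mxE.
  rewrite ij addrK [LHS]mxE [RHS]mxE; apply: eq_bigr => l _.
  by rewrite [W l j]mxE.
have YO : intmx O Y by move=> i j; rewrite mxE; case: (WYP j).
have WO : intmx O W by move=> i j; rewrite mxE; case: (WYP j).
have VG : GLO O V.
  have gO := GLO_congr1 YO; apply: (@GLO_exhibit _ _ _ _ (W *m invmx (1%:M - t *: Y))) => //.
    by rewrite mulmxA VW mulmxV // (GLO_unit gO).
  by apply: (intmxM Odvr) => //; case: gO.
have AU : A \in unitmx by rewrite AE unitmx_mul B0U (GLO_unit VG).
have B0A : lat (B 0%N) = lat A by rewrite AE (lat_GLO Odvr).
have BA i : (i <= n)%N -> lat (B i) = lat (A *m tdiag (omega i)).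
  move=> i_n; have AtU : A *m tdiag (omega i) \in unitmx.
    by rewrite unitmx_mul AU (tdiag_unit Odvr).
  have BnA x : lat (B n) x <-> exists2 y, intmx O y & x = t *: (A *m y).
    rewrite Bn; split=> [[y yO <-]|[y yO ->]].
      have : lat (B 0%N) (B 0%N *m y) by exists y.
      by rewrite B0A => -[z zO ze]; exists z => //; rewrite -scalemxAl -ze.
    have : lat A (A *m y) by exists y.
    by rewrite -B0A => -[z zO ze]; exists z => //; rewrite -scalemxAl ze.
  apply/seteqP; split=> x.
    move=> xB; have [|w [wO w0 wB]] := @expand (n - i)%N (leq_subr _ _) x.
      by rewrite subKn.
    rewrite subKn // in w0; move/BnA: wB => [y yO yE].
    exists (tdiag (fun c => - omega i c) *m (w + t *: y)).
      move=> r c; rewrite ord1 (tdiag_mul _ (fun c => - omega i c)) !mxE mulrDr.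
      rewrite /omega; have [ri|ir] := ltnP r i.
        rewrite w0 // mulr0 add0r mulrA -[t ^ _]/(t^-1) mulVf // mul1r; exact: yO.
      by rewrite oppr0 expr0z !mul1r; apply: (dvrD Odvr) => //;
        apply: (dvrM Odvr) => //; apply: (dvr_t Odvr).
    rewrite -mulmxA [tdiag _ *m (_ *m _)]mulmxA (tdiagM Odvr).
    rewrite (_ : (fun c => omega i c + - omega i c) = fun=> 0); last first.
      by apply/funext => c; rewrite subrr.
    by rewrite tdiag0 mul1mx mulmxDr -scalemxAr -yE addrC subrK.
  move=> [y yO <-]; rewrite -mulmxA.
  (* The columns of A t^omega all lie in the lattice of [B i]. *)
  have [M MO ME] : exists2 M, intmx O M & A *m tdiag (omega i) = B i *m M.
    exists (invmx (B i) *m (A *m tdiag (omega i))); last by rewrite mulKVmx // BU.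
    move=> r c; have /latP : lat (B i) (t ^ omega i c *: v c).
      rewrite /omega; have [ci|ic] := ltnP c i.
        apply: (Bsub_le i n) => //; apply/BnA; exists (delta_mx c 0).
          exact: (intmx_delta Odvr).
        by rewrite -colE colA.
      rewrite expr0z scale1r; apply: (Bsub_le i c) => //; first exact: ltnW.
      by case: (vP c).
    move=> /(_ (BU i i_n) r 0); congr O.
    have -> : t ^ omega i c *: v c = col c (A *m tdiag (omega i)).
      apply/matrixP => a b; rewrite [RHS]mxE (mul_tdiag _ _ (omega i)).
      by rewrite !mxE mulrC ord1.
    by rewrite colE mulmxA -colE mxE.
  by rewrite mulmxA ME -mulmxA; exists (M *m y) => //; apply: (intmxM Odvr).
have [g [b [s [nu [gI bI AE']]]]] := iwahori_decomposition Odvr AU.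
exists g, nu, s; split=> // i i_n; rewrite BA //.
have bC := iwahori_conj i bI.
have bt : b *m tdiag (omega i)
    = tdiag (omega i) *m (tdiag (fun c => - omega i c) *m b *m tdiag (omega i)).
  rewrite !mulmxA (tdiagM Odvr) (_ : (fun c => omega i c + - omega i c) = fun=> 0).
    by rewrite tdiag0 mul1mx.
  by apply/funext => c; rewrite subrr.
have gU : g \in unitmx by case: gI => /GLO_unit.
move: bC bt; move: (_ *m b *m _) => b' bC bt.
rewrite AE' -mulmxA bt mulmxA -[_ *m perm_mx s *m _]mulmxA perm_tdiag.
rewrite mulmxA -[g *m _ *m tdiag _]mulmxA (tdiagM Odvr).
have gtU : g *m tdiag (fun c => nu c + omega i (s c)) \in unitmx.
  by rewrite unitmx_mul gU (tdiag_unit Odvr).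
have gtsU : g *m tdiag (fun c => nu c + omega i (s c)) *m perm_mx s \in unitmx.
  by rewrite unitmx_mul gtU unitmx_perm.
rewrite (lat_GLO Odvr gtsU bC).
by rewrite (lat_GLO Odvr gtU (perm_mx_GLO s)).
Qed.

End AdaptedBasis.

(** * The dominance order *)

Section Dominance.
Variable n : nat.
Implicit Types (lambda mu : 'I_n -> int) (k : int) (a l c : 'I_n).

(** The dimension of O^n / (t^mu O^n + t^k O^n) for the nonnegative [mu]; as a
    function of [k] it determines [mu] up to permutation. *)
Definition hinge k mu : int := \sum_c Num.max (k - mu c) 0.

(** Up to permutation of the entries, [mu] is at most [lambda] in the dominance
    order. *)
Definition dominated lambda mu :=
  \sum_c mu c = \sum_c lambda c /\ forall k, hinge k mu <= hinge k lambda.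

Definition transfer a l mu : 'I_n -> int :=
  fun c => mu c + (c == a)%:Z - (c == l)%:Z.

Lemma sum_bigD2 (F : 'I_n -> int) a l : a != l ->
  \sum_c F c = F a + F l + \sum_(c | (c != a) && (c != l)) F c.
Proof. by move=> al; rewrite (bigD1 a) //= (bigD1 l) ?addrA // eq_sym. Qed.

Lemma transfer_out a l mu c : c != a -> c != l -> transfer a l mu c = mu c.
Proof. by rewrite /transfer => /negbTE-> /negbTE->; rewrite addr0 subr0. Qed.

Lemma transfer_l a l mu : a != l -> transfer a l mu a = mu a + 1.
Proof. by rewrite /transfer eqxx => /negbTE->; rewrite subr0. Qed.

Lemma transfer_r a l mu : a != l -> transfer a l mu l = mu l - 1.
Proof. by rewrite /transfer eqxx eq_sym => /negbTE->; rewrite addr0. Qed.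

Lemma sum_transfer a l mu : a != l -> \sum_c transfer a l mu c = \sum_c mu c.
Proof.
move=> al; rewrite !(sum_bigD2 _ al) transfer_l // transfer_r //.
rewrite (eq_bigr mu) => [|c /andP[]]; last exact: transfer_out.
by rewrite addrACA subrr addr0.
Qed.

Lemma hinge_transfer a l mu k : a != l ->
  hinge k (transfer a l mu) = hinge k mu + (mu l <= k)%R%:Z - (mu a < k)%R%:Z.
Proof.
move=> al; rewrite /hinge !(sum_bigD2 _ al) transfer_l // transfer_r //.
rewrite (eq_bigr (fun c => Num.max (k - mu c) 0)); last first.
  by move=> c /andP[ca cl]; rewrite transfer_out.
by move: (\sum_(_ | _) _) (mu a) (mu l) => S x y; case: leP; case: ltP; lia.
Qed.

(** By [hinge_transfer] the hinge increases, by one, exactly for the [k] between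
    [mu l] and [mu a], and there the hypothesis leaves room. *)
Lemma dominated_transfer lambda mu a l : a != l -> dominated lambda mu ->
  (forall k, hinge k mu = hinge k lambda -> mu l <= k -> k <= mu a -> False) ->
  dominated lambda (transfer a l mu).
Proof.
move=> al [s0 h] free; split; first by rewrite sum_transfer.
move=> k; rewrite hinge_transfer //; have := h k; have := free k.
have [->|/eqP hk] := eqVneq (hinge k mu) (hinge k lambda).
  by move=> /(_ erefl); case: leP; case: ltP; lia.
by move: hk; case: leP; case: ltP; lia.
Qed.

Lemma hinge_ge k mu c : Num.max (k - mu c) 0 <= hinge k mu.
Proof.
rewrite /hinge (bigD1 c) //= lerDl; apply: sumr_ge0 => i _.
by rewrite le_max lexx orbT.
Qed.

Lemma hinge_small k mu : (forall c, k <= mu c) -> hinge k mu = 0.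
Proof. by move=> h; apply: big1 => c _; have := h c; lia. Qed.

Lemma hinge_big k mu : (forall c, mu c <= k) -> hinge k mu = k * n%:Z - \sum_c mu c.
Proof.
move=> h; rewrite /hinge (eq_bigr (fun c => k - mu c)) => [|c _].
  by rewrite sumrB sumr_const card_ord -mulr_natr natz.
by have := h c; lia.
Qed.

Definition bound mu : int := \sum_c `|mu c|.

Lemma boundP mu c : `|mu c| <= bound mu.
Proof. by rewrite /bound (bigD1 c) //= lerDl; apply: sumr_ge0. Qed.

(** Let B be the bound. At k = - B the hinge of [lambda] is zero, which bounds
    [mu] from below; at k = B it is k n minus the sum of the entries, and the
    hinge of [mu] is larger than this if an entry of [mu] exceeds B. *)
Lemma dominated_bound lambda mu c : dominated lambda mu -> `|mu c| <= bound lambda.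
Proof.
move=> [s0 h]; set B := bound lambda.
have lB d : - B <= lambda d <= B by rewrite -ler_norml; apply: boundP.
rewrite ler_norml; apply/andP; split.
  have := le_trans (hinge_ge (- B) mu c) (h (- B)).
  by rewrite hinge_small => [|d]; [lia|case/andP: (lB d)].
have hB : hinge B lambda = B * n%:Z - \sum_c lambda c.
  by apply: hinge_big => d; case/andP: (lB d).
have : \sum_d (Num.max (B - mu d) 0 - (B - mu d)) <= 0.
  rewrite sumrB -/(hinge B mu) sumrB sumr_const card_ord -mulr_natr natz.
  by have := h B; rewrite hB s0; lia.
rewrite (bigD1 c) //=.
have : 0 <= \sum_(d | d != c) (Num.max (B - mu d) 0 - (B - mu d)).
  by apply: sumr_ge0 => d _; lia.
by move: (\sum_(_ | _) _) => S; lia.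
Qed.

Definition below k mu : nat := #|[pred c | mu c <= k]|.

Lemma hinge_succ k mu : hinge (k + 1) mu = hinge k mu + (below k mu)%:Z.
Proof.
rewrite /below -sum1_card /hinge [\sum_(_ in _) _]big_mkcond /=.
rewrite (big_morph Posz PoszD erefl) -big_split /=; apply: eq_bigr => c _.
by rewrite unfold_in /=; case: leP => h /=; lia.
Qed.

Lemma below_eq_perm lambda mu : (forall k, below k mu = below k lambda) ->
  exists s : 'S_n, forall c, mu c = lambda (s c).
Proof.
move=> h; pose tl := [tuple lambda c | c < n]; pose tm := [tuple mu c | c < n].
have /tuple_permP[s sE] : perm_eq tm tl.
  have cnt (f : 'I_n -> int) k :
      count_mem k [tuple f c | c < n] = (below k f - below (k - 1) f)%N.
    have -> : below k f = (below (k - 1) f + #|[pred c | f c == k]|)%N.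
      rewrite /below -!sum1_card [LHS]big_mkcond ![\sum_(_ in _) _]big_mkcond.
      rewrite -big_split /=; apply: eq_bigr => c _; rewrite !inE.
      move: (f c) => x.
      by case: (leP x k) => h1; case: (leP x (k - 1)) => h2; case: (x =P k) => h3 /=; lia.
    rewrite addKn /= count_map -sum1_count -sum1_card big_enum_cond /=.
    by apply: eq_bigl => c; rewrite !inE.
  by apply/allP => k _ /=; rewrite !cnt // !h.
exists s => c; have /(congr1 (fun x => nth 0 x c)) := sE.
by rewrite -!tnth_nth !tnth_mktuple.
Qed.

(** A weight that is not extremal can be moved outwards. Call [k] tight if the
    hinges of [mu] and [lambda] agree at [k]; if they differ somewhere between two
    consecutive tight values, comparison of their slopes at the two ends shows
    that at least two entries of [mu] lie strictly between these values. *)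
Lemma dominated_extremal lambda mu : dominated lambda mu ->
  (exists s : 'S_n, forall c, mu c = lambda (s c)) \/
  exists a l, [/\ a != l, mu l <= mu a & dominated lambda (transfer a l mu)].
Proof.
move=> mu_dom; have [sum_mu le_hinge] := mu_dom.
pose tight k := hinge k mu == hinge k lambda.
have [all_tight|] := EM (forall k, tight k).
  left; apply: below_eq_perm => k.
  by have /eqP := all_tight (k + 1); have /eqP := all_tight k; rewrite !hinge_succ; lia.
move=> /existsNP[k /negP k_loose]; right.
have muB := @dominated_bound lambda mu ^~ mu_dom.
have lB c := boundP lambda c; set B := bound lambda in muB lB.
have low k' : k' <= - B -> tight k'.
  by move=> h; apply/eqP; rewrite !hinge_small // => c; have := muB c; have := lB c; lia.
have high k' : B <= k' -> tight k'.
  move=> h; apply/eqP; rewrite !hinge_big ?sum_mu // => c;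
    [have := lB c|have := muB c]; lia.
have [k0 k0_tight k0_max] : exists2 k0, tight k0 /\ k0 < k
    & forall j, k0 < j -> j <= k -> ~~ tight j.
  have ex : exists m : nat, tight (k - m%:Z) by exists (absz (k + B)%R); apply: low; lia.
  case: (ex_minnP ex) => m m_tight m_min; exists (k - m%:Z).
    split=> //; suff : m != 0%N by lia.
    by apply: contraNneq k_loose => m0; move: m_tight; rewrite m0 subr0.
  move=> j h1 h2; apply/negP => j_tight; have := m_min (absz (k - j)%R).
  by rewrite (_ : k - (absz (k - j)%R)%:Z = j); [move=> /(_ j_tight); lia|lia].
have [k1 k1_tight k1_min] : exists2 k1, tight k1 /\ k < k1
    & forall j, j < k1 -> k <= j -> ~~ tight j.
  have ex : exists m : nat, tight (k + m%:Z) by exists (absz (B - k)%R); apply: high; lia.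
  case: (ex_minnP ex) => m m_tight m_min; exists (k + m%:Z).
    split=> //; suff : m != 0%N by lia.
    by apply: contraNneq k_loose => m0; move: m_tight; rewrite m0 addr0.
  move=> j h1 h2; apply/negP => j_tight; have := m_min (absz (j - k)%R).
  by rewrite (_ : k + (absz (j - k)%R)%:Z = j); [move=> /(_ j_tight); lia|lia].
case: k0_tight => /eqP k0_tight k0k; case: k1_tight => /eqP k1_tight kk1.
have loose j : k0 < j -> j < k1 -> ~~ tight j.
  by move=> h1 h2; case: (leP j k) => h3; [apply: k0_max|apply: k1_min => //; lia].
have slope0 : (below k0 mu < below k0 lambda)%N.
  have := loose (k0 + 1); rewrite /tight !hinge_succ k0_tight.
  have := le_hinge (k0 + 1); rewrite !hinge_succ k0_tight lerD2l.
  move=> h1 h2; have {}h2 : below k0 mu <> below k0 lambda.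
    by move=> h3; move/negP: (h2 ltac:(lia) ltac:(lia)); rewrite h3 eqxx; apply.
  by lia.
have slope1 : (below (k1 - 1) lambda < below (k1 - 1) mu)%N.
  have k1E : k1 = k1 - 1 + 1 by lia.
  have := loose (k1 - 1); have := le_hinge (k1 - 1); rewrite /tight.
  move: k1_tight; rewrite [in hinge k1 mu]k1E [in hinge k1 lambda]k1E !hinge_succ.
  move=> h0 h1 h2; have {}h2 := h2 ltac:(lia) ltac:(lia); move/eqP: h2; lia.
have below_mono (f : 'I_n -> int) : (below k0 f <= below (k1 - 1) f)%N.
  by apply/subset_leq_card/fintype.subsetP => c; rewrite !inE; lia.
pose mid := [pred c | (k0 < mu c) && (mu c < k1)].
have card_mid : below (k1 - 1) mu = (below k0 mu + #|mid|)%N.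
  rewrite /below -!sum1_card [LHS]big_mkcond ![\sum_(_ in _) _]big_mkcond.
  rewrite -big_split /=; apply: eq_bigr => c _; rewrite !inE; move: (mu c) => x.
  by case: (leP x (k1 - 1)) => h1; case: (leP x k0) => h2; case: (ltP x k1) => h3 /=; lia.
have : (1 < #|mid|)%N by have := below_mono lambda; lia.
case/card_gt1P => a [l [a_mid l_mid al]].
wlog mu_la : a l a_mid l_mid al / mu l <= mu a => [gen|].
  by have [/gen|/ltW/gen] := leP (mu l) (mu a); apply => //; rewrite eq_sym.
exists a, l; split=> //; apply: dominated_transfer => // j j_tight h1 h2.
have j0 : k0 < j by move: l_mid; rewrite inE => /andP[]; lia.
have j1 : j < k1 by move: a_mid; rewrite inE => /andP[]; lia.
by have := loose j j0 j1; rewrite /tight j_tight eqxx.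
Qed.

End Dominance.

(** * Chains of coordinate lattices *)

Section AffinePermutations.
Variable n : nat.
Implicit Types (lambda : 'I_n -> int) (a l c : 'I_n).

(** Along a path of dominated weights that raises the coordinate [sigma i] and
    lowers [rho i] at time [i], suppose that [a] is lowered at time [t0] and not
    touched again before time [q]. Then one of the coordinates raised meanwhile
    can give a unit back to [a] at all times after it was raised, up to [q].
    Otherwise every obstruction, that is a tight value between the entries of the
    two coordinates, would propagate backwards to the time just after [t0], where
    the step at time [t0] itself shows that [sigma t0] is not obstructed. *)
Lemma unobstructed_step lambda (mu : nat -> 'I_n -> int) (sigma rho : nat -> 'I_n)
    (t0 q : nat) a :
  (t0 < q)%N ->
  (forall i, (t0 <= i < q)%N -> sigma i != rho i ->
     mu i.+1 = transfer (sigma i) (rho i) (mu i)) ->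
  (forall i, (t0 <= i < q)%N -> sigma i = rho i -> mu i.+1 = mu i) ->
  (forall i, (t0 <= i <= q)%N -> dominated lambda (mu i)) ->
  rho t0 = a -> sigma t0 != a ->
  (forall i, (t0 < i < q)%N -> sigma i != a /\ rho i != a) ->
  exists p, [/\ (t0 <= p < q)%N, sigma p != rho p
    & forall i k, (p < i <= q)%N -> hinge k (mu i) = hinge k lambda ->
        mu i (sigma p) <= k -> k <= mu i a -> False].
Proof.
move=> t0q step still dom rho0 sigma0 avoid; apply: contrapT => none.
pose obstructed c i := exists k,
  [/\ hinge k (mu i) = hinge k lambda, mu i c <= k & k <= mu i a].
have entered p : (t0 <= p < q)%N -> sigma p != rho p ->
    exists2 i, (p < i <= q)%N & obstructed (sigma p) i.
  move=> pq sp; apply: contrapT => no; apply: none; exists p; split=> // i k iq h1 h2 h3.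
  by apply: no; exists i => //; exists k.
(* What an obstruction of [sigma i] at time [i + 1] says about time [i]. *)
have back i k : (t0 <= i < q)%N -> sigma i != rho i ->
    hinge k (mu i.+1) = hinge k lambda -> mu i.+1 (sigma i) <= k ->
    hinge k (mu i) = hinge k lambda /\ mu i (rho i) <= k.
  move=> iq si; rewrite (step i iq si) hinge_transfer // transfer_l // => h1 h2.
  have [_ /(_ k)] : dominated lambda (mu i) by apply: dom; lia.
  by move: h1; case: (leP (mu i (rho i)) k) => h3; case: (ltP (mu i (sigma i)) k) => h4 /=; lia.
have const i : (t0 < i < q)%N -> mu i.+1 a = mu i a.
  move=> iq; have [sa ra] := avoid i iq.
  have [si|si] := eqVneq (sigma i) (rho i); first by rewrite still //; lia.
  by rewrite step; [rewrite transfer_out // eq_sym|lia|].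
have propagate m : (t0 < q - m)%N -> (m <= q)%N -> forall c i, c != a ->
    (q - m <= i <= q)%N -> obstructed c i -> obstructed c (q - m)%N.
  elim: m => [|m IH] qm mq c i ca iq ob.
    by move: ob; rewrite (_ : i = q - 0)%N //; lia.
  have [iE|iqm] := eqVneq i (q - m.+1)%N; first by rewrite -iE.
  set j := (q - m.+1)%N in qm iq iqm *; have jq : (t0 < j < q)%N by lia.
  have jS : (q - m)%N = j.+1 by lia.
  have {}IH c' i' : c' != a -> (j < i' <= q)%N -> obstructed c' i' -> obstructed c' j.+1.
    by rewrite -jS => c'a i'q; apply: IH => //; lia.
  have {ob} [k1 [h1 h2 h3]] : obstructed c j.+1 by apply: IH ob => //; lia.
  have jM := const j jq; have [sa ra] := avoid j jq.
  have [si|si] := eqVneq (sigma j) (rho j).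
    by exists k1; rewrite -still //; lia.
  have [||i' i'q /(IH _ _ sa i'q)[k2 [h4 h5 h6]]] := entered j; [lia|done|].
  pose k := Num.max k1 k2.
  have hk : hinge k (mu j.+1) = hinge k lambda by rewrite /k; case: leP.
  have [||kt kr] := back j k _ si hk; [lia|rewrite /k; lia|].
  exists k; split=> //; last by rewrite /k -jM; lia.
  have [->|cr] := eqVneq c (rho j); first by [].
  have : mu j c <= mu j.+1 c by rewrite step //; [rewrite /transfer (negbTE cr)|]; lia.
  by rewrite /k; lia.
have [||i iq ob] := entered t0; [lia|by rewrite rho0|].
have : obstructed (sigma t0) t0.+1.
  have -> : t0.+1 = (q - (q - t0.+1))%N by lia.
  by apply: (propagate _ _ _ _ i) => //; lia.
move=> [k [h1 h2 h3]]; have [||_] := back t0 k _ _ h1 h2; [lia|by rewrite rho0|].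
move: h3; rewrite step; [|lia|by rewrite rho0].
by rewrite rho0 transfer_r //; lia.
Qed.

Definition wind (i : nat) c : nat := \sum_(r < i) (r %% n == c).

Lemma wind_succ i c : wind i.+1 c = (wind i c + (i %% n == c))%N.
Proof. by rewrite /wind big_ord_recr. Qed.

Lemma wind_small i c : (i <= n)%N -> wind i c = (c < i)%N.
Proof.
elim: i => [|i IH] i_n; first by rewrite /wind big_ord0.
rewrite wind_succ IH; last exact: ltnW.
by rewrite modn_small // ltnS; case: ltngtP.
Qed.

Lemma wind_period i c : wind (i + n) c = (wind i c).+1.
Proof.
elim: i => [|i IH]; first by rewrite add0n wind_small // ltn_ord /wind big_ord0.
by rewrite addSn !wind_succ IH modnDr addSn.
Qed.

(** An extended affine permutation is encoded by a weight [nu] and a permutation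
    [s]: the i-th lattice of its chain is t^(chain nu s i) O^n, and the chain
    meets the coordinate [c] at the times congruent to [s c]. *)
Definition chain (nu : 'I_n -> int) (s : 'S_n) (i : nat) : 'I_n -> int :=
  fun c => nu c + (wind i (s c))%:Z.

(** The position of the i-th lattice relative to that of the standard chain. *)
Definition relpos nu s i : 'I_n -> int := fun c => chain nu s i c - (wind i c)%:Z.

Lemma relpos_period nu s i : relpos nu s (i + n) = relpos nu s i.
Proof. by apply/funext => c; rewrite /relpos /chain !wind_period; lia. Qed.

Lemma chain_refl nu s a l e i : a != l ->
  chain (refl a l e nu) (tperm a l * s) i = refl a l e (chain nu s i).
Proof.
move=> al; apply/funext => c; rewrite /chain /refl permM.
have [->|ca] := eqVneq c a; first by rewrite tpermL; lia.
have [->|cl] := eqVneq c l; first by rewrite tpermR; lia.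
by rewrite tpermD // eq_sym.
Qed.

Lemma sum_wind c : (\sum_(i < n) wind i c = n - c.+1)%N.
Proof.
rewrite (eq_bigr (fun i : 'I_n => (c < i)%N : nat)); last first.
  by move=> i _; rewrite wind_small // ltnW.
rewrite -(big_mkord xpredT (fun i => (c < i)%N : nat)).
rewrite (big_cat_nat (n := c.+1)) //= big_nat big1 => [|i]; last first.
  by move=> /andP[_ ic]; apply/eqP; rewrite eqb0 -leqNgt -ltnS.
rewrite add0n big_nat (eq_bigr (fun=> 1%N)) => [|i /andP[-> _] //].
by rewrite -big_nat sum_nat_const_nat muln1.
Qed.

Definition total (nu : 'I_n -> int) s c : int := \sum_(i < n) relpos nu s i c.

Let slope_bound (e : int) (a l : nat) : (a < n)%N -> (l < n)%N ->
  1 + l%:Z - a%:Z <= e * n%:Z -> (a < l)%N%:Z <= e.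
Proof.
move=> an ln h; rewrite leNgt; apply/negP; case: (ltnP a l) => al e1.
  suff : e * n%:Z <= 0 by lia.
  by apply: mulr_le0_ge0; lia.
suff : e * n%:Z <= - n%:Z by lia.
by rewrite -mulN1r ler_pM2r; lia.
Qed.

Lemma square_gap (x y N : int) : y <= x -> 1 <= N ->
  x ^+ 2 + y ^+ 2 < (x + N) ^+ 2 + (y - N) ^+ 2.
Proof.
move=> yx N1; rewrite -subr_gt0.
have -> : (x + N) ^+ 2 + (y - N) ^+ 2 - (x ^+ 2 + y ^+ 2) = N * (x - y) *+ 2 + N * N *+ 2 by ring.
apply: ltr_wpDl; first by rewrite mulrn_wge0 // mulr_ge0; lia.
by rewrite pmulrn_lgt0 // mulr_gt0; lia.
Qed.

(** The combinatorial heart of the proof: a dominated affine permutation that is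
    not a translation lies strictly below another one in the Bruhat order,
    namely its product with an affine reflection. The coordinate [a] is chosen
    with the largest total among the coordinates moved by [s]; this makes the
    reflection increase the length, and also the sum of the squares of the
    totals. *)
Lemma dominated_reflection lambda nu (s : 'S_n) :
  (forall i, dominated lambda (relpos nu s i)) -> s != 1%g ->
  exists a l e, [/\ a != l,
    forall i, chain nu s i a - chain nu s i l <= e,
    (a < l)%N%:Z <= e,
    forall i, dominated lambda (relpos (refl a l e nu) (tperm a l * s) i)
    & \sum_c total nu s c ^+ 2 < \sum_c total (refl a l e nu) (tperm a l * s) c ^+ 2].
Proof.
move=> dom s1; have [a0 a0s] : exists a, s a != a.
  apply: contrapT => no; case/eqP: s1; apply/permP => c; rewrite perm1.
  by apply: contrapT => /eqP sc; apply: no; exists c.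
have n0 : (0 < n)%N by apply: leq_ltn_trans (ltn_ord a0).
have [a as_ a_max] : exists2 a : 'I_n, s a != a
    & forall c, s c != c -> total nu s c <= total nu s a.
  pose moved c := s c != c.
  by have [a ? ?] := Order.TotalTheory.arg_maxP (total nu s) (a0s : moved a0); exists a.
pose rho i : 'I_n := Ordinal (ltn_pmod i n0).
pose sigma i := (s^-1)%g (rho i).
have sigmaK i : s (sigma i) = rho i by rewrite permKV.
have windE i c : wind i.+1 c = (wind i c + (rho i == c))%N by rewrite wind_succ.
have chain_succ i c : chain nu s i.+1 c = chain nu s i c + (c == sigma i)%:Z.
  by rewrite /chain windE -[rho i]sigmaK (inj_eq perm_inj) [sigma i == c]eq_sym PoszD addrA.
have step i : sigma i != rho i ->
    relpos nu s i.+1 = transfer (sigma i) (rho i) (relpos nu s i).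
  move=> si; apply/funext => c; rewrite /transfer /relpos chain_succ windE.
  by rewrite [rho i == c]eq_sym; lia.
have still i : sigma i = rho i -> relpos nu s i.+1 = relpos nu s i.
  by move=> si; apply/funext => c; rewrite /relpos chain_succ windE si eq_sym; lia.
(* The standard chain moves the coordinate [a] at time [a], and the given chain
   moves it next at time [q]. *)
pose q : nat := if (a < s a)%N then (s a : nat) else ((s a : nat) + n)%N.
have sa_a : (s a : nat) != a by rewrite (inj_eq val_inj).
have [sa_n a_n] := (ltn_ord (s a), ltn_ord a).
have aq : (a < q < a + n)%N.
  by rewrite /q; case: (ltnP a (s a)) => h; lia.
have rho_q : rho q = s a.
  by apply: val_inj; rewrite /= /q; case: ifP => _; rewrite ?modnDr modn_small.
have rho_a : rho a = a by apply: val_inj; rewrite /= modn_small.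
have rho_inj i j : (i < j < i + n)%N -> rho i != rho j.
  move=> ij; apply/eqP => /(congr1 val) /= h; have : (i == j %[mod n])%N by apply/eqP.
  by rewrite eq_sym eqn_mod_dvd; [move=> /dvdn_leq|]; lia.
have avoid i : (a < i < q)%N -> sigma i != a /\ rho i != a.
  move=> iq; split.
    rewrite -(inj_eq (@perm_inj _ s)) sigmaK -rho_q; apply: rho_inj; lia.
  by rewrite -rho_a eq_sym; apply: rho_inj; lia.
have sigma_a : sigma a != a by rewrite -(inj_eq (@perm_inj _ s)) sigmaK rho_a eq_sym.
have [|||||||p [apq sp free]] := @unobstructed_step lambda (relpos nu s) sigma rho a q a.
- by lia.
- by move=> i _; apply: step.
- by move=> i _; apply: still.
- by [].
- by [].
- by [].
- exact: avoid.
set l := sigma p in sp free *.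
have al : a != l.
  rewrite -(inj_eq (@perm_inj _ s)) /l sigmaK -rho_q eq_sym; apply: rho_inj; lia.
have ls : s l != l by rewrite /l sigmaK eq_sym.
(* [delta] is e - 1 on the times in (p, q] and e on those in (q, p + n]; hence the
   reflection moves one unit from [l] to [a] on (p, q] and changes nothing on the
   rest of the period. *)
pose delta i := chain nu s i a - chain nu s i l; pose e := delta q + 1.
have delta_succ i : delta i.+1 = delta i + (a == sigma i)%:Z - (l == sigma i)%:Z.
  by rewrite /delta !chain_succ; ring.
have delta_period i : delta (i + n) = delta i.
  by rewrite /delta /chain !wind_period !intS; ring.
have sigmaN i j : (i < j < i + n)%N -> sigma i != sigma j.
  by move=> ij; rewrite (inj_eq perm_inj); apply: rho_inj.
have sigma_q : sigma q = a by rewrite /sigma rho_q permK.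
have low i : (p < i <= q)%N -> delta i = e - 1.
  have h m : (p < q - m)%N -> delta (q - m)%N = delta q.
    elim: m => [|m IH] pm; first by rewrite subn0.
    rewrite -IH; last by lia.
    have -> : (q - m)%N = (q - m.+1).+1 by lia.
    set j := (q - m.+1)%N in pm *; have [|sa _] := avoid j; first by lia.
    have sl : sigma p != sigma j.
      by apply: sigmaN; rewrite /j in pm *; clear -pm apq aq; lia.
    by rewrite delta_succ [a == _]eq_sym (negbTE sa) (negbTE sl) addr0 subr0.
  move=> iq; rewrite /e addrK (_ : i = q - (q - i))%N; last by lia.
  by apply: h; lia.
have high i : (q < i <= p + n)%N -> delta i = e.
  elim: i => [|i IH] iq; first by lia.
  have li : (l == sigma i) = false by apply/negbTE/sigmaN; lia.
  rewrite delta_succ li subr0; have [->|qi] := eqVneq i q.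
    by rewrite sigma_q eqxx.
  have qi_lt : (q < i <= p + n)%N by clear - iq qi; lia.
  have ai : (a == sigma i) = false.
    by rewrite -sigma_q; apply/negbTE/sigmaN; clear -qi_lt apq; lia.
  by rewrite ai addr0 IH.
have window i : (i < n)%N -> exists2 j, (p < j <= p + n)%N &
    delta i = delta j /\ relpos nu s i = relpos nu s j.
  move=> i_n; case: (ltnP p i) => pi; first by exists i => //; lia.
  case: (ltnP p (i + n)) => pin.
    by exists (i + n)%N; [lia|rewrite delta_period relpos_period].
  by exists (i + n + n)%N; [lia|rewrite !delta_period !relpos_period].
have reduce (P : nat -> Prop) : (forall i, P (i + n)%N <-> P i) ->
    (forall i, (i < n)%N -> P i) -> forall i, P i.
  move=> Pn P0 i; rewrite (divn_eq i n); elim: (i %/ n)%N => [|d IH].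
    by rewrite mul0n; apply: P0; rewrite ltn_mod.
  by rewrite mulSn -addnA addnC; apply/Pn.
have delta_range i : delta i = e - 1 \/ delta i = e.
  apply: (reduce (fun i => delta i = e - 1 \/ delta i = e)) => [j|j jn].
    by rewrite delta_period.
  have [j' j'p [-> _]] := window j jn.
  case/andP: j'p => pj' j'p; case: (leqP j' q) => h.
    by left; apply: low; rewrite pj'.
  by right; apply: high; rewrite h.
pose nu' := refl a l e nu; pose s' := (tperm a l * s)%g.
have relposE i : relpos nu' s' i = fun c => relpos nu s i c
    + (e - delta i) * ((c == a)%:Z - (c == l)%:Z).
  apply/funext => c; rewrite /relpos /nu' /s' chain_refl // /refl /delta.
  have [->|ca] := eqVneq c a; first by rewrite (negbTE al) /=; clear; lia.
  by have [->|cl] := eqVneq c l; rewrite /=; clear; lia.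
have dom' i : dominated lambda (relpos nu' s' i).
  apply: (reduce (fun i => dominated lambda (relpos nu' s' i))) => [j|j jn].
    by rewrite relpos_period.
  have [j' j'p [dE rE]] := window j jn; rewrite relposE dE rE.
  case: (leqP j' q) => h.
    rewrite low; last by rewrite h; case/andP: j'p => ->.
    have -> : (fun c => relpos nu s j' c + (e - (e - 1)) * ((c == a)%:Z - (c == l)%:Z))
        = transfer a l (relpos nu s j').
      by apply/funext => c; rewrite /transfer subKr mul1r addrA.
    by apply: dominated_transfer => // k; apply: free; rewrite h; case/andP: j'p => ->.
  rewrite high; last by rewrite h; case/andP: j'p.
  have -> : (fun c => relpos nu s j' c + (e - e) * ((c == a)%:Z - (c == l)%:Z))
      = relpos nu s j'.
    by apply/funext => c; rewrite subrr mul0r addr0.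
  exact: dom.
pose N := \sum_(i < n) (e - delta i).
have N_gt0 : 1 <= N.
  pose j : 'I_n := rho q; rewrite /N (bigD1 j) //=.
  have -> : delta (q %% n)%N = e - 1.
    have -> : e - 1 = delta q by rewrite /e addrK.
    rewrite [in RHS](divn_eq q n); elim: (q %/ n)%N => [|d IH]; first by rewrite mul0n.
    by rewrite mulSn -addnA addnC delta_period.
  have : 0 <= \sum_(i < n | i != j) (e - delta i).
    by apply: sumr_ge0 => i _; case: (delta_range i) => ->; clear; lia.
  by move: (\sum_(_ < _ | _) _) => S; lia.
have total_la : total nu s l <= total nu s a by apply: a_max.
have sum_delta : \sum_(i < n) delta i
    = total nu s a - total nu s l + (n - a.+1)%N%:Z - (n - l.+1)%N%:Z.
  rewrite -!sum_wind !(big_morph Posz PoszD erefl) /total -!sumrB -!big_split /=.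
  rewrite -sumrB; apply: eq_bigr => i _; rewrite /relpos /delta; clear; lia.
have NE : N = e * n%:Z - \sum_(i < n) delta i.
  by rewrite /N sumrB sumr_const card_ord -mulr_natr natz.
exists a, l, e; split=> //.
- by move=> i; rewrite -/(delta i); case: (delta_range i) => ->; clear; lia.
- apply: slope_bound (ltn_ord a) (ltn_ord l) _.
  have an := ltn_ord a; have ln := ltn_ord l; move: NE; rewrite sum_delta.
  by clear -N_gt0 total_la an ln; lia.
- have totalE c : total nu' s' c = total nu s c + N * ((c == a)%:Z - (c == l)%:Z).
    rewrite /total /N big_distrl -big_split /=; apply: eq_bigr => i _.
    by rewrite relposE.
  rewrite !(sum_bigD2 _ al) !totalE !eqxx (negbTE al) [l == a]eq_sym (negbTE al).
  rewrite [in ltRHS](eq_bigr (fun c => total nu s c ^+ 2)).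
    by rewrite ltrD2r /= subr0 sub0r mulr1 mulrN1; apply: square_gap.
  by move=> c /andP[/negbTE ca /negbTE cl]; rewrite totalE ca cl subrr mulr0 addr0.
Qed.

End AffinePermutations.

(** * Lattices over the power series and their truncations *)

Lemma singular_kernel (F : fieldType) n (A : 'M[F]_n) : \det A = 0 ->
  exists2 v : 'cV[F]_n, v != 0 & A *m v = 0.
Proof.
move=> dA0; have : kermx A^T != 0.
  apply/negP => /eqP k0; have : row_free A^T by rewrite -kermx_eq0 k0.
  by rewrite row_free_unit unitmx_tr unitmxE dA0 unitr0.
case/rowV0Pn => w /sub_kermxP wA w0; exists w^T; first by rewrite trmx_eq0.
by rewrite -[A]trmxK -trmx_mul wA trmx0.
Qed.

Section FpsLattices.
Variable C : fieldType.
Notation O := (fps C).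
Notation K := {fraction O}.
Notation tK := (tK C).
Notation OK := (@integral C).
Notation iota := (map_mx (@tofrac O)).

Lemma integral_tofrac f : OK (tofrac f). Proof. by exists f. Qed.

Lemma fps_dvr : is_dvr OK tK.
Proof.
have t0 : tK != 0 by rewrite tofrac_eq0 fps_var_neq0.
split.
- by exists 1; rewrite tofrac1.
- by move=> _ _ [f ->] [g ->]; exists (f - g); rewrite tofracB.
- by move=> _ _ [f ->] [g ->]; exists (f * g); rewrite tofracM.
- exact: integral_tofrac.
- move=> [f fE]; have : tofrac (fps_var C * f) = tofrac 1.
    by rewrite tofracM -fE -/tK mulfV // tofrac1.
  move=> /tofrac_inj /(congr1 (@fcoef0 C)); rewrite rmorphM rmorph1 /=.
  by rewrite {1}/fcoef0 /= mul0r => /eqP; rewrite eq_sym oner_eq0.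
- move=> x /laurent_unit_part[k [u [uU ->]]]; exists k.
  have tk0 : tK ^ k != 0 by rewrite expfz_neq0.
  have kV : tK ^ (- k) = (tK ^ k)^-1 by rewrite invr_expz.
  rewrite kV mulrAC mulfV // mul1r; split; first exact: integral_tofrac.
  by rewrite invfM mulrAC mulVf // mul1r -tofracV //; apply: integral_tofrac.
Qed.

Lemma fps_has_val (x : K) k : has_val OK tK x k <->
  exists2 u : O, u \is a GRing.unit & x = tK ^ k * tofrac u.
Proof.
split=> [xk|[u uU ->]].
  have [x0 _ _] := xk; have [l [u [uU xE]]] := laurent_unit_part x0.
  suff -> : k = l by exists u.
  apply: (has_val_inj fps_dvr xk); rewrite xE -[l]addr0.
  apply: (has_valM fps_dvr); rewrite ?addr0; first exact: (has_val_tX fps_dvr).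
  rewrite /has_val oppr0 expr0z !mulr1 -tofracV //.
  by split; [exact: tofrac_unit_neq0|exact: integral_tofrac|exact: integral_tofrac].
rewrite -[k]addr0; apply: (has_valM fps_dvr); rewrite ?addr0.
  exact: (has_val_tX fps_dvr).
rewrite /has_val oppr0 expr0z !mulr1 -tofracV //.
by split; [exact: tofrac_unit_neq0|exact: integral_tofrac|exact: integral_tofrac].
Qed.

Lemma intmx_map m n (A : 'M[O]_(m, n)) : intmx OK (iota A).
Proof. by move=> i j; rewrite mxE; apply: integral_tofrac. Qed.

Lemma intmxP m n (A : 'M[K]_(m, n)) : intmx OK A -> exists B, A = iota B.
Proof.
move=> hA; have h ij : exists f, A ij.1 ij.2 = tofrac f by apply: hA.
have [f fE] := choice h; exists (\matrix_(i, j) f (i, j)).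
by apply/matrixP => i j; rewrite !mxE -fE.
Qed.

Lemma iota_inj m n (A B : 'M[O]_(m, n)) : iota A = iota B -> A = B.
Proof.
move=> AB; apply/matrixP => i j; apply: tofrac_inj.
by move/matrixP: AB => /(_ i j); rewrite !mxE.
Qed.

Lemma On_int n : @On C n = [set v | intmx OK v].
Proof.
apply/seteqP; split=> v; first by case=> f _ <-; apply: intmx_map.
by case/intmxP => f ->; exists f.
Qed.

Section FixedRank.
Variable n : nat.
Implicit Types A B g : 'M[K]_n.
Notation lat := (@lat K OK n).

Lemma image_On A : [set A *m v | v in @On C n] = lat A.
Proof. by rewrite On_int. Qed.

Lemma GLO_map (g : 'M[O]_n) : g \in unitmx -> GLO OK (iota g).
Proof.
move=> gU; apply: (@GLO_exhibit _ _ _ _ (iota (invmx g))); try exact: intmx_map.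
by rewrite -map_mxM mulmxV // map_mx1.
Qed.

Lemma GLOP g : GLO OK g -> exists2 h : 'M[O]_n, h \in unitmx & g = iota h.
Proof.
move=> [gU /intmxP[h gE] /intmxP[k kE]]; exists h => //.
have hk : iota (h *m k) = iota 1%:M.
  rewrite map_mxM -gE -kE map_mx1; exact: mulmxV.
by have [] := mulmx1_unit (iota_inj hk).
Qed.

Lemma is_basisP (L : set 'cV[K]_n) A : is_basis L A <-> A \in unitmx /\ L = lat A.
Proof.
have latE : [set A *m iota a | a in [set: 'cV[O]_n]] = lat A.
  rewrite -image_On; apply/seteqP; split=> [v [a _ <-]|v [_ [a _ <-] <-]]; last by exists a.
  by exists (iota a) => //; exists a.
split=> [[LE inj]|[AU ->]].
  split; last by rewrite LE.
  rewrite unitmxE unitfE; apply/negP => /eqP dA0.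
  (* A kernel vector over K becomes a relation over O once its poles are cleared. *)
  have [v v0 Av] : exists2 v : 'cV[K]_n, v != 0 & A *m v = 0 by exact: singular_kernel.
  have [N /(_ N (leqnn N)) vN] := intmx_pole fps_dvr v.
  have [a aE] := intmxP vN; have a0 : a = 0.
    by apply: inj; rewrite -aE -scalemxAr Av scaler0.
  case/eqP: v0; apply: (scalerI (expf_neq0 N (dvr_t_neq0 fps_dvr))).
  by rewrite aE a0 map_mx0 scaler0.
split; first by rewrite latE.
move=> a Aa; apply: iota_inj; rewrite map_mx0.
by rewrite -[iota a](mulKmx AU) Aa mulmx0.
Qed.

Lemma GrP (L : set 'cV[K]_n) : Gr L <-> exists2 A, A \in unitmx & L = lat A.
Proof.
split=> [[A /is_basisP[AU ->]]|[A AU ->]]; first by exists A.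
by exists A; apply/is_basisP.
Qed.

Lemma nu_lat A k : has_val OK tK (\det A) k -> nu (lat A) = k.
Proof.
move=> Ak; have AU : A \in unitmx by rewrite unitmxE unitfE; case: Ak.
rewrite /nu; apply: xget_unique; last first.
  move=> l /(_ A (proj2 (is_basisP _ _) (conj AU erefl))) hB.
  by apply/esym/(has_val_inj fps_dvr Ak)/fps_has_val.
move=> B /is_basisP[BU LE].
have gO := (lat_eqP fps_dvr AU BU).1 LE.
have [_ g0] := (GLO_detP fps_dvr _).1 gO.
apply/fps_has_val; have := has_valM fps_dvr Ak g0; rewrite addr0 -det_mulmx.
by rewrite (mulKVmx AU); apply.
Qed.

Lemma Gr_orbitP lambda (L : set 'cV[K]_n) :
  Gr_orbit lambda L <-> exists2 g, GLO OK g & L = lat (g *m tdiag tK lambda).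
Proof.
have -> : Gr_orbit lambda L <-> exists2 g : 'M[O]_n, g \in unitmx &
    L = [set iota g *m v | v in lat (tdiag tK lambda)].
  by rewrite -image_On.
split=> [[g gU ->]|[g /GLOP[h hU ->] ->]].
  by exists (iota g); [exact: GLO_map|rewrite lat_image].
by exists h; [exact: hU|rewrite lat_image].
Qed.

End FixedRank.

Section Truncation.
Variables (n : nat).
Implicit Types (m : nat) (H G : 'M[O]_n).

(** The coefficients of order less than [m] of the entries of [f]: coordinates on
    O^n / t^m O^n. *)
Definition quo m (f : 'cV[O]_n) : 'rV[C]_(n * m) :=
  mxvec (\matrix_(i < n, k < m) fcoef (f i 0) k).

Definition lift m (w : 'rV[C]_(n * m)) : 'cV[O]_n :=
  \col_i Fps (fun k => if insub k is Some k' then vec_mx w i k' else 0).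

(** The matrix of the action of [H] on O^n / t^m O^n, for row vectors. *)
Definition act m H : 'M[C]_(n * m) :=
  \matrix_(a, b) quo m (H *m lift (delta_mx 0 a)) 0 b.

Lemma fcoef_sum (I : Type) (r : seq I) (P : pred I) (F : I -> O) k :
  fcoef (\sum_(i <- r | P i) F i) k = \sum_(i <- r | P i) fcoef (F i) k.
Proof. by elim/big_rec2: _ => // i x y _ <-. Qed.

Lemma fcoef_constM c (f : O) k : fcoef (fps_const c * f) k = c * fcoef f k.
Proof.
rewrite fcoefM big_ord_recl /= subn0 big1 ?addr0 // => i _.
by rewrite /= mul0r.
Qed.

Lemma quo_linear m c (f g : 'cV[O]_n) :
  quo m (fps_const c *: f + g) = c *: quo m f + quo m g.
Proof.
rewrite /quo -linearP; congr mxvec; apply/matrixP => i k.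
by rewrite !mxE fcoefD fcoef_constM.
Qed.

Lemma quoP m (f g : 'cV[O]_n) : quo m f = quo m g <->
  forall i k, (k < m)%N -> fcoef (f i 0) k = fcoef (g i 0) k.
Proof.
split=> [/(can_inj mxvecK)/matrixP fg i k km|fg].
  by have := fg i (Ordinal km); rewrite !mxE.
by congr mxvec; apply/matrixP => i k; rewrite !mxE fg.
Qed.

Lemma quo_sum m (I : Type) (r : seq I) (c : I -> C) (f : I -> 'cV[O]_n) :
  quo m (\sum_(i <- r) fps_const (c i) *: f i) = \sum_(i <- r) c i *: quo m (f i).
Proof.
rewrite /quo; under [RHS]eq_bigr do rewrite -linearZ /=.
rewrite -linear_sum; congr mxvec; apply/matrixP => i k.
rewrite [LHS]mxE !summxE fcoef_sum; apply: eq_bigr => j _.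
by rewrite !mxE fcoef_constM.
Qed.

Lemma quo_lift m (w : 'rV[C]_(n * m)) : quo m (lift w) = w.
Proof.
rewrite -[RHS]vec_mxK; congr mxvec; apply/matrixP => i k.
by rewrite !mxE /= valK mxE.
Qed.

Lemma quo_mulmx m H f g : quo m f = quo m g -> quo m (H *m f) = quo m (H *m g).
Proof.
move=> /quoP fg; apply/quoP => i k km; rewrite !mxE !fcoef_sum.
apply: eq_bigr => j _; rewrite !fcoefM; apply: eq_bigr => l _.
by rewrite fg // (leq_ltn_trans (leq_subr _ _)).
Qed.

Lemma lift_delta m (w : 'rV[C]_(n * m)) :
  quo m (\sum_a fps_const (w 0 a) *: lift (delta_mx 0 a)) = w.
Proof.
by rewrite quo_sum; under eq_bigr do rewrite quo_lift; rewrite -row_sum_delta.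
Qed.

Lemma row_act m H a : row a (act m H) = quo m (H *m lift (delta_mx 0 a)).
Proof. by apply/rowP => b; rewrite !mxE. Qed.

Lemma quo_act m H f : quo m (H *m f) = quo m f *m act m H.
Proof.
rewrite mulmx_sum_row -[in LHS](quo_mulmx H (lift_delta (quo m f))).
rewrite mulmx_sumr; under eq_bigr do rewrite -scalemxAr.
by rewrite quo_sum; apply: eq_bigr => a _; rewrite row_act.
Qed.

Lemma act_mulmx m G H : act m (G *m H) = act m H *m act m G.
Proof.
apply/row_matrixP => a.
rewrite row_mul [LHS]row_act row_act -mulmxA; exact: quo_act.
Qed.

Lemma act1 m : act m 1%:M = 1%:M.
Proof. apply/row_matrixP => a; rewrite row_act mul1mx quo_lift row1; reflexivity. Qed.

Lemma act_unit m H : H \in unitmx -> act m H \in unitmx.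
Proof.
move=> HU; have := congr1 (act m) (mulVmx HU); rewrite act_mulmx act1.
by move=> /mulmx1_unit[h _]; exact: h.
Qed.

Lemma act_pencil m c (P Q : 'M[O]_n) :
  act m (P + fps_const c *: Q) = act m P + c *: act m Q.
Proof.
apply/matrixP => a b; rewrite [LHS]mxE [RHS]mxE [X in _ = X + _]mxE.
rewrite [X in _ = _ + X]mxE [act m Q a b]mxE mulmxDl -scalemxAl addrC quo_linear.
rewrite addrC [LHS]mxE [X in _ + X]mxE; reflexivity.
Qed.

Definition tpow (mu : 'I_n -> nat) : 'M[O]_n := diag_mx (\row_i fps_var C ^+ mu i).

Lemma tpow_mul mu (f : 'cV[O]_n) i : (tpow mu *m f) i 0 = fps_var C ^+ mu i * f i 0.
Proof. by rewrite mul_diag_mx !mxE. Qed.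

Lemma quo_index m f i k : quo m f 0 (mxvec_index i k) = fcoef (f i 0) k.
Proof. by rewrite mxvecE mxE. Qed.

(** The image of t^mu O^n in O^n / t^m O^n is spanned by the classes of the
    t^k e_i with [mu i <= k]. *)
Lemma rank_act_tpow m mu : \rank (act m (tpow mu)) = (\sum_i (m - mu i))%N.
Proof.
pose S : {set 'I_n * 'I_m} := [set x : 'I_n * 'I_m | (mu x.1 <= x.2)%N]%SET.
pose e (j : 'I_#|S|) := enum_val j.
pose D : 'M[C]_(#|S|, n * m) := \matrix_j delta_mx 0 (mxvec_index (e j).1 (e j).2).
have eS j : (mu (e j).1 <= (e j).2)%N by have := enum_valP j; rewrite inE.
have index_inj (x y : 'I_n * 'I_m) : mxvec_index x.1 x.2 = mxvec_index y.1 y.2 -> x = y.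
  move=> xy; have [g gK _] := curry_mxvec_bij n m.
  case: x y xy => x1 x2 [y1 y2] /= xy.
  by rewrite -(gK (x1, x2) isT) -(gK (y1, y2) isT) /= xy.
have Dfree : \rank D = #|S|.
  apply/eqP; rewrite -[_ == _]/(row_free D); apply/row_freeP; exists D^T.
  apply/matrixP => i j; rewrite !mxE (bigD1 (mxvec_index (e i).1 (e i).2)) //= big1.
    rewrite !mxE !eqxx mul1r addr0 -(inj_eq enum_val_inj) /=.
    by congr ((_ : bool)%:R); rewrite /e; apply/eqP/eqP => [/index_inj|] ->.
  by move=> a /negbTE ai; rewrite !mxE ai mul0r.
have DA : (D :=: act m (tpow mu))%MS.
  apply/eqmxP/andP; split; apply/row_subP => j.
    rewrite rowK; pose f : 'cV[O]_n := fps_var C ^+ ((e j).2 - mu (e j).1) *: delta_mx (e j).1 0.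
    have <- : quo m (tpow mu *m f) = delta_mx 0 (mxvec_index (e j).1 (e j).2).
      apply/rowP => a; case/mxvec_indexP: a => i k.
      rewrite quo_index tpow_mul [f i 0]mxE [delta_mx _ _ i 0]mxE eqxx andbT.
      rewrite [RHS]mxE eqxx andTb; have [->|ie] := eqVneq i (e j).1.
        rewrite mulr1 -exprD (subnKC (eS j)) -[_ ^+ _]mulr1 fcoef_varXM.
        have -> : (mxvec_index (e j).1 k == mxvec_index (e j).1 (e j).2)
            = (k == (e j).2).
          by apply/eqP/eqP => [/(index_inj (_, _) (_, _))[] //|->].
        rewrite -val_eqE /=; case: ltngtP => [ejk|//|->]; last by rewrite subnn.
        by rewrite subn_eq0 leqNgt ejk.
      have -> : (mxvec_index i k == mxvec_index (e j).1 (e j).2) = false.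
        by apply: contraNF ie => /eqP/(index_inj (_, _) (_, _))[->].
      by rewrite mulr0 mulr0.
    by rewrite quo_act submxMl.
  have w0 i (k : 'I_m) : (k < mu i)%N -> row j (act m (tpow mu)) 0 (mxvec_index i k) = 0.
    by move=> ki; rewrite row_act quo_index tpow_mul fcoef_varXM leqNgt ki.
  rewrite (row_sum_delta (row j _)); apply: summx_sub => a _.
  case/mxvec_indexP: a => i k; have [/w0->|ki] := ltnP k (mu i); first by rewrite scale0r sub0mx.
  have ikS : (i, k) \in S by rewrite inE.
  apply: scalemx_sub; rewrite (_ : delta_mx 0 (mxvec_index i k) = row (enum_rank_in ikS (i, k)) D).
    exact: row_sub.
  by rewrite rowK /e enum_rankK_in.
rewrite -DA Dfree -sum1_card big_mkcond /=.
transitivity (\sum_i \sum_(k < m) (if (i, k) \in S then 1 else 0))%N.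
  by rewrite pair_bigA; apply: eq_bigr => -[i k] _.
apply: eq_bigr => i _; rewrite -big_mkcond sum1_card.
have -> : (m - mu i)%N = #|[pred k : 'I_m | (mu i <= k)%N]|.
  rewrite -sum1_card -(big_mkord (fun k => mu i <= k)%N (fun=> 1%N)) big_mkcond.
  rewrite /= -[(m - _)%N]muln1; have [mu_m|m_mu] := leqP (mu i) m.
    rewrite (big_cat_nat (leq0n _) mu_m) /= big_nat big1 ?add0n => [|k /andP[_ k_mu]]; last first.
      by rewrite leqNgt k_mu.
    rewrite big_nat (eq_bigr (fun=> 1%N)) => [|k /andP[-> _] //].
    by rewrite -big_nat sum_nat_const_nat.
  rewrite big_nat big1 => [|k km]; last by rewrite leqNgt (ltn_trans _ m_mu).
  by rewrite (eqP (ltnW m_mu)).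
by apply: eq_card => k; rewrite [LHS]unfold_in [RHS]unfold_in -[LHS]/((i, k) \in S) inE.
Qed.

End Truncation.
End FpsLattices.

(** * Closedness of the set of dominated lattices *)

Section PluckerRank.
Variables (F : fieldType) (d m k : nat).
Implicit Types (M : 'M[F]_(d, m)) (tau : 'I_k -> 'I_m).

Lemma mul_colsub p q r (A : 'M[F]_(p, q)) (f : 'I_r -> 'I_q) :
  colsub f A = A *m colsub f 1%:M.
Proof.
apply/matrixP => i j; rewrite !mxE (bigD1 (f j)) //= !mxE eqxx mulr1 big1 ?addr0 //.
by move=> a /negbTE aj; rewrite !mxE aj mulr0.
Qed.

(** The rank of the columns indexed by [tau] is at most [e] if and only if all
    Pluecker coordinates that involve [e + 1] of these columns vanish: a free
    family of [e + 1] columns can be completed to a basis by the other ones. *)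
Lemma plucker_rank M tau (e : nat) : row_free M ->
  ((\rank (colsub tau M) <= e)%N <->
   forall s : {ffun 'I_d -> 'I_m}, (e < d)%N ->
     (forall j : 'I_d, (j <= e)%N -> s j \in codom tau) -> plucker M s = 0).
Proof.
move=> Mfree; split=> [rk s ed stau|vanish].
  apply: contraTeq rk => det0; rewrite -ltnNge.
  have MU : colsub s M \in unitmx by rewrite unitmxE unitfE.
  pose w := widen_ord ed; have w_inj : injective w by move=> i j [] /val_inj.
  have sw j : s (w j) \in codom tau by apply: stau; rewrite -ltnS; apply: (ltn_ord j).
  pose s' j := iinv (sw j).
  have e1 : colsub w (colsub s M) = colsub s' (colsub tau M).
    by apply/matrixP => i j; rewrite !mxE f_iinv.
  have rw : \rank (colsub w (1%:M : 'M[F]_d)) = e.+1.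
    rewrite -mxrank_tr; apply/eqP; rewrite -[_ == _]/(row_free _).
    apply/row_freeP; exists (colsub w 1%:M).
    apply/matrixP => i j; rewrite !mxE (bigD1 (w i)) //= big1 => [|a /negbTE ai].
      by rewrite !mxE eqxx mul1r addr0 (inj_eq w_inj).
    by rewrite !mxE ai mul0r.
  have <- : \rank (colsub w (colsub s M)) = e.+1.
    by rewrite mul_colsub (eqmxMfull _ (_ : row_full (colsub s M))) // row_full_unit.
  by rewrite e1 mul_colsub; apply: mxrankM_maxl.
rewrite leqNgt; apply/negP => rk.
have ed : (e < d)%N by apply: leq_trans rk (rank_leq_row _).
pose A := (colsub tau M)^T; have rkA : (e < \rank A)%N by rewrite mxrank_tr.
pose f (x : 'I_e.+1) : 'I_k := maxrankfun A (widen_ord rkA x).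
pose B := rowsub f A.
have Bfree : \rank B = e.+1.
  have -> : B = rowsub (widen_ord rkA) (rowsub (maxrankfun A) A).
    by apply/matrixP => i j; rewrite !mxE.
  have w_inj : injective (widen_ord rkA) by move=> i j [] /val_inj.
  have /row_freeP[X AX] := maxrowsub_free A.
  apply/eqP; rewrite -[_ == _]/(row_free _).
  apply/row_freeP; exists (colsub (widen_ord rkA) X).
  apply/matrixP => i j; have /matrixP/(_ (widen_ord rkA i) (widen_ord rkA j)) := AX.
  by rewrite !mxE (inj_eq w_inj) => <-; apply: eq_bigr => l _; rewrite !mxE.
pose Q := M^T *m cokermx B.
have rkQ : \rank Q = (d - e.+1)%N.
  rewrite /Q (eqmxMfull (cokermx B)) ?mxrank_coker ?Bfree //.
  by rewrite /row_full mxrank_tr.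
pose h := maxrankfun Q.
have x0 : 'I_m by exact: (tau (f ord0)).
pose s : {ffun 'I_d -> 'I_m} := [ffun j : 'I_d =>
  if (insub (j : nat) : option 'I_e.+1) is Some x then tau (f x) else
  if (insub (j - e.+1)%N : option 'I_(\rank Q)) is Some y then h y else x0].
have sB (x : 'I_e.+1) : s (widen_ord ed x) = tau (f x) by rewrite ffunE /= valK.
have sC (y : 'I_(\rank Q)) : exists j, s j = h y.
  have jd : (e.+1 + y < d)%N by have := ltn_ord y; rewrite [X in (_ < X)%N]rkQ; lia.
  exists (Ordinal jd); rewrite ffunE /= insubF ?addKn ?valK //.
  by apply/negbTE; rewrite -leqNgt leq_addr.
have : plucker M s = 0.
  apply: vanish => // j je; have -> : j = widen_ord ed (Ordinal (je : (j < e.+1)%N)).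
    exact: val_inj.
  by rewrite sB codom_f.
apply/eqP; rewrite /plucker -unitfE -[_ \is a _]/(_ \in unitmx) -unitmx_tr.
rewrite -row_free_unit -row_leq_rank.
have sub : (col_mx B (rowsub h M^T) <= (colsub s M)^T)%MS.
  rewrite col_mx_sub; apply/andP; split; apply/row_subP => i.
    suff -> : row i B = row (widen_ord ed i) (colsub s M)^T by exact: row_sub.
    by apply/rowP => j; rewrite !mxE sB.
  have [j sj] := sC i; suff -> : row i (rowsub h M^T) = row j (colsub s M)^T.
    exact: row_sub.
  by apply/rowP => l; rewrite !mxE sj.
apply: leq_trans (mxrankS sub).
rewrite -(mxrank_mul_ker _ (cokermx B)) -{1}(subnK ed).
apply: leq_add; last first.
  rewrite -[X in (X <= _)%N]Bfree; apply: mxrankS; rewrite sub_capmx.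
  apply/andP; split; first by rewrite -addsmxE addsmxSl.
  by apply/sub_kermxP; rewrite mulmx_coker.
rewrite -rkQ mul_col_mx; apply: (@leq_trans (\rank (rowsub h Q))).
  by rewrite (eq_maxrowsub Q).
have -> : rowsub h Q = rowsub h M^T *m cokermx B by rewrite -mul_rowsub_mx.
by apply: mxrankS; rewrite -addsmxE addsmxSr.
Qed.

End PluckerRank.

Section SchubertRanks.
Variables (C : fieldType) (n : nat).
Notation O := (fps C).
Notation K := {fraction O}.
Notation tK := (tK C).
Notation OK := (@integral C).
Notation iota := (map_mx (@tofrac O)).
Notation lat := (@lat K OK n).
Notation dvr := (fps_dvr C).
Implicit Types (A g : 'M[K]_n) (H : 'M[O]_n) (mu nu : 'I_n -> int).

Lemma Gr_lat A : A \in unitmx -> Gr (lat A).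
Proof. by move=> AU; apply/GrP; exists A; [exact: AU|]. Qed.

Lemma scaled_On (a : K) : [set a *: v | v in @On C n] = lat a%:M.
Proof.
rewrite -image_On; apply/seteqP; split=> _ [v vO <-]; exists v => //.
  by rewrite mul_scalar_mx.
by rewrite mul_scalar_mx.
Qed.

Lemma tKn_neq0 N : tK ^+ N != 0.
Proof. exact: (expf_neq0 N (dvr_t_neq0 dvr)). Qed.

Lemma scalar_unitmx (a : K) : a != 0 -> (a%:M : 'M_n) \in unitmx.
Proof. by move=> a0; rewrite unitmxE det_scalar unitfE expf_neq0. Qed.

Lemma invmx_scalar_field (a : K) : a != 0 -> invmx (a%:M : 'M_n) = a^-1%:M.
Proof. by rewrite invmx_scalar. Qed.

Lemma GrN_lat N A : A \in unitmx ->
  (GrN N (lat A) <-> intmx OK (tK ^+ N *: A) /\ intmx OK (tK ^+ N *: invmx A)).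
Proof.
move=> AU; have tN := tKn_neq0 N; have tNU := scalar_unitmx tN.
have tVU := scalar_unitmx (invr_neq0 tN).
have up := lat_subP dvr tNU AU; have down := lat_subP dvr AU tVU.
rewrite mul_mx_scalar in up.
have invV := invmx_scalar_field (invr_neq0 tN); rewrite invrK in invV.
rewrite invV mul_scalar_mx in down.
split=> [[_ sub1 sub2]|[h1 h2]].
  rewrite scaled_On in sub1; rewrite scaled_On in sub2.
  by split; [exact: down.1 sub2|exact: up.1 sub1].
split; first by apply/GrP; exists A; [exact: AU|].
  by rewrite scaled_On; exact: up.2 h2.
by rewrite scaled_On; exact: down.2 h1.
Qed.

(** Since L = A O^n, the subspace L / t^N O^n is the image of t^N A. *)
Lemma frame_lat N d A H (M : 'M[C]_(d, n * (N + N))) :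
  A \in unitmx -> tK ^+ N *: A = iota H ->
  (frame (lat A) M <-> row_free M /\ (M :=: act (N + N) H)%MS).
Proof.
move=> AU AH; have tN := tKn_neq0 N.
have memL (f : 'cV[O]_n) : lat A (tK ^- N *: iota f) <-> exists v, f = H *m v.
  split=> [[w /intmxP[v ->] vE]|[v ->]].
    exists v; apply: iota_inj; rewrite map_mxM -AH -scalemxAl vE.
    by rewrite scalerA mulfV // scale1r.
  exists (iota v); first exact: intmx_map.
  by rewrite map_mxM -AH -scalemxAl scalerA mulVf // scale1r.
have sub_act (w : 'rV[C]_(n * (N + N))) : (w <= act (N + N) H)%MS <->
    exists2 f : 'cV[O]_n, lat A (tK ^- N *: iota f) & quo_coord N f = w.
  split=> [/submxP[u ->]|[f /memL[v ->] <-]].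
    exists (H *m lift u); first by apply/memL; exists (lift u).
    by rewrite -[LHS]/(quo (N + N) (H *m lift u)) quo_act quo_lift.
  by rewrite -[quo_coord N _]/(quo (N + N) (H *m v)) quo_act submxMl.
split=> [[Mfree Mw]|[Mfree MH]]; split=> //.
  apply/eqmxP/andP; split; apply/row_subP => i.
    by apply/sub_act/Mw/row_sub.
  by apply/Mw/sub_act/row_sub.
by move=> w; rewrite MH; apply: sub_act.
Qed.

(** The rank of the action on O^n / t^m O^n is read off the elementary divisors. *)
Lemma rank_act H g h nu m : GLO OK g -> GLO OK h ->
  iota H = g *m tdiag tK nu *m h ->
  (forall i, 0 <= nu i) /\ \rank (act m H) = (\sum_i (m - absz (nu i)))%N.
Proof.
move=> gO hO HE; have nu0 i : 0 <= nu i.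
  have : intmx OK (tdiag tK nu).
    have [[gU _ gV] [hU _ hV]] := (gO, hO).
    have -> : tdiag tK nu = invmx g *m iota H *m invmx h.
      by rewrite HE -mulmxA (mulmxK hU) (mulKmx gU).
    by apply: (intmxM dvr) hV; apply: (intmxM dvr) gV (intmx_map H).
  by move=> /(_ i i); rewrite tdiagE eqxx mulr1n => /(dvr_tXP dvr).
split=> //; have [g' g'U gE] := GLOP gO; have [h' h'U hE] := GLOP hO.
have -> : H = g' *m tpow C (fun i => absz (nu i)) *m h'.
  apply: iota_inj; rewrite HE gE hE !map_mxM; congr (_ *m _ *m _).
  apply/matrixP => i j; rewrite tdiagE [RHS]mxE /tpow [diag_mx _ _ _]mxE.
  rewrite [(\row__ _) _ _]mxE rmorphMn rmorphXn; congr (_ *+ _).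
  by have := nu0 i; case: (nu i) => // e _; rewrite -exprnP.
rewrite act_mulmx act_mulmx -(rank_act_tpow C).
rewrite (eqmxMfull _ (_ : row_full (act m h'))); last by rewrite row_full_unit act_unit.
by rewrite mxrankMfree // row_free_unit act_unit.
Qed.

(** The closed Schubert variety, as the union of the orbits of the dominated
    weights. *)
Definition Gr_le (lambda : 'I_n -> int) (L : set 'cV[K]_n) :=
  exists g mu, [/\ GLO OK g, dominated lambda mu & L = lat (g *m tdiag tK mu)].

Lemma GLO_tdiag_unit g mu : GLO OK g -> g *m tdiag tK mu \in unitmx.
Proof. by move=> gO; rewrite unitmx_mul (GLO_unit gO) (tdiag_unit dvr). Qed.

Lemma Gr_smith (L : set 'cV[K]_n) : Gr L -> exists g mu, GLO OK g /\
  L = lat (g *m tdiag tK mu).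
Proof.
move=> /GrP[A AU ->].
have [g [b [s [mu [[gO _] [bO _] AE]]]]] := iwahori_decomposition dvr AU.
exists g, mu; split; first exact: gO.
rewrite AE -mulmxA; apply: (lat_GLO dvr); first exact: GLO_tdiag_unit.
by apply: (GLOM dvr) bO; apply: (perm_mx_GLO dvr).
Qed.

Lemma shift_tdiag N g mu :
  tK ^+ N *: (g *m tdiag tK mu) = g *m tdiag tK (fun i => mu i + N%:Z).
Proof.
rewrite scalemxAr; congr (_ *m _); apply/matrixP => i j.
by rewrite mxE !tdiagE (dvr_tD dvr) -exprnP mulrC mulrnAl.
Qed.

(** The ranks of the truncations of t^N L, expressed through [hinge]. *)
Lemma rank_act_hinge N H g h mu m : GLO OK g -> GLO OK h ->
  iota H = g *m tdiag tK (fun i => mu i + N%:Z) *m h ->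
  (forall i, - N%:Z <= mu i) /\ (\rank (act m H))%:Z = hinge (m%:Z - N%:Z) mu.
Proof.
move=> gO hO HE; have [nu0 ->] := rank_act m gO hO HE; split.
  by move=> i; have := nu0 i; clear; lia.
rewrite /hinge (big_morph Posz PoszD erefl); apply: eq_bigr => i _.
by have := nu0 i; clear; lia.
Qed.

(** The values of the hinge are ranks of truncations of the lattice; for large
    arguments they determine the sum of the entries. *)
Lemma lat_invariant g g' mu mu' : GLO OK g -> GLO OK g' ->
  lat (g *m tdiag tK mu) = lat (g' *m tdiag tK mu') ->
  \sum_c mu c = \sum_c mu' c /\ forall k, hinge k mu = hinge k mu'.
Proof.
move=> gO gO' e.
have hO := (lat_eqP dvr (GLO_tdiag_unit mu gO) (GLO_tdiag_unit mu' gO')).1 e.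
set h := invmx _ *m _ in hO.
have [N0 /(_ _ (leqnn N0)) intN] := intmx_pole dvr (g' *m tdiag tK mu').
have [H HE] := intmxP intN; rewrite shift_tdiag in HE.
have HE1 : iota H = g' *m tdiag tK (fun i => mu' i + N0%:Z) *m 1%:M.
  by rewrite mulmx1; exact: esym HE.
have HE2 : iota H = g *m tdiag tK (fun i => mu i + N0%:Z) *m h.
  rewrite -HE -!shift_tdiag -scalemxAl /h.
  by rewrite (mulKVmx (GLO_tdiag_unit mu gO)).
have O1 := GLO1 dvr n.
have hingeE k : hinge k mu = hinge k mu'.
  have [lo1 _] := rank_act_hinge 0 gO' O1 HE1; have [lo2 _] := rank_act_hinge 0 gO hO HE2.
  have [kN|Nk] := leP k (- N0%:Z).
    by rewrite !hinge_small // => c; apply: le_trans kN _.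
  have -> : k = (absz (k + N0%:Z))%:Z - N0%:Z by move: Nk; clear; lia.
  have [_ <-] := rank_act_hinge (absz (k + N0%:Z)) gO' O1 HE1.
  by have [_ <-] := rank_act_hinge (absz (k + N0%:Z)) gO hO HE2.
split; last exact: hingeE.
have B1 c : mu c <= bound mu + bound mu'.
  have := boundP mu c; have := boundP mu' c; clear; lia.
have B2 c : mu' c <= bound mu + bound mu'.
  have := boundP mu c; have := boundP mu' c; clear; lia.
have := hingeE (bound mu + bound mu'); rewrite (hinge_big B1) (hinge_big B2).
by clear; lia.
Qed.

Lemma Gr_leP lambda g mu : GLO OK g ->
  (Gr_le lambda (lat (g *m tdiag tK mu)) <-> dominated lambda mu).
Proof.
move=> gO; split=> [[g' [mu' [gO' [s1 h1] /(lat_invariant gO gO')[s2 h2]]]]|dom].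
  by split=> [|k]; [rewrite s2|rewrite h2].
by exists g, mu.
Qed.

Lemma Gr_le_Gr lambda L : Gr_le lambda L -> Gr L.
Proof. by move=> [g [mu [gO _ ->]]]; apply/Gr_lat/GLO_tdiag_unit. Qed.

(** The rank conditions that define the Schubert variety need only be imposed in
    the finite quotient of the lattices between t^N O^n and t^-N O^n. *)
Lemma dominated_bounded lambda mu (N : nat) : (forall c, - N%:Z <= mu c) ->
  (forall c, mu c <= N%:Z) -> \sum_c mu c = \sum_c lambda c ->
  (forall k : nat, (k <= N + N)%N ->
     hinge (k%:Z - N%:Z) mu <= hinge (k%:Z - N%:Z) lambda) ->
  dominated lambda mu.
Proof.
move=> lo up s0 h; split=> // k.
have [kN|Nk] := leP k (- N%:Z).
  rewrite hinge_small; first by apply: sumr_ge0 => c _; rewrite le_max lexx orbT.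
  by move=> c; apply: le_trans kN _.
have [kN|Nk'] := leP k N%:Z.
  have := h (absz (k + N%:Z)); rewrite (_ : (absz (k + N%:Z))%:Z - N%:Z = k).
    by apply; move: Nk kN; clear; lia.
  by move: Nk; clear; lia.
rewrite hinge_big; last by move=> c; apply: le_trans (up c) _; apply: ltW.
rewrite s0 -[X in X <= _](_ : \sum_c (k - lambda c) = _).
  by apply: ler_sum => c _; rewrite le_max lexx.
by rewrite sumrB sumr_const card_ord -mulr_natr natz.
Qed.

(** The places of the coefficients of order less than [k] among those of order
    less than [m]. *)
Definition colmap (m k : nat) (km : (k <= m)%N) (a : 'I_(n * k)) : 'I_(n * m) :=
  let ik := enum_val (cast_ord (esym (mxvec_cast n k)) a) in
  mxvec_index ik.1 (widen_ord km ik.2).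

Lemma colsub_quo m k (km : (k <= m)%N) (f : 'cV[O]_n) : colsub (colmap km) (quo m f) = quo k f.
Proof.
apply/rowP => a; case/mxvec_indexP: a => i j.
rewrite mxE /colmap /mxvec_index cast_ordK enum_rankK -/(mxvec_index _ _).
by rewrite !quo_index.
Qed.

Lemma rank_colsub_act m k (km : (k <= m)%N) d (M : 'M[C]_(d, n * m)) H :
  (M :=: act m H)%MS -> \rank (colsub (colmap km) M) = \rank (act k H).
Proof.
move=> MH; rewrite mul_colsub (eqmxMr _ MH) -mul_colsub.
apply/eqmx_rank/andP; split; apply/row_subP => a.
  rewrite mul_colsub row_mul -mul_colsub row_act colsub_quo quo_act; exact: submxMl.
rewrite row_act -(colsub_quo km) quo_act mul_colsub.
by rewrite [colsub _ (act m H)]mul_colsub -mulmxA; apply: submxMl.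
Qed.

Lemma GrN_entries N g mu : GLO OK g -> GrN N (lat (g *m tdiag tK mu)) ->
  forall c, - N%:Z <= mu c <= N%:Z.
Proof.
move=> gO LN c; have AU := GLO_tdiag_unit mu gO; have tU := tdiag_unit dvr mu.
have [gU gi gV] := gO; have [intA intV] := (GrN_lat N AU).1 LN.
have lo : intmx OK (tK ^+ N *: tdiag tK mu).
  have -> : tK ^+ N *: tdiag tK mu = invmx g *m (tK ^+ N *: (g *m tdiag tK mu)).
    rewrite -scalemxAr (mulKmx gU); reflexivity.
  exact: (intmxM dvr) gV intA.
have up : intmx OK (tK ^+ N *: tdiag tK (fun i => - mu i)).
  have -> : tK ^+ N *: tdiag tK (fun i => - mu i)
      = tK ^+ N *: invmx (g *m tdiag tK mu) *m g.
    rewrite (invmxM gU tU) -scalemxAl (mulmxKV gU) (invmx_tdiag dvr); reflexivity.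
  exact: (intmxM dvr) intV gi.
move: (lo c c) (up c c); rewrite mxE tdiagE eqxx mulr1n exprnP -(dvr_tD dvr).
rewrite mxE tdiagE eqxx mulr1n -(dvr_tD dvr) => /(dvr_tXP dvr) h1 /(dvr_tXP dvr) h2.
by move: h1 h2; clear; lia.
Qed.

(** The dimension of L / t^N O^n is governed by the valuation of L. *)
Lemma rank_act_val N A H k : A \in unitmx -> GrN N (lat A) ->
  tK ^+ N *: A = iota H -> has_val OK tK (\det A) k ->
  (\rank (act (N + N) H))%:Z = n%:Z * N%:Z - k.
Proof.
move=> AU LN AH Ak.
have [g [b [s [mu [[gO _] [bO _] AE]]]]] := iwahori_decomposition dvr AU.
have hO := GLOM dvr (perm_mx_GLO dvr s) bO.
set h := perm_mx s *m b in hO; have {}AE : A = g *m tdiag tK mu *m h.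
  by rewrite /h mulmxA; exact: AE.
clearbody h.
have gtU := GLO_tdiag_unit mu gO.
have LE : lat A = lat (g *m tdiag tK mu) by rewrite AE; exact: (lat_GLO dvr gtU hO).
rewrite LE in LN; have bd := GrN_entries gO LN.
have HE : iota H = g *m tdiag tK (fun i => mu i + N%:Z) *m h.
  rewrite -AH AE scalemxAl shift_tdiag; reflexivity.
have [_ ->] := rank_act_hinge (N + N) gO hO HE.
rewrite PoszD addrK hinge_big; last by move=> c; case/andP: (bd c).
have -> : k = \sum_c mu c; last by rewrite mulrC.
apply: (has_val_inj dvr Ak); rewrite AE !det_mulmx (det_tdiag dvr).
have [_ gk] := (GLO_detP dvr g).1 gO; have [_ hk] := (GLO_detP dvr h).1 hO.
have := has_valM dvr (has_valM dvr gk (has_val_tX dvr (\sum_c mu c))) hk.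
by rewrite add0r addr0; apply.
Qed.

(** Closedness of the product of Schubert varieties. The equations are the
    vanishing of the Pluecker coordinates that express the bounds on the ranks,
    and a nonzero constant on the components of the Grassmannian of the wrong
    dimension. *)
Lemma zclosed_Gr_le a b lambda :
  @zclosed C n a b [set p | forall i, Gr_le lambda (p.2 i)].
Proof.
split=> [p hp i|N d]; first exact: Gr_le_Gr (hp i).
pose e k : nat := absz (hinge (k%:Z - N%:Z) lambda).
have eE k : (e k)%:Z = hinge (k%:Z - N%:Z) lambda.
  apply: gez0_abs; apply: sumr_ge0 => c _; by rewrite le_max lexx orbT.
pose m := (N + N)%N.
pose var i (s : {ffun 'I_(d i) -> 'I_(n * m)}) : pvar a (n * m) d :=
  inr (Tagged (fun i => {ffun 'I_(d i) -> 'I_(n * m)}) s).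
pose dim_ok := forall i, (d i)%:Z = n%:Z * N%:Z - \sum_c lambda c.
exists [set F | (~ dim_ok /\ F = mpolyC _ 1) \/
  exists i k (km : (k <= m)%N) (s : {ffun 'I_(d i) -> 'I_(n * m)}),
    [/\ (e k < d i)%N, forall j : 'I_(d i), (j <= e k)%N -> s j \in codom (colmap km)
      & F = mpolyX _ (mnm1 (enum_rank (var i s)))]].
  move=> F [[_ ->]|[i [k [km [s [_ _ ->]]]]]] i0.
    exists 0%N => x; rewrite msupp1 inE => /eqP->.
    by rewrite big1 // => v _; rewrite mnm0E.
  exists (in_factor i0 (var i s) : nat) => x; rewrite msuppX inE => /eqP->.
  rewrite big_mkcond /= (bigD1 (enum_rank (var i s))) //= enum_rankK mnm1E eqxx.
  rewrite big1 ?addn0 => [|v vs]; first by rewrite /in_factor /=; case: (i == i0).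
  by rewrite mnm1E eq_sym (negbTE vs); case: ifP.
move=> y L M LM /=.
have data i : exists g mu, [/\ GLO OK g, L i = lat (g *m tdiag tK mu),
    forall c, - N%:Z <= mu c <= N%:Z, (d i)%:Z = n%:Z * N%:Z - \sum_c mu c
    & forall k (km : (k <= m)%N), (\rank (colsub (colmap km) (M i)))%:Z
        = hinge (k%:Z - N%:Z) mu].
  have [LN LF] := LM i; have [g [mu [gO LE]]] : exists g mu, GLO OK g /\
      L i = lat (g *m tdiag tK mu) by apply: Gr_smith; case: LN.
  exists g, mu; have AU := GLO_tdiag_unit mu gO; rewrite LE in LN LF.
  have [intA intV] := (GrN_lat N AU).1 LN; have [H HE] := intmxP intA.
  have [Mfree MH] := (frame_lat _ AU HE).1 LF.
  have HE1 : iota H = g *m tdiag tK (fun i => mu i + N%:Z) *m 1%:M.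
    by rewrite mulmx1 -shift_tdiag; exact: esym HE.
  have O1 := GLO1 dvr n; have bd := GrN_entries gO LN.
  split=> //.
  - have : (\rank (M i))%:Z = hinge (m%:Z - N%:Z) mu.
      by rewrite MH; have [_ <-] := rank_act_hinge m gO O1 HE1.
    rewrite (eqP Mfree) /m PoszD addrK => ->; rewrite hinge_big; last by move=> c; case/andP: (bd c).
    by rewrite mulrC.
  - move=> k km; rewrite (rank_colsub_act km MH).
    by have [_ ->] := rank_act_hinge k gO O1 HE1.
have Mfree i : row_free (M i) by case: (LM i) => _ [].
have pevalE i s : peval y M (mpolyX C (mnm1 (enum_rank (var i s)))) = plucker (M i) s.
  by rewrite /peval mevalXU enum_rankK.
split=> [LS F [[bad _]|[i [k [km [s [ed scol ->]]]]]]|eqs i].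
- exfalso; apply: bad => i; have [g [mu [gO LE _ -> _]]] := data i.
  by have := LS i; rewrite LE => /(Gr_leP _ _ gO)[-> _].
- rewrite pevalE; have [g [mu [gO LE _ _ rk]]] := data i.
  apply: (plucker_rank (colmap km) (e k) (Mfree i)).1 => //.
  rewrite -lez_nat rk eE; have := LS i; rewrite LE => /(Gr_leP _ _ gO)[_ h].
  exact: h.
- have [g [mu [gO LE bd dE rk]]] := data i; rewrite LE; apply/(Gr_leP _ _ gO).
  have lo c : - N%:Z <= mu c by case/andP: (bd c).
  have up c : mu c <= N%:Z by case/andP: (bd c).
  apply: (dominated_bounded lo up) => [|k km].
    apply: contrapT => sum_neq; have bad : ~ dim_ok.
      by move=> /(_ i); rewrite dE => /addrI/oppr_inj/sum_neq.
    have := eqs _ (or_introl (conj bad erefl)); rewrite /peval mevalC => /eqP.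
    by rewrite oner_eq0.
  rewrite -(rk k km) -eE lez_nat.
  apply: (plucker_rank (colmap km) (e k) (Mfree i)).2 => s ed scol.
  by rewrite -pevalE; apply: eqs; right; exists i, k, km, s.
Qed.

End SchubertRanks.

(** * Limits in closed sets *)

Lemma horner_mmap (R : comNzRingType) (N : nat) (v : 'I_N -> {poly R})
    (F : mpoly N R) (c : R) :
  (mmap (@polyC R) v F).[c] = meval (fun i => (v i).[c]) F.
Proof.
rewrite /meval /mmap horner_sum; apply: eq_bigr => x _.
rewrite hornerM hornerC /mmap1 horner_prod; congr (_ * _).
by apply: eq_bigr => i _; rewrite horner_exp.
Qed.

(** That the field is infinite enters only in the form that a polynomial vanishing
    at all points is zero. *)
Lemma poly_cofinite_eq0 (F : fieldType) (p q : {poly F}) :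
  (forall r : {poly F}, (forall c, r.[c] = 0) -> r = 0) ->
  q != 0 -> (forall c, q.[c] != 0 -> p.[c] = 0) -> p = 0.
Proof.
move=> inf q0 pq; have /eqP : p * q = 0.
  apply: inf => c; rewrite hornerM.
  by have [->|/pq->] := eqVneq q.[c] 0; rewrite ?mulr0 ?mul0r.
by rewrite mulf_eq0 (negbTE q0) orbF => /eqP.
Qed.

Section Pencils.
Variables (C : fieldType) (n : nat).
Notation O := (fps C).
Notation K := {fraction O}.
Notation tK := (tK C).
Notation OK := (@integral C).
Notation iota := (map_mx (@tofrac O)).
Notation lat := (@lat K OK n).
Notation dvr := (fps_dvr C).

Definition constK (c : C) : K := tofrac (fps_const c).

Lemma constK0 : constK 0 = 0.
Proof. by rewrite -(tofrac0 O); congr tofrac; apply: fpsP => -[]. Qed.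

Hypothesis infinite : forall r : {poly C}, (forall c, r.[c] = 0) -> r = 0.

(** If [X] is a right inverse of the frame at 0, the determinant of the product
    of the pencil with [X] is a polynomial that is 1 at 0. *)
Lemma pencil_free d m (M0 M1 : 'M[C]_(d, m)) : row_free M0 ->
  exists2 q : {poly C}, q.[0] != 0 & forall c, q.[c] != 0 -> row_free (M0 + c *: M1).
Proof.
case/row_freeP => X M0X.
pose q := \det (map_mx polyC (M0 *m X) + 'X *: map_mx polyC (M1 *m X)).
have qE c : q.[c] = \det ((M0 + c *: M1) *m X).
  rewrite mulmxDl -scalemxAl -[LHS]/(horner_eval c q) /q.
  move: (M0 *m X) (M1 *m X) => A B; rewrite -det_map_mx; congr (\det _).
  by apply/matrixP => i j; rewrite !mxE /= /horner_eval !hornerE.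
exists q => [|c]; first by rewrite qE scale0r addr0 M0X det1 oner_neq0.
rewrite qE => det0; have U : (M0 + c *: M1) *m X \in unitmx.
  by rewrite unitmxE unitfE.
apply/row_freeP; exists (X *m invmx ((M0 + c *: M1) *m X)).
by rewrite mulmxA mulmxV.
Qed.

Lemma horner_plucker d m (M0 M1 : 'M[C]_(d, m)) (s : {ffun 'I_d -> 'I_m}) c :
  (\det (colsub s (map_mx polyC M0 + 'X *: map_mx polyC M1))).[c]
  = plucker (M0 + c *: M1) s.
Proof.
rewrite /plucker -[LHS]/(horner_eval c (\det _)) -det_map_mx; congr (\det _).
by apply/matrixP => i j; rewrite !mxE /= /horner_eval !hornerE.
Qed.

(** A closed set that contains almost all members of a pencil of tuples of
    lattices of constant valuations contains its member at 0: near 0 the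
    Pluecker coordinates are polynomials in the parameter, and the equations of
    the closed set vanish at almost all values of the parameter. *)
Theorem pencil_limit (a b : nat) (W : set ('rV[C]_a * ('I_b -> set 'cV[K]_n)))
    (y0 y1 : 'rV[C]_a) (B0 B1 : 'I_b -> 'M[K]_n) (k : 'I_b -> int)
    (good : {poly C}) :
  zclosed W -> good.[0] != 0 ->
  (forall c i, good.[c] != 0 ->
     has_val OK tK (\det (B0 i + constK c *: B1 i)) (k i)) ->
  (forall c, c != 0 -> good.[c] != 0 ->
     W (y0 + c *: y1, fun i => lat (B0 i + constK c *: B1 i))) ->
  W (y0, fun i => lat (B0 i)).
Proof.
move=> [_ Wclosed] good0 Bval BW.
have poles (B : 'I_b -> 'M[K]_n) : exists N0, forall i N, (N0 <= N)%N ->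
    intmx OK (tK ^+ N *: B i).
  have [f fP] := choice (fun i => intmx_pole dvr (B i)).
  exists (\max_i f i)%N => i N fN; apply: fP; apply: leq_trans fN; exact: leq_bigmax.
have [N1 intB0] := poles B0; have [N2 intB1] := poles B1.
pose N0 := maxn N1 N2; pose N := (n * N0 + N0 + \max_i absz (k i))%N.
have N0N : (N0 <= N)%N by rewrite /N; clear; lia.
have [P PE] := choice (fun i => intmxP (intB0 i N (leq_trans (leq_maxl _ _) N0N))).
have [Q QE] := choice (fun i => intmxP (intB1 i N (leq_trans (leq_maxr _ _) N0N))).
pose B c i := B0 i + constK c *: B1 i.
pose H c i : 'M[O]_n := P i + fps_const c *: Q i.
have BH c i : tK ^+ N *: B c i = iota (H c i).
  rewrite /B /H scalerDr scalerA [_ * constK c]mulrC -scalerA PE QE.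
  by rewrite map_mxD map_mxZ.
have BU c i : good.[c] != 0 -> B c i \in unitmx.
  by move=> /(Bval c i)[d0 _ _]; rewrite unitmxE unitfE; exact: d0.
have BN c i : good.[c] != 0 -> GrN N (lat (B c i)).
  move=> gc; apply/(GrN_lat N (BU c i gc)); split; first by rewrite BH; exact: intmx_map.
  have intN0 : intmx OK (tK ^+ N0 *: B c i).
    rewrite /B scalerDr scalerA [_ * constK c]mulrC -scalerA.
    apply: (intmxD dvr); first exact: intB0 (leq_maxl _ _).
    apply: (intmxZ dvr); first exact: integral_tofrac.
    exact: intB1 (leq_maxr _ _).
  apply: (intmx_inv_pole dvr intN0 (Bval c i gc)).
  have : (absz (k i) <= \max_i absz (k i))%N by apply: leq_bigmax.
  by rewrite /N; clear; lia.
pose m := (n * (N + N))%N.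
have actH c i : act (N + N) (H c i) = act (N + N) (P i) + c *: act (N + N) (Q i).
  exact: act_pencil.
have constB0 i : B 0 i = B0 i.
  rewrite /B constK0 scale0r addr0; reflexivity.
have rk c i : good.[c] != 0 -> \rank (act (N + N) (H c i)) = \rank (act (N + N) (P i)).
  have rkE c' : good.[c'] != 0 -> (\rank (act (N + N) (H c' i)))%:Z = n%:Z * N%:Z - k i.
    by move=> gc; apply: (rank_act_val (BU c' i gc) (BN c' i gc) (BH c' i) (Bval c' i gc)).
  have H0 : act (N + N) (H 0 i) = act (N + N) (P i) by rewrite actH scale0r addr0.
  move=> gc; have e1 := rkE c gc; have e0 := rkE 0 good0; rewrite H0 in e0.
  have e := congr1 absz (etrans e1 (esym e0)); exact: e.
pose d i := \rank (act (N + N) (P i)).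
pose M0 i : 'M[C]_(d i, m) := rowsub (maxrankfun (act (N + N) (P i))) (act (N + N) (P i)).
pose M1 i : 'M[C]_(d i, m) := rowsub (maxrankfun (act (N + N) (P i))) (act (N + N) (Q i)).
pose M c i := M0 i + c *: M1 i.
have free_ex i : exists q : {poly C}, q.[0] != 0 /\ forall c, q.[c] != 0 -> row_free (M c i).
  by have [q q0 qP] := pencil_free (M1 i) (maxrowsub_free (act (N + N) (P i))); exists q.
have [q qP] := choice free_ex.
have MH c i : good.[c] != 0 -> (q i).[c] != 0 -> frame (lat (B c i)) (M c i).
  move=> gc qc; have [_ /(_ c qc) Mfree] := qP i.
  apply/(frame_lat _ (BU c i gc) (BH c i)); split=> //.
  have sub : (M c i <= act (N + N) (H c i))%MS.
    have -> : M c i = rowsub (maxrankfun (act (N + N) (P i))) (act (N + N) (H c i)).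
      by rewrite actH; apply/matrixP => r s; rewrite !mxE.
    exact: rowsub_sub.
  apply/eqmxP; rewrite sub /= -(geq_leqif (mxrank_leqif_sup sub)) rk //.
  by rewrite (eqP Mfree).
have [eqs _ eqsP] := Wclosed N d.
have members c : good.[c] != 0 -> (forall i, (q i).[c] != 0) ->
    forall i, GrN N (lat (B c i)) /\ frame (lat (B c i)) (M c i).
  by move=> gc qc i; split; [exact: BN|exact: MH].
have q0 i : (q i).[0] != 0 by case: (qP i).
have lim : W (y0, fun i => lat (B 0 i)).
  apply/(eqsP _ _ (M 0) (members 0 good0 q0)) => F /[dup] FP.
  pose v (x : 'I_#|pvar a m d|) : {poly C} := match enum_val x with
    | inl j => (y0 0 j)%:P + 'X * (y1 0 j)%:P
    | inr u => \det (colsub (tagged u)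
        (map_mx polyC (M0 (tag u)) + 'X *: map_mx polyC (M1 (tag u))))
    end.
  have vE c : (mmap (@polyC C) v F).[c] = peval (y0 + c *: y1) (M c) F.
    rewrite horner_mmap /peval; congr (meval _ F); apply/funext => x.
    rewrite /v; case: (enum_val x) => [j|u].
      by rewrite !hornerE !mxE.
    exact: horner_plucker.
  suff p0 : mmap (@polyC C) v F = 0.
    by have := vE 0; rewrite scale0r addr0 p0 horner0.
  apply: (poly_cofinite_eq0 infinite (q := 'X * good * \prod_i q i)).
    have nz (p : {poly C}) : p.[0] != 0 -> p != 0.
      by apply: contraNneq => ->; rewrite horner0.
    apply: mulf_neq0; first by rewrite mulf_neq0 ?polyX_eq0 ?nz.
    apply/prodf_neq0 => i _.
    exact: nz (q0 i).
  move=> c; rewrite !hornerM hornerX horner_prod !mulf_eq0 !negb_or => /andP[/andP[c0 gc] qc].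
  rewrite vE; apply: (eqsP _ _ (M c) (members c gc _)).1 => // [i|]; last exact: BW.
  by apply: contraNneq qc => qi; rewrite (bigD1 i) //= qi mul0r.
by rewrite (_ : (fun i => lat (B 0 i)) = fun i => lat (B0 i)) in lim;
  [exact: lim|apply/funext => i; rewrite constB0].
Qed.

End Pencils.

Lemma scale_middle (F : fieldType) n (x y : F) (G D T : 'M[F]_n) :
  x *: (G *m (y *: D) *m T) = G *m ((x * y) *: D *m T).
Proof. by rewrite -mulmxA -!scalemxAl -!scalemxAr scalerA. Qed.

Lemma unitmx_mulmx (F : fieldType) n (A B : 'M[F]_n) :
  A \in unitmx -> B \in unitmx -> A *m B \in unitmx.
Proof. by move=> AU BU; rewrite unitmx_mul AU. Qed.

Lemma unitmx_det_neq0 (F : fieldType) n (A : 'M[F]_n) : A \in unitmx -> \det A != 0.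
Proof. by rewrite unitmxE unitfE. Qed.

Section ThetaPencil.
Variables (K : fieldType) (O : K -> Prop) (t : K).
Hypothesis Odvr : is_dvr O t.
Variable n : nat.
Implicit Types (g : 'M[K]_n) (i : nat) (x y : K).

Definition theta_mx i x : 'M[K]_n := diag_mx (\row_j (if (j < i)%N then x else 1)).

Lemma theta_mx_mul p i x (A : 'M[K]_(n, p)) r c :
  (theta_mx i x *m A) r c = (if (r < i)%N then x else 1) * A r c.
Proof. by rewrite mul_diag_mx !mxE. Qed.

Lemma mul_theta_mx p i x (A : 'M[K]_(p, n)) r c :
  (A *m theta_mx i x) r c = A r c * (if (c < i)%N then x else 1).
Proof. by rewrite mul_mx_diag !mxE. Qed.

Lemma theta_mxM i x y : theta_mx i x *m theta_mx i y = theta_mx i (x * y).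
Proof.
rewrite /theta_mx mulmx_diag; congr diag_mx; apply/rowP => j; rewrite !mxE.
by case: ifP; rewrite ?mulr1.
Qed.

Lemma theta_mx1 i : theta_mx i 1 = 1%:M.
Proof. by apply/matrixP => r c; rewrite !mxE; case: ifP. Qed.

Lemma theta_mx_unit i x : x != 0 -> theta_mx i x \in unitmx.
Proof.
move=> x0; have : theta_mx i x *m theta_mx i x^-1 = 1%:M.
  by rewrite theta_mxM mulfV // theta_mx1.
by case/mulmx1_unit.
Qed.

Lemma theta_mx_GLO i x : has_val O t x 0 -> GLO O (theta_mx i x).
Proof.
move=> x0; have [nz _ _] := x0.
have intT y : O y -> intmx O (theta_mx i y).
  move=> Oy r c; rewrite !mxE; case: eqP => _; last exact: (dvr0 Odvr).
  by case: ifP => _; [exact: Oy|exact: (dvr1 Odvr)].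
apply: (@GLO_exhibit _ _ _ _ (theta_mx i x^-1)).
- by rewrite theta_mxM mulfV // theta_mx1.
- by apply: intT; apply/(has_val_int Odvr x0).
- by apply: intT; apply/(has_val_int Odvr (has_valV x0)); rewrite oppr0.
Qed.

Lemma theta_mx_tdiag i x mu : theta_mx i x *m tdiag t mu = tdiag t mu *m theta_mx i x.
Proof. by rewrite /theta_mx /tdiag !mulmx_diag; congr diag_mx; apply/rowP => j; rewrite !mxE mulrC. Qed.

Lemma theta_mx_t i : theta_mx i t = tdiag t (omega i).
Proof.
apply/matrixP => r c; rewrite tdiagE !mxE /omega; by case: ifP.
Qed.

(** The deformation of an element of the Iwahori subgroup in which the factors t
    above the diagonal become t - y. *)
Definition deform g y : 'M[K]_n :=
  \matrix_(r, c) (g r c - y * (if (r < c)%N then g r c * t^-1 else 0)).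

Definition slope i g : 'M[K]_n :=
  \matrix_(r, c) (if (c < i <= r)%N then - g r c else
    if (r < i <= c)%N then 0 else if (r < c)%N then - (g r c * t^-1) else 0).

(** The conjugates of [deform g y] are affine functions of y: conjugation
    multiplies the entries with c < i <= r, which do not depend on y, by t - y,
    and it cancels the factor t - y of the entries with r < i <= c. *)
Lemma deform_conj i g y :
  theta_mx i (t - y) *m
    (tdiag t (fun c => - omega i c) *m g *m tdiag t (omega i) + y *: slope i g)
  = deform g y *m theta_mx i (t - y).
Proof.
have t0 := dvr_t_neq0 Odvr.
apply/matrixP => r c; rewrite theta_mx_mul mul_theta_mx [in LHS]mxE.
rewrite (mul_tdiag _ _ (omega i)) (tdiag_mul _ (fun c => - omega i c)) !mxE /omega.
case: (ltnP r i) => ri; case: (ltnP c i) => ci; case: (ltnP r c) => rc /=;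
  rewrite ?oppr0 ?expr0z -?[t ^ (- 1%N%:Z)]/(t^-1) ?expr1z ?mulr0 ?mul1r ?mulr1 ?addr0;
  try by field.
- by move: (leq_ltn_trans rc ri); rewrite ltnNge ci.
- by move: (leq_ltn_trans ri rc); rewrite ltnNge ltnW.
Qed.

End ThetaPencil.

Section Limits.
Variables (C : fieldType) (n : nat).
Notation O := (fps C).
Notation K := {fraction O}.
Notation tK := (tK C).
Notation OK := (@integral C).
Notation iota := (map_mx (@tofrac O)).
Notation lat := (@lat K OK n).
Notation dvr := (fps_dvr C).
Notation tdiag := (@tdiag K tK n).

Hypothesis infinite : forall r : {poly C}, (forall c, r.[c] = 0) -> r = 0.

Lemma constK_val c : c != 0 -> has_val OK tK (constK c) 0.
Proof.
move=> c0; apply/fps_has_val; exists (fps_const c); last by rewrite expr0z mul1r.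
by rewrite fps_unitE.
Qed.

(** The matrices 1 + c t^-e E_lj define a pencil through the given tuple, with
    constant determinants. For c != 0 its members are by [root_lattice] images of
    the reflected tuple under the root subgroup of (j, l), provided that all
    members of the given tuple lie on the same side of the hyperplane. *)
Lemma root_limit a b (W : set ('rV[C]_a * ('I_b -> set 'cV[K]_n))) y
    (G : 'I_b -> 'M[K]_n) (nu : 'I_b -> 'I_n -> int) (j l : 'I_n) e :
  zclosed W -> (forall i, G i \in unitmx) -> j != l ->
  (forall i, nu i j - nu i l <= e) ->
  (forall c, c != 0 -> W (y, fun i => lat (G i *m
      root_mx j l ((constK c)^-1 * tK ^ e) *m tdiag (refl j l e (nu i))))) ->
  W (y, fun i => lat (G i *m tdiag (nu i))).
Proof.
move=> Wc GU jl nule WG; have lj : l != j by rewrite eq_sym.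
pose B1 i := G i *m (tK ^ (- e) *: delta_mx l j) *m tdiag (nu i).
have BE c i : G i *m tdiag (nu i) + constK c *: B1 i
    = G i *m (root_mx l j (constK c * tK ^ (- e)) *m tdiag (nu i)).
  rewrite /B1 /root_mx mulmxDl mul1mx mulmxDr; congr (_ + _).
  exact: scale_middle.
have detU i : \det (G i *m tdiag (nu i)) != 0.
  exact: unitmx_det_neq0 (unitmx_mulmx (GU i) (tdiag_unit dvr (nu i))).
have [k kE] := choice (fun i => has_valP dvr (detU i)).
apply: (@pencil_limit C n infinite a b W y 0 _ B1 k 1) => //.
- by rewrite hornerC oner_neq0.
- move=> c i _; rewrite BE !det_mulmx (det_root _ lj) mul1r -det_mulmx; exact: kE.
- move=> c c0 _; rewrite scaler0 addr0.
  have -> : (fun i => lat (G i *m tdiag (nu i) + constK c *: B1 i))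
      = (fun i => lat (G i *m root_mx j l ((constK c)^-1 * tK ^ e)
                   *m tdiag (refl j l e (nu i)))).
    apply/funext => i; rewrite BE -lat_image.
    rewrite (root_lattice dvr jl (nule i) (constK_val c0)) lat_image mulmxA.
    reflexivity.
  exact: WG.
Qed.

(** The closure of the orbit of [lambda] contains the orbits of the dominated
    weights. Unless [mu] is a permutation of [lambda], it can be moved outwards by
    [dominated_extremal] to another dominated weight, whose orbit has that of [mu]
    in its closure by [root_limit]. The sum of the squares of the entries
    increases and is bounded. The factors [h i] allow the use of the statement in
    all fibres off the special one. *)
Lemma dominated_limit a b (W : set ('rV[C]_a * ('I_b -> set 'cV[K]_n))) y
    (h : 'I_b -> 'M[K]_n) lambda : zclosed W -> (forall i, h i \in unitmx) ->
  (forall g, GLO OK g -> W (y, fun i => lat (h i *m (g *m tdiag lambda)))) ->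
  forall mu g, dominated lambda mu -> GLO OK g ->
    W (y, fun i => lat (h i *m (g *m tdiag mu))).
Proof.
move=> Wc hU base; pose B := bound lambda.
pose size (mu : 'I_n -> int) : int := n%:Z * B ^+ 2 - \sum_c mu c ^+ 2.
have size_ge0 mu : dominated lambda mu -> 0 <= size mu.
  move=> dom; rewrite /size subr_ge0 mulrC -natz mulr_natr -[n in _ *+ n]card_ord -sumr_const.
  apply: ler_sum => c _; rewrite -(real_normK (num_real (mu c))).
  by rewrite lerXn2r ?nnegrE //; [apply: sumr_ge0|exact: dominated_bound].
move=> mu; have [m] := ubnP (absz (size mu)); elim: m mu => // m IH mu mu_m g dom gO.
have [[s mu_s]|[j [l [jl mu_lj dom']]]] := dominated_extremal dom.
  have -> : (fun i => lat (h i *m (g *m tdiag mu)))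
      = fun i => lat (h i *m (g *m perm_mx s *m tdiag lambda)).
    have eL : lat (g *m tdiag mu) = lat (g *m perm_mx s *m tdiag lambda).
      rewrite -mulmxA (perm_tdiag tK s lambda).
      have -> : (fun c => lambda (s c)) = mu by apply/funext => c; rewrite mu_s.
      rewrite mulmxA (lat_GLO dvr (GLO_tdiag_unit mu gO) (perm_mx_GLO dvr s)).
      reflexivity.
    apply/funext => i; rewrite -[LHS]lat_image eL lat_image; reflexivity.
  by apply: base; exact: (GLOM dvr gO (perm_mx_GLO dvr s)).
pose e := mu j - mu l + 1.
have reflE : refl j l e mu = transfer j l mu.
  apply/funext => c; rewrite /refl /transfer /e.
  have [->|cj] := eqVneq c j; first by rewrite (negbTE jl); clear; lia.
  by have [->|cl] := eqVneq c l; clear; lia.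
have hgU i : h i *m g \in unitmx by exact: unitmx_mulmx (hU i) (GLO_unit gO).
have -> : (fun i => lat (h i *m (g *m tdiag mu)))
    = fun i => lat ((h i *m g) *m tdiag mu).
  by apply/funext => i; rewrite mulmxA.
apply: (root_limit (nu := fun=> mu) (e := e) Wc hgU jl) => [i|c c0].
  by rewrite /e; clear; lia.
have uO : GLO OK (root_mx j l ((constK c)^-1 * tK ^ e)).
  apply: (root_GLO dvr jl); apply/(has_val_int dvr (has_valM dvr
    (has_valV (constK_val c0)) (has_val_tX dvr e))).
  by move: mu_lj; rewrite /e; clear; lia.
rewrite reflE; set u := root_mx _ _ _ in uO *.
have -> : (fun i => lat (h i *m g *m u *m tdiag (transfer j l mu)))
    = fun i => lat (h i *m (g *m u *m tdiag (transfer j l mu))).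
  by apply/funext => i; rewrite !mulmxA.
apply: IH; [|exact: dom'|exact: (GLOM dvr gO uO)].
have lt_size : size (transfer j l mu) < size mu.
  rewrite /size ltrD2l ltrN2 !(sum_bigD2 _ jl) transfer_l // transfer_r //.
  rewrite [in ltRHS](eq_bigr (fun c => mu c ^+ 2)); last first.
    by move=> d /andP[dj dl]; rewrite transfer_out.
  by rewrite ltrD2r; exact: square_gap mu_lj (lexx 1).
have := size_ge0 _ dom'; move: mu_m lt_size; clear; lia.
Qed.

End Limits.

(** * Deformation of the points of the special fibre *)

Section SpecialFibre.
Variables (C : fieldType) (n : nat).
Notation O := (fps C).
Notation K := {fraction O}.
Notation tK := (tK C).
Notation OK := (@integral C).
Notation iota := (map_mx (@tofrac O)).
Notation lat := (@lat K OK n).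
Notation dvr := (fps_dvr C).
Notation tdiag := (@tdiag K tK n).

Hypothesis infinite : forall r : {poly C}, (forall c, r.[c] = 0) -> r = 0.

Definition Theta (i : nat) (y : C) : 'M[K]_n := theta_mx n i (t_minus y).

Lemma t_minusE y : t_minus y = tK - constK y.
Proof. exact: tofracB. Qed.

Lemma t_minus0 : t_minus 0 = tK :> K.
Proof. by rewrite t_minusE constK0 subr0. Qed.

Lemma t_minus_val y : y != 0 -> has_val OK tK (t_minus y) 0.
Proof.
move=> y0; apply/fps_has_val; exists (fps_var C - fps_const y); last by rewrite expr0z mul1r.
by rewrite fps_unitE rmorphB /fcoef0 /= sub0r oppr_eq0.
Qed.

Lemma Theta_GLO i y : y != 0 -> GLO OK (Theta i y).
Proof. by move=> y0; apply: (theta_mx_GLO dvr); apply: t_minus_val. Qed.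

Lemma Theta_unit i y : Theta i y \in unitmx.
Proof.
apply: theta_mx_unit; have [->|y0] := eqVneq y 0; last by case: (t_minus_val y0).
by rewrite t_minus0; apply: (dvr_t_neq0 dvr).
Qed.

Lemma Theta0 i : Theta i 0 = tdiag (omega i).
Proof. by rewrite /Theta t_minus0; apply: theta_mx_t. Qed.

Lemma Theta_id y : Theta 0 y = 1%:M.
Proof. by apply/matrixP => r c; rewrite !mxE. Qed.

Lemma theta_lat i y A : theta i y @` lat A = lat (Theta i y *m A).
Proof.
rewrite -lat_image; congr (_ @` _); apply/funext => v; apply/matrixP => r c.
by rewrite theta_mx_mul mxE ord1; case: ifP; rewrite ?mul1r.
Qed.

(** For y != 0 this is the point of the global Grassmannian over y with first
    lattice [lat A]. *)
Definition generic_point y A : 'I_n -> set 'cV[K]_n :=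
  fun i => lat (invmx (Theta i y) *m A).

(** If the lattices of a point of the special fibre all have the same position
    [nu] relative to the standard ones, then [deform] moves the point off the
    special fibre, into the orbit of [nu], where [dominated_limit] applies. *)
Lemma translation_limit (W : set ('rV[C]_1 * ('I_n -> set 'cV[K]_n))) lambda :
  zclosed W ->
  (forall (y : C) g, y != 0 -> GLO OK g -> W (y%:M, generic_point y (g *m tdiag lambda))) ->
  forall nu g, dominated lambda nu -> iwahori OK tK g ->
    W (0, fun i : 'I_n => lat (tdiag (fun c => - omega i c) *m g *m tdiag (omega i) *m tdiag nu)).
Proof.
move=> Wc base nu g dom gI; have [gO gt] := gI.
pose G0 (i : 'I_n) := tdiag (fun c => - omega i c) *m g *m tdiag (omega i).
pose G1 (i : 'I_n) := slope tK i g.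
have [g' g'U gE] := GLOP gO.
have [U UE] : exists U : 'M[O]_n, forall y, deform tK g (constK y) = iota (g' - fps_const y *: U).
  have [U UE] : exists U, (\matrix_(r, c) (if (r < c)%N then g r c * tK^-1 else 0)) = iota U.
    apply: intmxP => r c; rewrite mxE; case: ifP => [/gt h|_]; first exact: h.
    exact: (dvr0 dvr).
  exists U => y; apply/matrixP => r c.
  have /matrixP/(_ r c) := UE; have /matrixP/(_ r c) := gE.
  rewrite !mxE rmorphB rmorphM /= => <- <-; reflexivity.
pose good : {poly C} :=
  \det (map_mx polyC (map_mx (@fcoef0 C) g') + 'X *: map_mx polyC (- map_mx (@fcoef0 C) U)).
have goodE y : good.[y] = fcoef0 (\det (g' - fps_const y *: U)).
  rewrite -[LHS]/(horner_eval y good) /good -!det_map_mx; congr (\det _).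
  apply/matrixP => r c; rewrite !mxE /= /horner_eval !hornerE.
  rewrite big_ord1 mulrN; reflexivity.
have gyO y : good.[y] != 0 -> GLO OK (deform tK g (constK y)).
  by move=> gy; rewrite UE; apply: GLO_map; rewrite unitmxE fps_unitE -goodE.
have good0 : good.[0] != 0.
  rewrite goodE (_ : fps_const 0 = 0); last by apply: fpsP => -[].
  by rewrite scale0r subr0 -fps_unitE -unitmxE.
have conj (i : 'I_n) y : Theta i y *m (G0 i + constK y *: G1 i)
    = deform tK g (constK y) *m Theta i y.
  by rewrite /Theta t_minusE; exact: (deform_conj dvr).
have detE (i : 'I_n) y : \det (G0 i + constK y *: G1 i) = \det (deform tK g (constK y)).
  have := congr1 determinant (conj i y); rewrite !det_mulmx mulrC.
  by move/(mulIf (unitmx_det_neq0 (Theta_unit i y))).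
pose B0 i := G0 i *m tdiag nu; pose B1 i := G1 i *m tdiag nu.
have BE (i : 'I_n) y : B0 i + constK y *: B1 i = (G0 i + constK y *: G1 i) *m tdiag nu.
  by rewrite mulmxDl -scalemxAl; reflexivity.
apply: (pencil_limit infinite (y1 := 1%:M) (B0 := B0) (B1 := B1) Wc good0).
  move=> y i gy; rewrite BE det_mulmx detE (det_tdiag dvr).
  have [_ gv] := (GLO_detP dvr _).1 (gyO y gy).
  exact: (has_valM dvr gv (has_val_tX dvr _)).
move=> y y0 gy; rewrite add0r scale_scalar_mx mulr1.
have -> : (fun i => lat (B0 i + constK y *: B1 i))
    = generic_point y (deform tK g (constK y) *m tdiag nu).
  apply/funext => i; rewrite BE /generic_point.
  have -> : (G0 i + constK y *: G1 i) *m tdiag nu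
      = invmx (Theta i y) *m (deform tK g (constK y) *m tdiag nu) *m Theta i y.
    have c1 := canRL (mulKmx (Theta_unit i y)) (conj i y).
    by rewrite c1 -!mulmxA /Theta theta_mx_tdiag; reflexivity.
  apply: (lat_GLO dvr); last exact: Theta_GLO.
  apply: unitmx_mulmx; last exact: GLO_tdiag_unit (gyO y gy).
  by rewrite unitmx_inv; exact: Theta_unit.
apply: (dominated_limit infinite Wc _ _ dom (gyO y gy)) => [i|g1 g1O].
  by rewrite unitmx_inv; exact: Theta_unit.
exact: base.
Qed.

End SpecialFibre.

Lemma chain_translation n (nu : 'I_n -> int) i : (i <= n)%N ->
  chain nu 1%g i = fun c => omega i c + nu c.
Proof.
by move=> le_in; apply/funext => c; rewrite /chain perm1 wind_small // addrC.
Qed.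

Lemma relpos_translation n (nu : 'I_n -> int) i : relpos nu 1%g i = nu.
Proof. by apply/funext => c; rewrite /relpos /chain perm1 addrK. Qed.

Section SpecialFibreChains.
Variables (C : fieldType) (n : nat).
Notation O := (fps C).
Notation K := {fraction O}.
Notation tK := (tK C).
Notation OK := (@integral C).
Notation lat := (@lat K OK n).
Notation dvr := (fps_dvr C).
Notation tdiag := (@tdiag K tK n).

Hypothesis infinite : forall r : {poly C}, (forall c, r.[c] = 0) -> r = 0.

(** A closed condition that holds off the special fibre holds at the chains of
    the special fibre with dominated positions. The reflections of
    [dominated_reflection] lead to the case of a translation, since the sum of the
    squares of the totals, which they increase, is bounded. *)
Lemma special_limit (W : set ('rV[C]_1 * ('I_n -> set 'cV[K]_n))) lambda :
  zclosed W ->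
  (forall (y : C) g, y != 0 -> GLO OK g ->
    W (y%:M, generic_point y (g *m tdiag lambda))) ->
  forall nu (s : 'S_n) g, (forall i, dominated lambda (relpos nu s i)) ->
    iwahori OK tK g ->
    W (0, fun i : 'I_n => lat (tdiag (fun c => - omega i c) *m g *m tdiag (chain nu s i))).
Proof.
move=> Wc base; pose B := n%:Z * bound lambda.
have B0 : 0 <= B by apply: mulr_ge0 => //; apply: sumr_ge0.
pose size nu (s : 'S_n) : int := n%:Z * B ^+ 2 - \sum_c total nu s c ^+ 2.
have size_ge0 nu (s : 'S_n) : (forall i, dominated lambda (relpos nu s i)) -> 0 <= size nu s.
  move=> dom; rewrite /size subr_ge0 mulrC -natz mulr_natr -[n in _ *+ n]card_ord -sumr_const.
  apply: ler_sum => c _; rewrite -(real_normK (num_real (total nu s c))).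
  rewrite lerXn2r ?nnegrE //; apply: (le_trans (ler_norm_sum _ _ _)).
  rewrite /B -natz mulr_natl -[n in _ *+ n]card_ord -sumr_const.
  by apply: ler_sum => i _; exact: dominated_bound.
move=> nu s; have [m] := ubnP (absz (size nu s)).
elim: m nu s => // m IH nu s size_m g dom gI.
have [s1|s1] := eqVneq s 1%g.
  have posE i : relpos nu s i = nu.
    rewrite s1; exact: relpos_translation.
  have -> : (fun i : 'I_n => lat (tdiag (fun c => - omega i c) *m g *m tdiag (chain nu s i)))
      = fun i : 'I_n => lat (tdiag (fun c => - omega i c) *m g *m tdiag (omega i) *m tdiag nu).
    apply/funext => i; have chainE := chain_translation nu (ltnW (ltn_ord i)).
    rewrite s1 chainE -(tdiagM dvr) mulmxA; reflexivity.
  have dom0 := dom 0%N; rewrite posE in dom0.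
  exact: (translation_limit infinite Wc base dom0 gI).
have [a [l [e [al le_e ale dom' lt_sq]]]] := dominated_reflection dom s1.
have GU (i : 'I_n) : tdiag (fun c => - omega i c) *m g \in unitmx.
  apply: unitmx_mulmx; first exact: (tdiag_unit dvr).
  by case: gI => gO _; exact: (GLO_unit gO).
apply: (root_limit infinite (nu := fun i : 'I_n => chain nu s i) (e := e) Wc GU al).
  by move=> i; exact: le_e.
move=> c c0; set u := root_mx _ _ _.
have uI : iwahori OK tK u.
  apply: (root_iwahori dvr al); rewrite -mulrA -(dvr_tD dvr).
  apply/(has_val_int dvr (has_valM dvr (has_valV (constK_val c0)) (has_val_tX dvr _))).
  by move: ale; clear; lia.
have -> : (fun i : 'I_n => lat (tdiag (fun c => - omega i c) *m g *m u *m tdiag (refl a l e (chain nu s i))))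
    = fun i : 'I_n => lat (tdiag (fun c => - omega i c) *m (g *m u)
        *m tdiag (chain (refl a l e nu) (tperm a l * s) i)).
  apply/funext => i; rewrite (chain_refl _ _ _ _ al) mulmxA; reflexivity.
apply: IH; [|exact: dom'|exact: (iwahoriM dvr gI uI)].
have lt_size : size (refl a l e nu) (tperm a l * s)%g < size nu s.
  by rewrite /size ltrD2l ltrN2.
have := size_ge0 _ _ dom'; move: size_m lt_size; clear; lia.
Qed.

End SpecialFibreChains.

(** * The members of the global Grassmannian *)

Lemma sum_omega n i : (i <= n)%N -> \sum_(c < n) omega i c = i%:Z.
Proof.
move=> le_in; rewrite /omega -(big_morph Posz PoszD erefl); congr Posz.
rewrite -[RHS](card_ord i) -sum1_card (big_ord_widen n (fun=> 1%N) le_in) [RHS]big_mkcond.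
by apply: eq_bigr => c _; case: ifP.
Qed.

Section Members.
Variables (C : fieldType) (n : nat).
Notation O := (fps C).
Notation K := {fraction O}.
Notation tK := (tK C).
Notation OK := (@integral C).
Notation lat := (@lat K OK n).
Notation dvr := (fps_dvr C).
Notation tdiag := (@tdiag K tK n).
Notation Theta := (@Theta C n).
Implicit Types (L : 'I_n -> set 'cV[K]_n) (A g : 'M[K]_n).

Lemma lat_scale (x : K) A : [set x *: v | v in lat A] = lat (x *: A).
Proof.
rewrite -mul_scalar_mx -lat_image; congr (_ @` _).
by apply/funext => v; rewrite mul_scalar_mx.
Qed.

Lemma lat_scale_unit (x : K) A : A \in unitmx -> has_val OK tK x 0 -> lat (x *: A) = lat A.
Proof.
move=> AU x0; have xE : theta_mx n n x = x%:M.
  by apply/matrixP => r c; rewrite !mxE ltn_ord.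
have xO := @theta_mx_GLO _ _ _ dvr n n _ x0; rewrite xE in xO.
have e := lat_GLO dvr AU xO; rewrite mul_mx_scalar in e; exact: e.
Qed.

Lemma theta_lat_inv i y A : theta i y @` lat (invmx (Theta i y) *m A) = lat A.
Proof. by rewrite theta_lat (mulKVmx (Theta_unit n i y)). Qed.

Lemma theta_lat_canR i y A B : theta i y @` lat A = lat B -> lat A = lat (invmx (Theta i y) *m B).
Proof.
move=> e; rewrite -lat_image -e theta_lat lat_image (mulKmx (Theta_unit n i y)).
reflexivity.
Qed.

Lemma GGr_sub y L : GGr (y, L) -> forall i j : 'I_n, (i <= j)%N ->
  theta j y @` L j `<=` theta i y @` L i.
Proof.
move=> [_ _ step _] i [j jn] /=; elim: j jn => [|j IH] jn ij.
  have e : i = Ordinal jn by apply/val_inj/eqP; rewrite -leqn0.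
  by rewrite e.
have [ij'|ji] := leqP i j.
  apply: subset_trans (IH (ltnW jn) ij').
  exact: (step (Ordinal (ltnW jn)) (Ordinal jn)).
have e : i = Ordinal jn by apply/val_inj/anti_leq; rewrite ij.
by rewrite e.
Qed.

(** Off the special fibre the inclusions of the chain close up to equalities. *)
Lemma GGr_generic y L A (i0 : 'I_n) : y != 0 -> GGr (y, L) -> i0 = 0%N :> nat ->
  A \in unitmx -> L i0 = lat A -> L = generic_point y A.
Proof.
move=> y0 LG i00 AU LA; have [LGr _ _ last] := LG; have subL := GGr_sub LG.
have n0 : (0 < n)%N := leq_ltn_trans (leq0n _) (ltn_ord i0).
have nn : (n.-1 < n)%N by rewrite prednK.
have th0 : theta i0 y @` L i0 = lat A.
  by rewrite LA i00 theta_lat Theta_id mul1mx.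
apply/funext => i; have [Ai AiU] := (GrP _).1 (LGr i); rewrite [(y, L).2]/= => LAi.
rewrite LAi; apply: theta_lat_canR; rewrite -LAi; apply/seteqP; split.
  by rewrite -th0; apply: subL; rewrite i00.
have := last (Ordinal nn) i0 (prednK n0) i00.
rewrite /= LA lat_scale (lat_scale_unit AU (t_minus_val y0)) => s.
apply: (subset_trans s); apply: (subL i (Ordinal nn)) => /=.
by rewrite -ltnS prednK.
Qed.

Lemma generic_GGr_orbit y g lambda : y != 0 -> GLO OK g ->
  GGr_orbit lambda (y, generic_point y (g *m tdiag lambda)).
Proof.
move=> y0 gO; set A := g *m tdiag lambda; have AU : A \in unitmx := GLO_tdiag_unit lambda gO.
have TU i : invmx (Theta i y) \in unitmx by rewrite unitmx_inv; exact: Theta_unit.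
have [k Ak] := has_valP dvr (unitmx_det_neq0 AU).
have nuE i : nu (generic_point y A i) = k.
  apply: nu_lat; rewrite det_mulmx -[k]add0r; apply: (has_valM dvr _ Ak).
  by have [_ h] := (GLO_detP dvr _).1 (GLOV (Theta_GLO n i y0)).
have thE i : theta i y @` generic_point y A i = lat A by exact: theta_lat_inv.
have zeroE (i : 'I_n) : i = 0%N :> nat -> generic_point y A i = lat A.
  move=> i0; rewrite /generic_point i0 Theta_id invmx1 mul1mx; reflexivity.
have sc : [set t_minus y *: v | v in lat A] = lat A.
  by rewrite lat_scale; exact: (lat_scale_unit AU (t_minus_val y0)).
split; last first.
- by move=> i i0; apply/Gr_orbitP; exists g; [exact: gO|exact: zeroE].
- exact: y0.
split=> [i|i j|i j _|i j _ j0].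
- exact: (Gr_lat (unitmx_mulmx (TU i) AU)).
- by rewrite [LHS]nuE [RHS]nuE.
- rewrite [X in X `<=` _]thE [X in _ `<=` X]thE; exact: subset_refl.
- suff h : [set t_minus y *: v | v in generic_point y A j]
      `<=` theta i y @` generic_point y A i by exact: h.
  have sub_eq (X Y Z : set 'cV[K]_n) : X = Z -> Y = Z -> X `<=` Y by move=> -> ->.
  by rewrite (zeroE j j0); apply: (sub_eq _ _ (lat A) sc); exact: thE.
Qed.

(** On the special fibre the inclusions are those of a periodic chain of lattices
    with steps of colength one, hence given by a common adapted basis. *)
Lemma GGr_special L (i0 : 'I_n) : GGr (0, L) -> i0 = 0%N :> nat ->
  exists g nu (s : 'S_n), iwahori OK tK g /\
    forall i, L i = lat (tdiag (fun c => - omega i c) *m g *m tdiag (chain nu s i)).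
Proof.
move=> LG i00; have [LGr Lnu step last] := LG.
have n0 : (0 < n)%N := leq_ltn_trans (leq0n _) (ltn_ord i0).
have /choice[A AP] : forall i, exists A, A \in unitmx /\ L i = lat A.
  by move=> i; have [A AU LA] := (GrP (L i)).1 (LGr i); exists A.
have AU i : A i \in unitmx by case: (AP i).
have LA i : L i = lat (A i) by case: (AP i).
have [k k0] := has_valP dvr (unitmx_det_neq0 (AU i0)).
have Ak i : has_val OK tK (\det (A i)) k.
  have [ki kiP] := has_valP dvr (unitmx_det_neq0 (AU i)).
  have e : ki = k by rewrite -(nu_lat kiP) -(nu_lat k0) -!LA; exact: Lnu.
  by rewrite -e.
pose B i := if (i < n)%N then Theta i 0 *m A (insubd i0 i) else tK *: A i0.
have BE (i : 'I_n) : B i = Theta i 0 *m A i by rewrite /B ltn_ord valKd.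
have BOE i (ilt : (i < n)%N) : B i = Theta i 0 *m A (Ordinal ilt) := BE (Ordinal ilt).
have Bn : B n = tK *: A i0 by rewrite /B ltnn.
have B0 : B 0%N = A i0 by rewrite -[0%N]i00 BE i00 Theta_id mul1mx.
have BU i : (i <= n)%N -> B i \in unitmx.
  rewrite leq_eqVlt => /orP[/eqP->|ilt].
    by rewrite Bn unitmxZ ?AU // unitfE; exact: (dvr_t_neq0 dvr).
  rewrite (BOE i ilt); exact: unitmx_mulmx (Theta_unit n i 0) (AU _).
have Bval i : (i <= n)%N -> has_val OK tK (\det (B i)) (k + i%:Z).
  rewrite leq_eqVlt => /orP[/eqP->|ilt].
    rewrite Bn detZ addrC exprnP; exact: (has_valM dvr (has_val_tX dvr n) (Ak i0)).
  rewrite (BOE i ilt) det_mulmx Theta0 (det_tdiag dvr) sum_omega; last exact: ltnW.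
  by rewrite addrC; exact: (has_valM dvr (has_val_tX dvr _) (Ak _)).
have Bsub i : (i < n)%N -> lat (B i.+1) `<=` lat (B i).
  move=> ilt; pose oi := Ordinal ilt.
  rewrite (BOE i ilt) -theta_lat -LA.
  have [jn|nj] := ltnP i.+1 n.
    pose oj := Ordinal jn.
    rewrite (BOE _ jn) -theta_lat -LA; exact: (step oi oj).
  have e : i.+1 = n by apply/anti_leq; rewrite ilt.
  rewrite e Bn -lat_scale -LA; have := last oi i0 e i00.
  by rewrite /= t_minus0.
have Bper : lat (B n) = lat (tK *: B 0%N) by rewrite Bn B0.
have [g [nu0 [s [gI BgE]]]] := common_adapted_basis dvr BU Bval Bsub Bper.
exists g, nu0, s; split=> // i.
have e := BgE i (ltnW (ltn_ord i)); rewrite BE -theta_lat in e.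
rewrite LA (theta_lat_canR e) Theta0 (invmx_tdiag dvr) mulmxA.
have -> : chain nu0 s i = fun c => nu0 c + omega i (s c); last by [].
by apply/funext => c; rewrite /chain wind_small // ltnW.
Qed.

(** By [iwahori_conj] the i-th lattice has the position [relpos nu s i], and these
    positions are periodic in i. *)
Lemma special_relpos g nu (s : 'S_n) lambda : (0 < n)%N -> iwahori OK tK g ->
  (forall i : 'I_n,
     Gr_le lambda (lat (tdiag (fun c => - omega i c) *m g *m tdiag (chain nu s i)))) ->
  forall i, dominated lambda (relpos nu s i).
Proof.
move=> n0 gI le_L i; rewrite (divn_eq i n) addnC.
have period q j : relpos nu s (j + q * n) = relpos nu s j.
  by elim: q => [|q IH]; [rewrite mul0n addn0|rewrite mulSnr addnA relpos_period].
rewrite period; have jn : (i %% n < n)%N by rewrite ltn_mod.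
move: (i %% n)%N jn => j jn; pose oj := Ordinal jn.
have chainE : tdiag (chain nu s j) = tdiag (omega j) *m tdiag (relpos nu s j).
  rewrite (tdiagM dvr); congr tdiag; apply/funext => c.
  by rewrite /relpos wind_small ?(ltnW jn) // /omega addrC subrK.
have := le_L oj; rewrite [val oj]/= chainE mulmxA.
by move/(Gr_leP lambda _ (iwahori_conj dvr j gI)).
Qed.

End Members.

(** * Schubert varieties *)

Section MainTheorem.
Variables (C : fieldType) (n : nat).
Notation O := (fps C).
Notation K := {fraction O}.
Notation tK := (tK C).
Notation OK := (@integral C).
Notation lat := (@lat K OK n).
Notation dvr := (fps_dvr C).
Notation tdiag := (@tdiag K tK n).
Notation Theta := (@Theta C n).

Hypothesis infinite : forall r : {poly C}, (forall c, r.[c] = 0) -> r = 0.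

Lemma Gr_orbit_le lambda : Gr_orbit lambda `<=` @Gr_le C n lambda.
Proof.
move=> L /Gr_orbitP[g gO LE]; exists g, lambda; split; [exact: gO| |exact: LE].
by split=> // k.
Qed.

(** The set of dominated lattices is closed by [zclosed_Gr_le], and by
    [dominated_limit] every closed set that contains the orbit contains it. *)
Lemma Gr_schubertE lambda : @Gr_schubert C n lambda = Gr_le lambda.
Proof.
apply/seteqP; split=> [L|L [g [mu [gO dom LE]]] Z [Zc sub]].
  apply; split; last exact: Gr_orbit_le.
  have := @zclosed_Gr_le C n 0 1 lambda.
  have -> : [set p : 'rV[C]_0 * ('I_1 -> set 'cV[K]_n) | forall i, Gr_le lambda (p.2 i)]
      = [set p | Gr_le lambda (p.2 ord0)].
    by apply/seteqP; split=> p; [exact|move=> h i; rewrite ord1; exact: h].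
  exact.
have h : forall i : 'I_1, (1%:M : 'M[K]_n) \in unitmx by move=> _; exact: unitmx1.
have := dominated_limit infinite (y := 0) (h := fun=> 1%:M) (lambda := lambda) Zc h _ dom gO.
rewrite /= mul1mx -LE; apply => g' gO'; apply: sub; apply/Gr_orbitP.
by exists g'; [exact: gO'|rewrite mul1mx].
Qed.

Lemma GGr_generic_le y L (i0 : 'I_n) lambda : y != 0 -> GGr (y, L) -> i0 = 0%N :> nat ->
  Gr_le lambda (L i0) ->
  exists g mu, [/\ GLO OK g, dominated lambda mu & L = generic_point y (g *m tdiag mu)].
Proof.
move=> y0 LG i00 [g [mu [gO dom LE]]]; exists g, mu; split; [exact: gO|exact: dom|].
exact: (GGr_generic y0 LG i00 (GLO_tdiag_unit mu gO) LE).
Qed.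

Lemma generic_point_le y g mu lambda : y != 0 -> GLO OK g -> dominated lambda mu ->
  forall i, Gr_le lambda (generic_point y (g *m tdiag mu) i).
Proof.
move=> y0 gO dom i; rewrite /generic_point mulmxA.
exact/(Gr_leP lambda _ (GLOM dvr (GLOV (Theta_GLO n i y0)) gO)).
Qed.

(** That the right side contains the left one is clear, because it is closed and
    because the lattices of a point off the special fibre have the same position.
    Conversely a closed set that contains the orbit contains the points of the
    right side by [dominated_limit] off the special fibre and by [special_limit]
    on it. *)
Theorem global_schubertE lambda : (0 < n)%N ->
  @global_schubert C n lambda = Xlambda lambda.
Proof.
move=> n0; pose i0 := Ordinal n0.
apply/seteqP; split=> [p|[y L] [LG LS] Z [[W Wc ZE] sub]].
  apply; split=> [|[y L] [LG y0 LO]].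
    exists [set p | forall i, Gr_le lambda (p.2 i)]; first exact: zclosed_Gr_le.
    apply/seteqP; split=> [[y L] [LG LS]|[y L] [LG LS]]; split; try exact: LG.
      by move=> i; have := LS i; rewrite Gr_schubertE.
    by move=> i; rewrite Gr_schubertE; exact: LS.
  split; first exact: LG.
  have [g [mu [gO dom LE]]] := GGr_generic_le y0 LG (erefl : i0 = 0%N :> nat)
    (Gr_orbit_le (LO i0 erefl)).
  move=> i; rewrite Gr_schubertE [(y, L).2]/= LE; exact: generic_point_le.
have LS' i : Gr_le lambda (L i) by rewrite -Gr_schubertE; exact: LS.
have base (x : C) g : x != 0 -> GLO OK g -> W (x%:M, generic_point x (g *m tdiag lambda)).
  move=> x0 gO; have := sub _ (generic_GGr_orbit lambda x0 gO).
  by rewrite ZE => -[].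
rewrite ZE; split; first exact: LG.
have [y_eq0|y0] := eqVneq y 0; last first.
  have [g [mu [gO dom ->]]] := GGr_generic_le y0 LG (erefl : i0 = 0%N :> nat) (LS' i0).
  apply: (dominated_limit infinite Wc _ _ dom gO) => [i|g' gO'].
    by rewrite unitmx_inv; exact: Theta_unit.
  exact: base.
rewrite y_eq0 in LG *.
have [g [nu [s [gI LE]]]] := GGr_special LG (erefl : i0 = 0%N :> nat).
have dom := special_relpos n0 gI (lambda := lambda).
have {}dom : forall i, dominated lambda (relpos nu s i).
  by apply: dom => i; rewrite -LE; exact: LS'.
have LF : L = fun i : 'I_n => lat (tdiag (fun c => - omega i c) *m g *m tdiag (chain nu s i)).
  by apply/funext.
have := special_limit infinite Wc base dom gI; rewrite -LF.
have -> : (0 : 'rV[C]_1) = 0%:M by apply/matrixP => r c; rewrite !mxE mul0rn.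
exact.
Qed.

End MainTheorem.

Lemma infinite_poly (F : numFieldType) (r : {poly F}) : (forall c, r.[c] = 0) -> r = 0.
Proof.
move=> r0; apply/eqP; apply: contraT => rn0.
have := max_poly_roots rn0 (rs := [seq k%:R | k <- iota 0 (size r)]).
rewrite size_map size_iota ltnn; apply.
  by apply/allP => c _; apply/eqP.
by rewrite map_inj_uniq ?iota_uniq // => i j /eqP; rewrite eqr_nat => /eqP.
Qed.

Theorem theorem1p1 (R : realType) (n : nat) (hn : (0 < n)%N)
    (lambda : 'I_n -> int) (hlambda : dominant lambda) :
  global_schubert (C := R[i]%C) lambda = Xlambda (C := R[i]%C) lambda.
Proof. exact: (global_schubertE (@infinite_poly _) lambda hn). Qed.
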